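(* Let $Y$ be an $n$-dimensional Gaussian random variable with law $\nu$, and let $X$ be an $n$-dimensional random variable whose law $\mu$ is given by $$\mu(dx)=\frac{1}{Z}e^{-V(x)}\,\nu(dx),\qquad Z:=\int_{\mathbb{R}^n}e^{-V(x)}\,\nu(dx)<\infty,$$ where $V:\mathbb{R}^n\to\mathbb{R}$ is a convex function. Let $v\in\mathbb{R}^n$, $v\neq 0$, and set $\mathsf{a}:=\mathrm{var}(v\cdot Y)$, where $\mathsf{a}>0$. Then for every convex function $\psi:\mathbb{R}\to\mathbb{R}$ the following hold. (i) One has $$E\left[\psi\left(v\cdot Y-E[v\cdot Y]\right)\right]\ \ge\ E\left[\psi\left(v\cdot X-E[v\cdot X]\right)\right],$$ and, more precisely, $$E\left[\psi\left(v\cdot Y-E[v\cdot Y]\right)\right]\ \ge\ E\left[\psi\left(v\cdot X-E[v\cdot X]\right)\right]+\frac12\int_{\mathbb{R}}\psi''(dx)\int_0^{\mathsf{a}^{-1}\left(\mathsf{a}-\mathrm{var}(v\cdot X)\right)^2}ds\,\mathsf{p}\left(s;\sqrt{x^2+\mathsf{a}}\right).$$ (ii) For every $p>1$, with $q$ the conjugate exponent of $p$ (that is, $p^{-1}+q^{-1}=1$), $$E\left[\psi\left(v\cdot Y-E[v\cdot Y]\right)\right]\ \le\ E\left[\psi\left(v\cdot X-E[v\cdot X]\right)\right]+C(\mathsf{a},\psi,q)\left(\mathsf{a}-\mathrm{var}(v\cdot X)\right)^{\frac{1}{2p}},$$ where $C(\mathsf{a},\psi,q)\in[0,\infty]$ is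 given by $$C(\mathsf{a},\psi,q)=\left(\mathsf{a}(1+q)\right)^{\frac{1}{2q}}\int_{\mathbb{R}}\psi''(dx)\,\mathsf{p}\left(1;\frac{x}{\sqrt{\mathsf{a}(1+q)}}\right).$$ (Here $\mathsf{a}-\mathrm{var}(v\cdot X)\ge 0$ by the first inequality of (i).) All these inequalities are understood to hold also in the case that both sides are infinite.
   Context: The random variables $X,Y$ are defined on a probability space $(\Omega,\mathcal{F},P)$, and $E$ is expectation with respect to $P$. For a one-dimensional random variable $\xi$, $\mathrm{var}(\xi)=E[(\xi-E[\xi])^2]$. For $a,b\in\mathbb{R}^n$, $a\cdot b$ is the inner product. For $t>0$ and $x\in\mathbb{R}$, $$\mathsf{p}(t;x):=\frac{1}{\sqrt{2\pi t}}\exp\left(-\frac{x^2}{2t}\right).$$ For convex $\psi$ on $\mathbb{R}$, $\psi''(dx)$ denotes the second derivative of $\psi$ in the sense of distributions, a nonnegative (locally finite) measure on $\mathbb{R}$. The convention $\infty\cdot 0=0$ is used for the product in (ii). *)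

(* Defs.v *)
From HB Require Import structures.
From mathcomp Require Import all_boot all_order all_algebra.
From mathcomp Require Import all_classical all_reals all_analysis.

Set Implicit Arguments.
Unset Strict Implicit.
Unset Printing Implicit Defensive.

Import Order.TTheory GRing.Theory Num.Theory.
Import numFieldNormedType.Exports.

Local Open Scope classical_set_scope.
Local Open Scope ring_scope.

(* R^n is 'rV[R]_n with its Borel sigma-algebra. *)
Section borel_matrix.
Context (R : realType) (m n : nat).
Let G : set (set 'M[R]_(m, n)) := open.

Let borel0 : <<s G >> set0.
Proof. exact: sigma_algebra0. Qed.

Let borelC A : <<s G >> A -> <<s G >> (~` A).
Proof. by rewrite -setTD; exact: sigma_algebraCD. Qed.

Let borel_bigcup (F : (set 'M[R]_(m, n))^nat) :
  (forall i, <<s G >> (F i)) -> <<s G >> (\bigcup_i F i).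
Proof. exact: sigma_algebra_bigcup. Qed.

HB.instance Definition _ := @isMeasurable.Build (sigma_display G)
  'M[R]_(m, n) <<s G >> borel0 borelC borel_bigcup.

End borel_matrix.

Definition dot (R : realType) (n : nat) (a b : 'rV[R]_n) : R :=
  \sum_(i < n) a ord0 i * b ord0 i.

(* Every linear form has a normal law; the variance-zero case is the Dirac mass,
   spelled out because [normal_prob m 0] is not the Dirac mass at m but a dummy
   (uniform) law. *)
Definition gaussian_law (R : realType) (n : nat)
    (nu : probability 'rV[R]_n R) : Prop :=
  forall u : 'rV[R]_n, exists m : R,
    (exists2 s : R, 0 < s & forall B : set R, measurable B ->
        nu (dot u @^-1` B) = normal_prob m s B)
    \/ (forall B : set R, measurable B -> nu (dot u @^-1` B) = \d_m B).

Definition test_function (R : realType) (phi : R -> R) : Prop :=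
  (forall (k : nat) (x : R), derivable (phi^`(k)%classic) x 1) /\
  compact (closure [set x | phi x != 0]).

(* m is the measure psi''(dx): the distribution <psi'', phi> = <psi, phi''> is
   integration against m. *)
Definition second_derivative_measure (R : realType) (psi : R -> R)
    (m : {measure set R -> \bar R}) : Prop :=
  (forall K : set R, compact K -> (m K < +oo)%E) /\
  (forall phi : R -> R, test_function phi ->
    \int[m]_x (phi x)%:E =
    \int[lebesgue_measure]_x (psi x * (phi^`(2)%classic) x)%:E)%E.

Definition heat_kernel (R : realType) (t x : R) : R :=
  (Num.sqrt (2 * pi * t))^-1 * expR (- (x ^+ 2 / (2 * t))).

(* The constant C(a, psi, q), as a function of m = psi''(dx). *)
Definition Cconst (R : realType) (a : R) (m : {measure set R -> \bar R})
    (q : R) : \bar R :=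
  (((a * (1 + q)) `^ (2 * q)^-1)%:E *
   \int[m]_x (heat_kernel 1 (x / Num.sqrt (a * (1 + q))))%:E)%E.

(* Main.v *)
(** By the Gaussian splitting Y = Y' + N b with N standard normal and independent
    of Y', and by a one-dimensional Prékopa argument repeated over the
    coordinates, the law of f = (v.X - E[v.X]) / sqrt a has a density
    phi e^{-U} with U convex, while g = (v.Y - E[v.Y]) / sqrt a is standard
    normal.  Let T, S, K be the tail P(f > x) and its successive integrals
    E(f - x)^+ and E((f - x)^+)^2, and let Q, G, H be the same for the normal
    law.  Since the density ratio is log-concave, comparing the tails at points
    where they agree shows S <= G, and controls G - S from below and from above
    in terms of the variance deficit 1 - E f^2, the optimal competitors being
    normal tails shifted to a common level.  The representation
    E psi(s h) = psi 0 + int E kern(s h, x) psi''(dx) for centred h turns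
    these pointwise bounds into the inequalities. *)
Require Import Defs.
From HB Require Import structures.
From mathcomp Require Import all_boot all_order all_algebra.
From mathcomp Require Import all_classical all_reals all_analysis.
From mathcomp Require Import measurable_realfun.
From mathcomp Require Import ring lra.
Set Implicit Arguments.
Unset Strict Implicit.
Unset Printing Implicit Defensive.
Import Order.TTheory GRing.Theory Num.Theory.
Import numFieldNormedType.Exports.
Local Open Scope classical_set_scope.
Local Open Scope ring_scope.

(** Three obstacles shape the argument. [gaussian_law] only speaks of one-dimensional marginals and
    allows degenerate covariances, so there is neither a density on R^n nor a ready independence:
    the splitting is obtained as an equality of laws, recognised from integrals of cosines of linear
    forms. The measure psi'' is known through smooth test functions only, whereas the representation
    kernel is piecewise linear: it is reached through smoothed hat functions. The inequality between
    the two expectations is claimed before any measure psi'' is given, so it has its own proof,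
    which compares psi with a chord through the sign changes of U. All gap bounds rest on one
    differential inequality for E = G - S: where E equals G w, the slope of E is at least that of G
    at w. Hence, if E x = G M, then E (x + l) lies between G (M + |l|) and G (M - |l|), and
    integration over the line constrains the deficit d, which is twice the integral of E. The lower
    bound in (i) becomes M d <= sqrt (1 + x^2), which leaves little room and is checked with
    rational tangent lines; (ii) interpolates between E <= phi and E <= phi 0 * sqrt d. *)

Section calculus.
Context {R : realType}.
Implicit Types (f g df : R -> R) (a b x l : R).

Lemma is_derive_continuous f df x : is_derive x 1 f (df x) -> {for x, continuous f}.
Proof. by move=> H; apply/differentiable_continuous/derivable1_diffP. Qed.

Lemma MVT_itv f df a b : a < b -> (forall x, a <= x <= b -> is_derive x 1 f (df x)) ->
  exists2 c, a < c < b & f b - f a = df c * (b - a).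
Proof.
move=> ab fdf.
have [c cab E] : exists2 c, c \in `]a, b[ & f b - f a = df c * (b - a).
  apply: MVT => //.
    by move=> x /[!in_itv]/= /andP[ax xb]; apply: fdf; rewrite !ltW.
  apply: derivable_within_continuous => x /[!in_itv]/= /fdf H.
  by case: H.
by exists c => //; move: cab; rewrite in_itv.
Qed.

Lemma derive_le0_le f df a b : a <= b -> (forall x, a <= x <= b -> is_derive x 1 f (df x)) ->
  (forall x, a < x < b -> df x <= 0) -> f b <= f a.
Proof.
rewrite le_eqVlt => /predU1P[-> //|ab] fdf dfle.
have [c cab E] := MVT_itv ab fdf.
by rewrite -subr_le0 E mulr_le0_ge0// ?dfle// subr_ge0 ltW.
Qed.

Lemma derive_ge0_le f df a b : a <= b -> (forall x, a <= x <= b -> is_derive x 1 f (df x)) ->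
  (forall x, a < x < b -> 0 <= df x) -> f a <= f b.
Proof.
rewrite le_eqVlt => /predU1P[-> //|ab] fdf dfle.
have [c cab E] := MVT_itv ab fdf.
by rewrite -subr_ge0 E mulr_ge0// ?dfle// subr_ge0 ltW.
Qed.

Lemma derive_lt0_lt f df a b : a < b -> (forall x, a <= x <= b -> is_derive x 1 f (df x)) ->
  (forall x, a < x < b -> df x < 0) -> f b < f a.
Proof.
move=> ab fdf dfle.
have [c cab E] := MVT_itv ab fdf.
by rewrite -subr_lt0 E nmulr_rlt0 ?dfle// subr_gt0.
Qed.

Lemma IVT_le f df a b v : a <= b -> (forall x, is_derive x 1 f (df x)) ->
  f b <= v <= f a -> exists2 c, a <= c <= b & f c = v.
Proof.
move=> ab fdf fv.
have [||c cab fc] := @IVT R f a b v ab; last by exists c; [move: cab; rewrite in_itv|].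
- apply: continuous_subspaceT => x; exact: is_derive_continuous.
- by case/andP: fv => ? ?; rewrite ge_min le_max; apply/andP; split; apply/orP; [right|left].
Qed.

Lemma noninc_cvgy_le f l a : (forall x y, a <= x -> x <= y -> f y <= f x) ->
  f x @[x --> +oo] --> l -> forall x, a <= x -> l <= f x.
Proof.
move=> nf fl x ax; apply: (@cvgr_to_le _ _ _ _ f l (f x) fl).
by apply: filterS (nbhs_pinfty_ge (num_real x)) => y; exact: nf.
Qed.

Lemma cvgy_lt f l a b : f x @[x --> +oo] --> l -> l < b -> exists2 y, a < y & f y < b.
Proof.
move=> fl lb; have H : \forall y \near +oo, a < y /\ f y < b.
  by apply: filterS2 (nbhs_pinfty_gt (num_real a)) (cvgr_lt _ fl _ lb) => y.
by have [y [? ?]] := filter_ex H; exists y.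
Qed.

Lemma cvgy_gt f l a b : f x @[x --> +oo] --> l -> b < l -> exists2 y, a < y & b < f y.
Proof.
move=> fl lb; have H : \forall y \near +oo, a < y /\ b < f y.
  by apply: filterS2 (nbhs_pinfty_gt (num_real a)) (cvgr_gt _ fl _ lb) => y.
by have [y [? ?]] := filter_ex H; exists y.
Qed.

Lemma cvgNy_lt f l a b : f x @[x --> -oo] --> l -> l < b -> exists2 y, y < a & f y < b.
Proof.
move=> fl lb; have H : \forall y \near -oo, y < a /\ f y < b.
  by apply: filterS2 (nbhs_ninfty_lt (num_real a)) (cvgr_lt _ fl _ lb) => y.
by have [y [? ?]] := filter_ex H; exists y.
Qed.

Lemma cvgNy_gt f l a b : f x @[x --> -oo] --> l -> b < l -> exists2 y, y < a & b < f y.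
Proof.
move=> fl lb; have H : \forall y \near -oo, y < a /\ b < f y.
  by apply: filterS2 (nbhs_ninfty_lt (num_real a)) (cvgr_gt _ fl _ lb) => y.
by have [y [? ?]] := filter_ex H; exists y.
Qed.

(** Lets each differentiation rule be stated for explicit lambda-terms, with a derivative of any
    shape, so that computing a derivative ends in a [ring] or [field] goal. *)
Lemma is_derive_ext f g a b x : is_derive x 1 f a -> f =1 g -> a = b -> is_derive x 1 g b.
Proof. by move=> H /funext <- <-. Qed.

Lemma is_deriveD' f g a b x : is_derive x 1 f a -> is_derive x 1 g b ->
  is_derive x 1 (fun z => f z + g z) (a + b).
Proof. by move=> Hf Hg; apply: is_derive_ext (is_deriveD Hf Hg) _ _. Qed.

Lemma is_deriveB' f g a b x : is_derive x 1 f a -> is_derive x 1 g b ->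
  is_derive x 1 (fun z => f z - g z) (a - b).
Proof. by move=> Hf Hg; apply: is_derive_ext (is_deriveB Hf Hg) _ _. Qed.

Lemma is_deriveN' f a x : is_derive x 1 f a -> is_derive x 1 (fun z => - f z) (- a).
Proof. by move=> Hf; apply: is_derive_ext (is_deriveN Hf) _ _. Qed.

Lemma is_deriveM' f g a b x : is_derive x 1 f a -> is_derive x 1 g b ->
  is_derive x 1 (fun z => f z * g z) (a * g x + f x * b).
Proof.
move=> Hf Hg; apply: is_derive_ext (is_deriveM Hf Hg) _ _ => //.
by rewrite addrC /GRing.scale/= mulrC.
Qed.

Lemma is_deriveX' f n a x : is_derive x 1 f a ->
  is_derive x 1 (fun z => f z ^+ n) (n%:R * f x ^+ n.-1 * a).
Proof.
by move=> Hf; apply: is_derive_ext (is_deriveX n Hf) _ _ => // z; rewrite exprfctE.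
Qed.

Lemma is_deriveV' f a x : f x != 0 -> is_derive x 1 f a ->
  is_derive x 1 (fun z => (f z)^-1) (- a / f x ^+ 2).
Proof.
move=> fx Hf; apply: is_derive_ext (is_deriveV fx Hf) _ _ => //.
by rewrite /GRing.scale/= !mulNr mulrC.
Qed.

Lemma is_derive_cst' (c x : R) : is_derive x 1 (fun=> c) 0.
Proof. exact: is_derive_cst. Qed.

Lemma is_derive_id' (x : R) : is_derive x 1 (fun z : R => z) 1.
Proof. exact: is_derive_id. Qed.

Lemma is_derive_comp' f g a b x : is_derive (g x) 1 f a -> is_derive x 1 g b ->
  is_derive x 1 (fun z => f (g z)) (a * b).
Proof. by move=> Hf Hg; apply: is_derive_ext (is_derive1_comp Hf Hg) _ _. Qed.

Lemma is_derive_affine (m c x : R) : is_derive x 1 (fun z => m * z + c) m.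
Proof.
apply: is_derive_ext (is_deriveD' (is_deriveM' (is_derive_cst' m x) (is_derive_id' x)) (is_derive_cst' c x)) _ _ => //.
by rewrite mul0r add0r mulr1 addr0.
Qed.

Lemma is_derive_shift f df c x : (forall x, is_derive x 1 f (df x)) ->
  is_derive x 1 (fun z => f (c + z)) (df (c + x)).
Proof.
move=> fdf; apply: is_derive_ext (is_derive_comp' (g := fun z => 1 * z + c) (fdf _) (is_derive_affine 1 c x)) _ _.
  by move=> z /=; rewrite mul1r addrC.
by rewrite mulr1 mul1r addrC.
Qed.

Lemma is_derive_flip f df c x : (forall x, is_derive x 1 f (df x)) ->
  is_derive x 1 (fun z => f (c - z)) (- df (c - x)).
Proof.
move=> fdf; apply: is_derive_ext (is_derive_comp' (g := fun z => -1 * z + c) (fdf _) (is_derive_affine (-1) c x)) _ _.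
  by move=> z /=; rewrite mulN1r addrC.
by rewrite mulrN1 mulN1r addrC.
Qed.

Lemma is_derive_expR' f a x : is_derive x 1 f a ->
  is_derive x 1 (fun z => expR (f z)) (expR (f x) * a).
Proof. by move=> H; apply: is_derive_comp'. Qed.

Lemma cvgy_ext f g l : f x @[x --> +oo] --> l -> f =1 g -> g x @[x --> +oo] --> l.
Proof. by move=> fl /funext <-. Qed.

Lemma cvgy_shift f l c : f z @[z --> +oo] --> l -> f (c + z) @[z --> +oo] --> l.
Proof.
move=> fl; apply: (@cvg_comp _ _ _ (fun z => c + z) f _ (+oo%R)) => //.
by rewrite (_ : (fun z => c + z) = (fun z => z + c)); [exact: cvg_addrr|apply/funext => z; rewrite addrC].
Qed.

End calculus.

Section convR.
Context {R : realType}.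
Implicit Types (f : R -> R).

Definition cvxR f := forall t x y, 0 <= t -> t <= 1 ->
  f (t * x + (1 - t) * y) <= t * f x + (1 - t) * f y.

(** Sublevel sets of a convex function are intervals; in this form convexity excludes the sign
    pattern -, +, - for U. *)
Lemma cvxR_between f a b c l : cvxR f -> a <= b -> b <= c -> f a <= l -> f c <= l -> f b <= l.
Proof.
move=> cf ab bc fa fc.
have [ac|ac] := eqVneq a c.
  by have -> : b = a by apply/eqP; rewrite eq_le ab andbT ac.
have {}ac : 0 < c - a by rewrite subr_gt0 lt_neqAle ac (le_trans ab).
have t0 : 0 <= (c - b) / (c - a) by apply: divr_ge0; rewrite ?subr_ge0// ltW// -subr_gt0.
have t1 : (c - b) / (c - a) <= 1.
  by rewrite ler_pdivrMr// mul1r lerD2l lerN2.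
have := cf _ a c t0 t1.
have -> : (c - b) / (c - a) * a + (1 - (c - b) / (c - a)) * c = b.
  by field; rewrite gt_eqF.
move=> /le_trans; apply; move: t0 t1; set t := (_ / _) => t0 t1.
have -> : l = t * l + (1 - t) * l by ring.
by apply: lerD; apply: ler_wpM2l => //; rewrite subr_ge0.
Qed.

End convR.

(** * The standard normal density, its tail and the iterated integrals of the tail *)

Section gauss_fun.
Context {R : realType}.
Implicit Types (x y s w l : R).

Definition phi x : R := (Num.sqrt (2 * pi))^-1 * expR (- (x ^+ 2 / 2)).

Lemma sqrt2pi_gt0 : 0 < (Num.sqrt (2 * pi))^-1 :> R.
Proof. by rewrite invr_gt0 sqrtr_gt0 mulr_gt0// pi_gt0. Qed.

Lemma phi_gt0 x : 0 < phi x.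
Proof. by rewrite mulr_gt0 ?sqrt2pi_gt0 ?expR_gt0. Qed.

Lemma phiN x : phi (- x) = phi x.
Proof. by rewrite /phi sqrrN. Qed.

Lemma is_derive_phi x : is_derive x 1 phi (- (x * phi x)).
Proof.
have H : is_derive x 1 (fun z : R => z * z) (1 * x + x * 1).
  by apply: is_deriveM'; exact: is_derive_id'.
have H2 : is_derive x 1 (fun z : R => - (z ^+ 2 / 2)) (- x).
  apply: is_derive_ext (is_deriveM' (is_derive_cst' (- 2^-1) x) H) _ _.
    by move=> z /=; rewrite expr2; field.
  by field.
apply: is_derive_ext (is_deriveM' (is_derive_cst' (Num.sqrt (2 * pi))^-1 x) (is_derive_expR' H2)) _ _ => //.
by rewrite /phi; ring.
Qed.

(** From exp y >= 1 + y at y = x^2 / 2. *)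
Lemma phi_le x : 0 < x -> phi x <= (2 * (Num.sqrt (2 * pi))^-1) / x ^+ 2.
Proof.
move=> x0; rewrite mulrAC [leRHS]mulrC ler_wpM2l ?(ltW sqrt2pi_gt0)//.
have x20 : 0 < x ^+ 2 by rewrite exprn_gt0.
rewrite expRN invf_ple// ?posrE ?expR_gt0 ?divr_gt0// invf_div.
by apply: le_trans (expR_ge1Dx _); rewrite lerDr.
Qed.

Lemma cvgy0_bound (f : R -> R) (C : R) : (forall x, 0 < x -> `|f x| <= C / x) ->
  f x @[x --> +oo] --> 0.
Proof.
move=> fC; apply/cvgrPdist_le => e e0.
have C0 : 0 <= C by have := fC 1 ltr01; rewrite divr1; exact: le_trans.
apply: filterS (nbhs_pinfty_gt (num_real (C / e))) => x Cx.
have x0 : 0 < x by rewrite (le_lt_trans _ Cx)// divr_ge0// ltW.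
rewrite sub0r normrN (le_trans (fC _ x0))// ler_pdivrMr// mulrC -ler_pdivrMr//.
exact: ltW.
Qed.

(** The constant of [phi_le], so that phi x <= mills / x^2. *)
Definition mills := (2 * (Num.sqrt (2 * pi))^-1) : R.

Lemma phi_cvgy : phi x @[x --> +oo] --> 0.
Proof.
apply: (@cvgy0_bound _ (mills + (Num.sqrt (2 * pi))^-1)) => x x0.
have p0 := sqrt2pi_gt0.
rewrite gtr0_norm ?phi_gt0//; have [x1|x1] := leP 1 x.
  apply: le_trans (phi_le x0) _; rewrite expr2 invfM mulrA ler_pM2r ?invr_gt0//.
  rewrite ler_pdivrMr// /mills; nra.
have : phi x <= (Num.sqrt (2 * pi))^-1.
  rewrite /phi ler_piMr 1?ltW// -expR0 ltr_expR.
  by rewrite oppr_lt0 divr_gt0// exprn_gt0.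
move=> /le_trans; apply; rewrite ler_pdivlMr// /mills; nra.
Qed.

End gauss_fun.

Section gauss_tail.
Context {R : realType}.
Implicit Types (x y s w l : R).
Variable Q : R -> R.
Hypothesis dQ : forall x, is_derive x 1 Q (- phi x).
Hypothesis Qy : Q x @[x --> +oo] --> 0.
Hypothesis QNy : Q (- x) @[x --> +oo] --> (1 : R).

(** For a standard normal N with tail Q, these are E (N - x)^+ and E ((N - x)^+)^2 after integration
    by parts. Q is known by its derivative and its limits only, so that it can later be the tail of
    the given Gaussian variable itself. *)
Definition Gf x := phi x - x * Q x.
Definition Hf x := (1 + x ^+ 2) * Q x - x * phi x.

Let dQle (a b : R) : a < b -> Q b < Q a.
Proof.
move=> ab; apply: derive_lt0_lt ab (fun x _ => dQ x) _ => x _.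
by rewrite oppr_lt0 phi_gt0.
Qed.

Lemma Q_lt a b : (Q b < Q a) = (a < b).
Proof.
have [ab|] := ltP a b; first by rewrite dQle.
by rewrite le_eqVlt => /predU1P[->|/dQle ba]; rewrite ?ltxx// ltNge ltW.
Qed.

Lemma Q_le a b : (Q b <= Q a) = (a <= b).
Proof. by rewrite !leNgt Q_lt. Qed.

Lemma Q_ge0 x : 0 <= Q x.
Proof.
apply: (@noninc_cvgy_le _ Q 0 x _ Qy x) => // y z _; by rewrite Q_le.
Qed.

Lemma Q_gt0 x : 0 < Q x.
Proof. by rewrite (le_lt_trans (Q_ge0 (x + 1)))// Q_lt ltrDl. Qed.

(** The sum Q (- x) + Q x has derivative 0 and tends to 1 at infinity. *)
Lemma QN x : Q (- x) = 1 - Q x.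
Proof.
pose f z := Q (0 - z) + Q z.
have df (z : R) : is_derive z 1 f 0.
  apply: is_derive_ext (is_deriveD' (is_derive_flip 0 z dQ) (dQ z)) _ _ => //.
  by rewrite sub0r phiN; ring.
have fc y z : f y = f z.
  have : forall y z, y <= z -> f y <= f z by move=> a b ab; apply: derive_ge0_le ab (fun x _ => df x) _.
  have : forall y z, y <= z -> f z <= f y by move=> a b ab; apply: derive_le0_le ab (fun x _ => df x) _.
  move=> H1 H2; apply/eqP; rewrite eq_le.
  by have [yz|/ltW zy] := leP y z; rewrite ?(H1 _ _ yz) ?(H2 _ _ yz) ?(H1 _ _ zy) ?(H2 _ _ zy).
have f1 : f z @[z --> +oo] --> (1 + 0 : R).
  by apply: cvgD => //; under eq_fun do rewrite sub0r.
have : f x = 1.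
  rewrite addr0 in f1; apply: (cvg_unique _ _ f1) => //.
  rewrite (_ : f = cst (f x)); first exact: cvg_cst.
  by apply/funext => z; exact: fc.
by rewrite /f sub0r => <-; rewrite addrK.
Qed.

Lemma Q_lt1 x : Q x < 1.
Proof. by rewrite -subr_gt0 -QN Q_gt0. Qed.

Lemma Q0 : Q 0 = 2^-1.
Proof. have := QN 0; rewrite oppr0; lra. Qed.

(** Mills' bound: phi z / z - Q z has derivative - phi z / z^2 and tends to 0, so it is
    nonnegative. *)
Lemma Q_mills x : 0 < x -> x * Q x <= phi x.
Proof.
move=> x0; rewrite mulrC -ler_pdivlMr// -subr_ge0.
pose f z := phi z / z - Q z.
have df (z : R) : 0 < z -> is_derive z 1 f (- (phi z / z ^+ 2)).
  move=> z0; apply: is_derive_ext (is_deriveB' (is_deriveM' (is_derive_phi z) (is_deriveV (f := id) _ (is_derive_id' z))) (dQ z)) _ _ => //.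
    by rewrite gt_eqF.
  rewrite /GRing.scale/=; field; by rewrite gt_eqF.
have f0 : f z @[z --> +oo] --> 0.
  rewrite -[X in _ --> X](subr0 0); apply: cvgB => //.
  apply: (@cvgy0_bound _ _ (Num.sqrt (2 * pi))^-1) => z z0.
  rewrite gtr0_norm ?divr_gt0 ?phi_gt0// ltW// ltr_pM2r ?invr_gt0//.
  rewrite /phi gtr_pMr ?sqrt2pi_gt0// -[ltRHS]expR0 ltr_expR.
  by rewrite oppr_lt0 divr_gt0// exprn_gt0.
apply: (@noninc_cvgy_le _ f 0 x _ f0 x) => // y z xy yz.
apply: (derive_le0_le yz (df := fun t => - (phi t / t ^+ 2))).
  by move=> t /andP[yt _]; apply: df; rewrite (lt_le_trans x0)// (le_trans xy).
by move=> t _; rewrite oppr_le0 divr_ge0 ?sqr_ge0// ltW ?phi_gt0.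
Qed.

Lemma dG x : is_derive x 1 Gf (- Q x).
Proof.
apply: is_derive_ext (is_deriveB' (is_derive_phi x) (is_deriveM' (is_derive_id' x) (dQ x))) _ _ => //.
ring.
Qed.

Lemma dH x : is_derive x 1 Hf (- (2 * Gf x)).
Proof.
have H1 : is_derive x 1 (fun z : R => 1 + z ^+ 2) (2 * x).
  apply: is_derive_ext (is_deriveD' (is_derive_cst' 1 x) (is_deriveM' (is_derive_id' x) (is_derive_id' x))) _ _.
    by move=> z /=; rewrite expr2.
  ring.
apply: is_derive_ext (is_deriveB' (is_deriveM' H1 (dQ x)) (is_deriveM' (is_derive_id' x) (is_derive_phi x))) _ _ => //.
rewrite /Gf; ring.
Qed.

Lemma Gy : Gf x @[x --> +oo] --> 0.
Proof.
apply: (squeeze_cvgr (f := fun=> 0) (h := phi)); last 2 first.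
  exact: cvg_cst.
  exact: phi_cvgy.
apply: filterS (nbhs_pinfty_gt (num_real 0)) => x x0.
rewrite /Gf subr_ge0 Q_mills//= gerBl mulr_ge0 ?Q_ge0//; exact: ltW.
Qed.

Let G_lt_ (a b : R) : a < b -> Gf b < Gf a.
Proof.
move=> ab; apply: derive_lt0_lt ab (fun x _ => dG x) _ => x _.
by rewrite oppr_lt0 Q_gt0.
Qed.

Lemma G_lt a b : (Gf b < Gf a) = (a < b).
Proof.
have [ab|] := ltP a b; first by rewrite G_lt_.
by rewrite le_eqVlt => /predU1P[->|/G_lt_ ba]; rewrite ?ltxx// ltNge ltW.
Qed.

Lemma G_le a b : (Gf b <= Gf a) = (a <= b).
Proof. by rewrite !leNgt G_lt. Qed.

Lemma G_ge0 x : 0 <= Gf x.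
Proof.
apply: (@noninc_cvgy_le _ Gf 0 x _ Gy x) => // y z _; by rewrite G_le.
Qed.

Lemma G_gt0 x : 0 < Gf x.
Proof. by rewrite (le_lt_trans (G_ge0 (x + 1)))// G_lt ltrDl. Qed.

Lemma GN x : Gf (- x) = Gf x + x.
Proof. by rewrite /Gf phiN QN; ring. Qed.

Lemma HN x : Hf (- x) = 1 + x ^+ 2 - Hf x.
Proof. by rewrite /Hf phiN QN sqrrN; ring. Qed.

Lemma G_surj v : 0 < v -> exists u, Gf u = v.
Proof.
move=> v0; have [b b0 Gb] := cvgy_lt (- v) Gy v0.
have vG : v < Gf (- v) by rewrite GN ltrDr G_gt0.
have [|u _ <-] := IVT_le (ltW b0) dG (v := v); last by exists u.
by rewrite !ltW.
Qed.

Lemma Q_surj v : 0 < v < 1 -> exists u, Q u = v.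
Proof.
case/andP => v0 v1; have [b b0 Qb] := cvgy_lt 0 Qy v0.
have [a a0 Qa] := cvgy_gt 0 QNy v1.
have [||u _ <-] := IVT_le (a := - a) (b := b) (v := v) _ dQ; last by exists u.
  by rewrite (le_trans (y := 0))// ?oppr_le0 ltW.
by rewrite !ltW.
Qed.

Lemma Hy : Hf x @[x --> +oo] --> 0.
Proof.
have p0 := @sqrt2pi_gt0 R.
apply: (@cvgy0_bound _ _ (mills + 1)) => x x0.
have xp : phi x <= mills / x ^+ 2 by exact: phi_le.
have xQ := Q_mills x0; have q0 := Q_ge0 x; have f0 := phi_gt0 x.
have x20 : 0 < x ^+ 2 by rewrite exprn_gt0.
have m0 : 0 <= (mills : R) by rewrite /mills mulr_ge0// ltW.
have xf : x * phi x <= mills / x.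
  by rewrite ler_pdivlMr// mulrAC -expr2 mulrC -ler_pdivlMr.
have mx : mills / x <= (mills + 1) / x by rewrite ler_pM2r ?invr_gt0// lerDl.
rewrite ler_norml; apply/andP; split.
  rewrite lerNl opprB (le_trans _ mx)// (le_trans _ xf)// lerBlDr lerDl mulr_ge0// addr_ge0//; exact: ltW.
have E : Hf x = Q x - x * Gf x by rewrite /Hf /Gf; ring.
rewrite E; apply: (@le_trans _ _ (Q x)).
  by rewrite gerBl mulr_ge0 ?G_ge0// ltW.
have [x1|x1] := leP 1 x.
  apply: (le_trans _ mx); apply: (le_trans _ xf).
  apply: (@le_trans _ _ (phi x)); last by rewrite ler_peMl// ltW.
  by rewrite (le_trans _ xQ)// ler_peMl.
apply: (@le_trans _ _ 1); first exact/ltW/Q_lt1.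
rewrite ler_pdivlMr// mul1r; lra.
Qed.

End gauss_tail.

(** * Tails of log-concave perturbations of the normal law, compared at equal level *)

Section tail_system.
Context {R : realType}.
Implicit Types (x y s w l : R).

(* T, S, K stand for the tail P(X > x), the stop-loss E(X - x)^+ and E((X - x)^+)^2
   of a centred X with density phi * e^(-U) and variance 1 - d. *)
Record tails (U T S K : R -> R) (d : R) : Prop := Tails {
  tails_cvx : cvxR U ;
  tails_dT : forall x, is_derive x 1 T (- (phi x * expR (- U x))) ;
  tails_dS : forall x, is_derive x 1 S (- T x) ;
  tails_dK : forall x, is_derive x 1 K (- (2 * S x)) ;
  tails_Ty : T x @[x --> +oo] --> (0 : R) ;
  tails_Sy : S x @[x --> +oo] --> (0 : R) ;
  tails_Ky : K x @[x --> +oo] --> (0 : R) ;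
  tails_TNy : T (- x) @[x --> +oo] --> (1 : R) ;
  tails_SNy : S (- x) - x @[x --> +oo] --> (0 : R) ;
  tails_KNy : 1 - d + x ^+ 2 - K (- x) @[x --> +oo] --> (0 : R) }.

(** Passage from X to - X: centring gives E (- X - x)^+ = S (- x) - x, and the variance gives the
    second-order analogue. Every right-sided estimate thereby yields a left-sided one. *)
Lemma tails_reflect U T S K d : tails U T S K d ->
  tails (fun x => U (- x)) (fun x => 1 - T (- x)) (fun x => S (- x) - x)
    (fun x => 1 - d + x ^+ 2 - K (- x)) d.
Proof.
case=> cU dT dS dK Ty Sy Ky TNy SNy KNy.
have flip (f df : R -> R) x : (forall x, is_derive x 1 f (df x)) -> is_derive x 1 (fun z => f (- z)) (- df (- x)).
  by move=> H; apply: is_derive_ext (is_derive_flip 0 x H) _ _ => [z|]; rewrite sub0r.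
split => //.
- by move=> t x y t0 t1; rewrite opprD -!mulrN; exact: cU.
- move=> x; apply: is_derive_ext (is_deriveB' (is_derive_cst' 1 x) (flip _ _ x dT)) _ _ => //.
  by rewrite phiN; ring.
- move=> x; apply: is_derive_ext (is_deriveB' (flip _ _ x dS) (is_derive_id' x)) _ _ => //.
  by ring.
- move=> x; apply: is_derive_ext (is_deriveB' (is_deriveD' (is_derive_cst' (1 - d) x) (is_deriveM' (is_derive_id' x) (is_derive_id' x))) (flip _ _ x dK)) _ _.
    by move=> z /=; rewrite expr2.
  by ring.
- by rewrite -[X in _ --> X](subrr (1 : R)); apply: cvgB => //; exact: cvg_cst.
- have H : 1 - T x @[x --> +oo] --> (1 - 0 : R) by apply: cvgB => //; exact: cvg_cst.
  by rewrite subr0 in H; apply: cvgy_ext H _ => x; rewrite opprK.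
- by apply: cvgy_ext Sy _ => x; rewrite opprK addrK.
- by apply: cvgy_ext Ky _ => x; rewrite opprK sqrrN opprD opprK addrA subrr add0r.
Qed.

Section core.
Variable Q : R -> R.
Hypothesis dQ : forall x, is_derive x 1 Q (- phi x).
Hypothesis Qy : Q x @[x --> +oo] --> (0 : R).
Hypothesis QNy : Q (- x) @[x --> +oo] --> (1 : R).
Let G := Gf Q.
Let H := Hf Q.
Let dG := dG dQ.
Let dH := dH dQ.
Let Q_lt := Q_lt dQ.
Let Q_le := Q_le dQ.
Let G_lt := G_lt dQ Qy.
Let G_le := G_le dQ Qy.
Let G_gt0 := G_gt0 dQ Qy.
Let G_ge0 := G_ge0 dQ Qy.
Let Q_gt0 := Q_gt0 dQ Qy.
Let Gy := Gy dQ Qy.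
Let Hy := Hy dQ Qy QNy.
Let GN := GN dQ Qy QNy.
Let HN := HN dQ Qy QNy.
Let QN := QN dQ Qy QNy.

Let hazard x := phi x / Q x.

(** The hazard rate has derivative phi G / Q^2, because phi - x Q = G. *)
Let hazard_nd a b : a <= b -> hazard a <= hazard b.
Proof.
move=> ab; apply: (derive_ge0_le ab (df := fun x => phi x * G x / Q x ^+ 2)).
  move=> x _; apply: is_derive_ext (is_deriveM' (is_derive_phi x) (is_deriveV _ (dQ x))) _ _ => //.
    by rewrite gt_eqF.
  rewrite /GRing.scale/= /G /Gf; field; by rewrite gt_eqF.
by move=> x _; rewrite divr_ge0 ?sqr_ge0// mulr_ge0 ?G_ge0// ltW// phi_gt0.
Qed.

(** The derivative has the sign of r minus the hazard rate, so Q - r G increases until the rate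
    reaches r and decreases afterwards. The next two bounds are the two halves of this fact. *)
Let dQhG r x : is_derive x 1 (fun z => Q z - r * G z) (Q x * (r - hazard x)).
Proof.
apply: is_derive_ext (is_deriveB' (dQ x) (is_deriveM' (is_derive_cst' r x) (dG x))) _ _ => //.
by rewrite /hazard; field; rewrite gt_eqF.
Qed.

Let Q_sub_le a b r : a <= b -> hazard b <= r -> Q a - Q b <= r * (G a - G b).
Proof.
move=> ab br; suff : Q a - r * G a <= Q b - r * G b by lra.
apply: (derive_ge0_le ab (fun x _ => dQhG r x)) => x /andP[_ xb].
by apply: mulr_ge0; [exact: ltW|rewrite subr_ge0 (le_trans _ br)// hazard_nd// ltW].
Qed.

Let hazardG_le w r : r <= hazard w -> r * G w <= Q w.
Proof.
move=> rw; rewrite -subr_ge0.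
have f0 : Q z - r * G z @[z --> +oo] --> (0 - r * 0 : R).
  by apply: cvgB => //; apply: cvgM => //; exact: cvg_cst.
rewrite mulr0 subr0 in f0.
apply: (@noninc_cvgy_le _ (fun z => Q z - r * G z) 0 w _ f0 w) => // y z wy yz.
apply: (derive_le0_le yz (fun x _ => dQhG r x)) => x /andP[yx _].
by apply: mulr_ge0_le0; [exact: ltW|rewrite subr_le0 (le_trans rw)// hazard_nd// (le_trans wy)// ltW].
Qed.

(** As a function of G, Q has slope phi / Q, the hazard rate, which decreases when G grows. So Q is
    a concave function of G vanishing at 0, hence subadditive: G x <= G y + G w implies Q x <= Q y +
    Q w. *)
Lemma Q_sub_G x y w : x <= y -> G x - G y <= G w -> Q x - Q y <= Q w.
Proof.
move=> xy Gxy.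
have [yw|wy] := leP y w.
  apply: le_trans (Q_sub_le xy (lexx _)) _.
  apply: le_trans (hazardG_le (lexx (hazard w))).
  apply: ler_pM => //; rewrite ?subr_ge0 ?G_le ?hazard_nd//.
  by rewrite divr_ge0// ltW// phi_gt0.
have [xw|wx] := leP x w; last first.
  apply: (@le_trans _ _ (Q x)); first by rewrite gerBl ltW.
  by rewrite Q_le ltW.
have h0 : 0 <= hazard w by rewrite divr_ge0// ltW// phi_gt0.
have := Q_sub_le xw (lexx _).
have : hazard w * (G x - G w) <= hazard w * G y by apply: ler_wpM2l => //; lra.
have := hazardG_le (hazard_nd (ltW wy)).
lra.
Qed.

Section one_sided.
Variables (U T S K : R -> R) (d : R).
Hypothesis tl : tails U T S K d.
Let W x := phi x * expR (- U x).
Let cU := tails_cvx tl.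
Let dT := tails_dT tl.
Let dS := tails_dS tl.
Let dK := tails_dK tl.
Let Ty := tails_Ty tl.
Let Sy := tails_Sy tl.
Let Ky := tails_Ky tl.
Let TNy := tails_TNy tl.

Let T_lt a b : a < b -> T b < T a.
Proof.
move=> ab; apply: (derive_lt0_lt ab (fun x _ => dT x)) => x _.
by rewrite oppr_lt0 mulr_gt0 ?phi_gt0 ?expR_gt0.
Qed.

Let T_gt0 x : 0 < T x.
Proof.
apply: (@le_lt_trans _ _ (T (x + 1))); last by rewrite T_lt// ltrDl.
apply: (@noninc_cvgy_le _ T 0 (x + 1) _ Ty) => // y z _.
by rewrite le_eqVlt => /predU1P[->//|/T_lt/ltW].
Qed.

Let T_lt1 x : T x < 1.
Proof.
rewrite ltNge; apply/negP => Tx.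
have : 1 < T (x - 1) by rewrite (le_lt_trans Tx)// T_lt// ltrBlDr ltrDl.
move=> /(cvgy_lt (1 - x) TNy)[y xy]; apply/negP; rewrite -leNgt ltW// T_lt//; lra.
Qed.

Lemma tails_S_ge0 x : 0 <= S x.
Proof.
apply: (@noninc_cvgy_le _ S 0 x _ Sy) => // y z _ yz.
by apply: (derive_le0_le yz (fun x _ => dS x)) => t _; rewrite oppr_le0 ltW.
Qed.

Lemma tails_K_ge0 x : 0 <= K x.
Proof.
apply: (@noninc_cvgy_le _ K 0 x _ Ky) => // y z _ yz.
apply: (derive_le0_le yz (fun x _ => dK x)) => t _.
by rewrite oppr_le0 mulr_ge0// tails_S_ge0.
Qed.

(* [theta <= 0] exactly where the density of X - x exceeds that of N - y; as theta is
   convex, the difference of the two tails can only change sign at the common median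
   point s = 0. *)
Lemma tails_contract x y s : T x = Q y -> 0 <= s -> T (x + s) <= Q (y + s).
Proof.
move=> TQ; rewrite le_eqVlt => /predU1P[<-|s0]; first by rewrite !addr0 TQ.
rewrite leNgt; apply/negP => TQs.
pose A z := Q (y + z) - T (x + z).
pose theta z := U (x + z) + (x - y) * z + (x ^+ 2 - y ^+ 2) / 2.
have ctheta : cvxR theta.
  move=> t a b t0 t1; rewrite /theta.
  have := cU (x + a) (x + b) t0 t1.
  have -> : t * (x + a) + (1 - t) * (x + b) = x + (t * a + (1 - t) * b) by ring.
  move=> cUab; lra.
have sgn (z : R) : (W (x + z) - phi (y + z) < 0) = (0 < theta z).
  rewrite subr_lt0 /W /phi -mulrA ltr_pM2l ?sqrt2pi_gt0// -expRD ltr_expR /theta.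
  by apply/idP/idP; rewrite !expr2; lra.
have dA (z : R) : is_derive z 1 A (W (x + z) - phi (y + z)).
  apply: is_derive_ext (is_deriveB' (is_derive_shift y z dQ) (is_derive_shift x z dT)) _ _ => //.
  by rewrite /W; ring.
have A0 : A 0 = 0 by rewrite /A !addr0 TQ subrr.
have As : A s < 0 by rewrite /A subr_lt0.
have [p /andP[p0 ps] Ep] := MVT_itv s0 (fun z _ => dA z).
have thp : 0 < theta p.
  by rewrite -sgn -(pmulr_llt0 _ (_ : 0 < s - 0)) ?subr0// -[s in X in _ * X]subr0 -Ep A0 subr0.
have Ay : A z @[z --> +oo] --> (0 - 0 : R) by apply: cvgB; apply: cvgy_shift.
rewrite subr0 in Ay.
have [q sq Aq] := cvgy_gt s Ay As.
have [p2 /andP[sp2 p2q] Ep2] := MVT_itv sq (fun z _ => dA z).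
have thp2 : theta p2 <= 0.
  rewrite leNgt -sgn -leNgt -(pmulr_lge0 _ (_ : 0 < q - s)) ?subr_gt0// -Ep2 subr_ge0 ltW//.
(* Otherwise A would strictly decrease up to 0, hence stay above A (-1) > 0 far to the left,
   although both tails tend to 1 there. With p and p2 this produces the forbidden pattern theta <=
   0, > 0, <= 0. *)
have [p1 p10 thp1] : exists2 p1, p1 < 0 & theta p1 <= 0.
  apply/not_exists2P => NE.
  have thn z : z < 0 -> 0 < theta z by move=> z0; case: (NE z) => //; rewrite ltNge => /negP.
  have An a b : a < b -> b <= 0 -> A b < A a.
    move=> ab b0; apply: (derive_lt0_lt ab (fun z _ => dA z)) => z /andP[_ zb].
    by rewrite sgn thn// (lt_le_trans zb).
  have AN1 : 0 < A (-1) by rewrite -A0 An// oppr_lt0.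
  have ANy : A (- z) @[z --> +oo] --> (1 - 1 : R).
    have sh (f : R -> R) l c : f (- z) @[z --> +oo] --> (l : R) -> f (c + - z) @[z --> +oo] --> l.
      move=> fl; apply: cvgy_ext (@cvgy_shift _ (fun z => f (- z)) l (- c) fl) _ => z.
      by rewrite opprD opprK.
    by apply: cvgB; apply: sh.
  rewrite subrr in ANy.
  have [z z1 Az] := cvgy_lt 1 ANy AN1.
  by move: Az; rewrite ltNge ltW// An ?ltrN2// oppr_le0.
have := cvxR_between ctheta (ltW (lt_trans p10 p0)) (ltW (lt_trans ps sp2)) thp1 thp2.
by rewrite leNgt thp.
Qed.

(** The derivative of G - S is T - Q, so this bounds its decrease by the decrease of G at the same
    level. Take y with Q y = T x: [tails_contract], integrated over [0, +oo), gives S x <= G y, and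
    then [Q_sub_G] applies. *)
Lemma tails_hazard x w : G x - S x <= G w -> Q x - T x <= Q w.
Proof.
move=> GS; have [|y Ty'] := @Q_surj _ Q dQ Qy QNy (T x); first by rewrite T_gt0 T_lt1.
have [yx|/ltW xy] := leP y x.
  by apply: (@le_trans _ _ 0); [rewrite subr_le0 -Ty' Q_le|exact: ltW].
rewrite -Ty'; apply: Q_sub_G => //; apply: le_trans GS; rewrite lerD2l lerN2 -subr_ge0.
pose f z := G (y + z) - S (x + z).
have f0 : f z @[z --> +oo] --> (0 - 0 : R) by apply: cvgB; apply: cvgy_shift.
rewrite subr0 in f0.
suff : 0 <= f 0 by rewrite /f !addr0.
apply: (@noninc_cvgy_le _ f 0 0 _ f0) => // a b a0 ab.
apply: (derive_le0_le ab (df := fun z => T (x + z) - Q (y + z))).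
  move=> z _; apply: is_derive_ext (is_deriveB' (is_derive_shift y z dG) (is_derive_shift x z dS)) _ _ => //.
  by ring.
move=> z /andP[az _]; rewrite subr_le0; apply: tails_contract; first by rewrite Ty'.
by rewrite (le_trans a0)// ltW.
Qed.

End one_sided.
End core.
End tail_system.

(** * Translation bounds for the gap G - S, and the variance deficit *)

Section barrier.
Context {R : realType}.
Implicit Types (f df : R -> R) (x s : R).

(** After the last point c of [0, s] where f is nonnegative, f is negative and therefore
    nondecreasing, so it cannot have fallen below f c. *)
Lemma barrier_ge0 f df : (forall x, is_derive x 1 f (df x)) -> 0 <= f 0 ->
  (forall s, 0 <= s -> f s < 0 -> 0 <= df s) -> forall s, 0 <= s -> 0 <= f s.
Proof.
move=> fdf f0 fb s s0; rewrite leNgt; apply/negP => fs.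
pose A := [set z | 0 <= z <= s /\ 0 <= f z].
have A0 : A 0 by split => //; rewrite lexx.
have sA : has_sup A by split; [exists 0|exists s => z [/andP[]]].
pose c := sup A.
have c0 : 0 <= c by apply: ub_le_sup A0; case: sA.
have cs : c <= s by apply: ge_sup => [|z [/andP[]]//]; exists 0.
have fc : 0 <= f c.
  rewrite leNgt; apply/negP => fc.
  have cf : {for c, continuous f} by exact: is_derive_continuous.
  have /(nbhs_ballP c)[e /= e0 ce] : nbhs c [set z | f z < 0] by exact: (cvgr_lt _ cf _ fc).
  have [z Az cz] := sup_adherent e0 sA.
  have zc : z <= c by apply: ub_le_sup Az; case: sA.
  case: Az => _; apply/negP; rewrite -ltNge; apply: ce.
  by rewrite /ball/= ger0_norm ?subr_ge0// ltrBlDl -ltrBlDr.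
have {}cs : c < s by rewrite lt_neqAle cs andbT; apply: contraTneq fc => ->; rewrite -ltNge.
have [z /andP[cz zs] E] := MVT_itv cs (fun z _ => fdf z).
have fz : f z < 0.
  rewrite ltNge; apply/negP => fz.
  have : z <= c by apply: ub_le_sup; [case: sA|split => //; rewrite ltW ?(le_lt_trans c0)// ltW].
  by rewrite leNgt cz.
have : 0 <= f s - f c.
  rewrite E; apply: mulr_ge0; last by rewrite subr_ge0 ltW.
  by apply: fb => //; exact/ltW/(le_lt_trans c0).
by rewrite subr_ge0 => /(le_trans fc); rewrite leNgt fs.
Qed.

End barrier.

Section tail_bounds.
Context {R : realType}.
Implicit Types (x y s w l M : R).
Variable Q : R -> R.
Hypothesis dQ : forall x, is_derive x 1 Q (- phi x).
Hypothesis Qy : Q x @[x --> +oo] --> (0 : R).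
Hypothesis QNy : Q (- x) @[x --> +oo] --> (1 : R).
Let G := Gf Q.
Let H := Hf Q.
Let dG x : is_derive x 1 G (- Q x) := dG dQ x.
Let dH x : is_derive x 1 H (- (2 * G x)) := dH dQ x.
Let G_lt a b : (G b < G a) = (a < b) := G_lt dQ Qy a b.
Let G_le a b : (G b <= G a) = (a <= b) := G_le dQ Qy a b.
Let G_gt0 x : 0 < G x := G_gt0 dQ Qy x.
Let G_ge0 x : 0 <= G x := G_ge0 dQ Qy x.
Let Gy : G x @[x --> +oo] --> (0 : R) := Gy dQ Qy.
Let Hy : H x @[x --> +oo] --> (0 : R) := Hy dQ Qy QNy.
Let GN x : G (- x) = G x + x := GN dQ Qy QNy x.
Let HN x : H (- x) = 1 + x ^+ 2 - H x := HN dQ Qy QNy x.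
Let G_surj v : 0 < v -> exists u, G u = v := @G_surj _ Q dQ Qy QNy v.

Let E_reflect (S : R -> R) x : G (- x) - (S (- - x) - - x) = G x - S x.
Proof. by rewrite opprK GN; ring. Qed.

(** Wherever E (x + s) - G (M + s) is negative, [tails_hazard] makes its derivative nonnegative; the
    barrier principle concludes. *)
Lemma tails_right_le U T S K d x M l : tails U T S K d -> G M <= G x - S x -> 0 <= l ->
  G (M + l) <= G (x + l) - S (x + l).
Proof.
move=> tl GM l0; rewrite -subr_ge0.
pose f s := G (x + s) - S (x + s) - G (M + s).
suff fs : forall s, 0 <= s -> 0 <= f s by exact: (fs l l0).
apply: (@barrier_ge0 _ f (fun s => - Q (x + s) - - T (x + s) - - Q (M + s))).
- move=> s; apply: is_deriveB'; last exact: (is_derive_shift _ _ dG).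
  by apply: is_deriveB'; [exact: (is_derive_shift _ _ dG)|exact: (is_derive_shift _ _ (tails_dS tl))].
- by rewrite /f !addr0 subr_ge0.
- move=> s s0; rewrite /f subr_lt0 => /ltW /(tails_hazard dQ Qy QNy tl).
  by move=> ?; lra.
Qed.

(** For l < 0 the right-sided bound is applied to the reflected law, whose gap at - x is the gap at
    x. *)
Lemma tails_le U T S K d x M l : tails U T S K d -> G M <= G x - S x ->
  G (M + `|l|) <= G (x + l) - S (x + l).
Proof.
move=> tl GM; have [l0|l0] := leP 0 l.
  by rewrite ger0_norm//; exact: tails_right_le tl GM l0.
have := @tails_right_le _ _ _ _ _ (- x) M (- l) (tails_reflect tl).
rewrite -opprD (E_reflect S x) (E_reflect S (x + l)) ltr0_norm// => H1; apply: H1 => //.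
by rewrite oppr_ge0 ltW.
Qed.

Section fixed.
Variables (U T S K : R -> R) (d : R).
Hypothesis tl : tails U T S K d.
Let E x := G x - S x.

(* Otherwise E would have a negative value at some x; by the mean value theorem the
   sign of E'' = phi - W would be -, +, - in succession, against convexity of U. *)
Lemma tails_E_ge0 x : 0 <= E x.
Proof.
have cU := tails_cvx tl; have dT := tails_dT tl; have dS := tails_dS tl.
rewrite leNgt; apply/negP => Ex.
have dE (z : R) : is_derive z 1 E (T z - Q z).
  by apply: is_derive_ext (is_deriveB' (dG z) (dS z)) _ _ => //; ring.
pose W z := phi z * expR (- U z).
have dD (z : R) : is_derive z 1 (fun z => T z - Q z) (phi z - W z).
  by apply: is_derive_ext (is_deriveB' (dT z) (dQ z)) _ _ => //; rewrite /W; ring.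
have Wneg (z : R) : phi z - W z < 0 -> U z <= 0.
  rewrite subr_lt0 /W -[ltLHS]mulr1 ltr_pM2l ?phi_gt0// -expR0 ltr_expR.
  by rewrite oppr_gt0 => /ltW.
have Ey : E z @[z --> +oo] --> (0 - 0 : R) by apply: cvgB => //; exact: tails_Sy tl.
have ENy : E (- z) @[z --> +oo] --> (0 - 0 : R).
  apply: cvgy_ext (cvgB Gy (tails_SNy tl)) _ => z; rewrite /E fctE GN; ring.
have Dy : T z - Q z @[z --> +oo] --> (0 - 0 : R) by apply: cvgB => //; exact: tails_Ty tl.
have DNy : T (- z) - Q (- z) @[z --> +oo] --> (1 - 1 : R) by apply: cvgB => //; exact: tails_TNy tl.
rewrite subr0 in Ey; rewrite subr0 in ENy; rewrite subr0 in Dy; rewrite subrr in DNy.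
have [a xa Ea] := cvgy_gt x Ey Ex.
have [p2 /andP[xp2 p2a] Ep2] := MVT_itv xa (fun z _ => dE z).
have Dp2 : 0 < T p2 - Q p2.
  by rewrite -(pmulr_lgt0 _ (_ : 0 < a - x)) ?subr_gt0// -Ep2 subr_gt0.
have [b pb Db] := cvgy_lt p2 Dy Dp2.
have [r2 /andP[p2r2 _] Er2] := MVT_itv pb (fun z _ => dD z).
have Ur2 : U r2 <= 0.
  by apply: Wneg; rewrite -(pmulr_llt0 _ (_ : 0 < b - p2)) ?subr_gt0// -Er2 subr_lt0.
have [a' xa' Ea'] := cvgy_gt (- x) ENy Ex.
have xa'' : - a' < x by rewrite ltrNl.
have [p1 /andP[a'p1 p1x] Ep1] := MVT_itv xa'' (fun z _ => dE z).
have Dp1 : T p1 - Q p1 < 0.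
  by rewrite -(pmulr_llt0 _ (_ : 0 < x - - a')) ?subr_gt0// -Ep1 subr_lt0.
have [b' pb' Db'] := cvgy_gt (- p1) DNy Dp1.
have pb'' : - b' < p1 by rewrite ltrNl.
have [r1 /andP[_ r1p1] Er1] := MVT_itv pb'' (fun z _ => dD z).
have Ur1 : U r1 <= 0.
  by apply: Wneg; rewrite -(pmulr_llt0 _ (_ : 0 < p1 - - b')) ?subr_gt0// -Er1 subr_lt0.
have p12 : p1 < p2 by rewrite (lt_trans p1x).
have [r /andP[p1r rp2] Er] := MVT_itv p12 (fun z _ => dD z).
have := cvxR_between cU (ltW (lt_trans r1p1 p1r)) (ltW (lt_trans rp2 p2r2)) Ur1 Ur2.
apply/negP; rewrite -ltNge.
have : 0 < phi r - W r.
  rewrite -(pmulr_lgt0 _ (_ : 0 < p2 - p1)) ?subr_gt0// -Er; lra.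
rewrite subr_gt0 /W -[ltRHS]mulr1 ltr_pM2l ?phi_gt0// -expR0 ltr_expR.
by rewrite oppr_lt0.
Qed.

(** This is [tails_le] started at x + l and read back at x: a larger value at x + l would push E x
    above G M. *)
Lemma tails_ge x M l : E x <= G M -> E (x + l) <= G (M - `|l|).
Proof.
move=> EM; rewrite leNgt; apply/negP => EG.
have [M' GM'] := G_surj (le_lt_trans (G_ge0 _) EG).
have := @tails_le _ _ _ _ _ (x + l) M' (- l) tl.
rewrite addrK normrN => /(_ _); rewrite GM' => /(_ (lexx _)) GE.
have : G (M' + `|l|) <= G M by exact: le_trans EM.
by rewrite G_le leNgt -ltrBrDr; apply/negP; rewrite negbK -G_lt GM'.
Qed.

(** E x is at most G x and at most G (- x), since S and its reflection are nonnegative. *)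
Lemma tails_radius x M : G M = E x -> `|x| <= M.
Proof.
move=> GM; rewrite ler_norml lerNl -(G_le (- x)) -(G_le x) GM.
by rewrite /E GN; have := tails_S_ge0 tl x; have := tails_S_ge0 (tails_reflect tl) (- x); rewrite opprK => ? ?; apply/andP; split; lra.
Qed.

(** H x - K x is twice the integral of E over [x, +oo) and H M twice that of G over [M, +oo);
    [tails_le] compares the integrands. *)
Lemma tails_H_ge x M : G M <= E x -> H M <= H x - K x.
Proof.
move=> GM; pose f s := H (x + s) - K (x + s) - H (M + s).
have f0 : f z @[z --> +oo] --> (0 - 0 - 0 : R).
  apply: cvgB; last exact: cvgy_shift.
  by apply: cvgB; apply: cvgy_shift => //; exact: tails_Ky tl.
rewrite !subr0 in f0.
suff : 0 <= f 0 by rewrite /f !addr0 subr_ge0.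
apply: (@noninc_cvgy_le _ f 0 0 _ f0) => // a b a0 ab.
apply: (derive_le0_le ab (df := fun s => - (2 * G (x + s)) - - (2 * S (x + s)) - - (2 * G (M + s)))).
  move=> s _; apply: is_deriveB'; last exact: (is_derive_shift _ _ dH).
  by apply: is_deriveB'; [exact: (is_derive_shift _ _ dH)|exact: (is_derive_shift _ _ (tails_dK tl))].
move=> s /andP[sa _].
have := tails_le s tl GM; rewrite ger0_norm; last exact/(le_trans a0)/ltW.
by move=> ?; lra.
Qed.

(** The integral of E over [x, +oo) is cut at the midpoint (x + M) / 2. Before it E (x + s) <= G (M
    - s) is used, after it E <= G. The two bounds agree at the midpoint, and each part contributes
    at most H there. *)
Lemma tails_H_le x M : G M = E x -> H x - K x <= 2 * H ((x + M) / 2).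
Proof.
move=> GM; pose e := (M - x) / 2.
have xM : x <= M by rewrite (le_trans (ler_norm x))// tails_radius.
have e0 : 0 <= e by rewrite divr_ge0// subr_ge0.
pose f s := H (x + s) - K (x + s) + H (M - s).
have : f 0 <= f e.
  apply: (derive_ge0_le e0 (df := fun s => - (2 * G (x + s)) - - (2 * S (x + s)) + - - (2 * G (M - s)))).
    move=> s _; apply: is_deriveD'; last exact: (is_derive_flip _ _ dH).
    by apply: is_deriveB'; [exact: (is_derive_shift _ _ dH)|exact: (is_derive_shift _ _ (tails_dK tl))].
  move=> s /andP[s0 _].
  have := @tails_ge x M s; rewrite -GM => /(_ (lexx _)).
  by rewrite /E ger0_norm ?(ltW s0)// => ?; lra.
rewrite /f addr0 subr0 -[M - e](_ : x + e = _); last by rewrite /e; field.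
have -> : x + e = (x + M) / 2 by rewrite /e; field.
have := tails_K_ge0 tl ((x + M) / 2).
have : 0 <= H M.
  apply: (@noninc_cvgy_le _ H 0 M _ Hy) => // y z _ yz.
  apply: (derive_le0_le yz (fun x _ => dH x)) => t _.
  by rewrite oppr_le0 mulr_ge0// G_ge0.
by move=> ? ? ?; lra.
Qed.

End fixed.

(** The one-sided deficit H - K at x and its reflection at - x add up to d, because H x + H (- x) =
    1 + x^2 while the two K-terms add up to 1 - d + x^2. *)
Lemma tails_d_ge U T S K d x M : tails U T S K d -> G M <= G x - S x -> 2 * H M <= d.
Proof.
move=> tl GM; have := tails_H_ge tl GM.
have := @tails_H_ge _ _ _ _ _ (tails_reflect tl) (- x) M.
rewrite (E_reflect S x) => /(_ GM); rewrite opprK HN sqrrN; lra.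
Qed.

Lemma tails_d_le U T S K d x M : tails U T S K d -> G M = G x - S x ->
  d <= 2 * H ((M - x) / 2) + 2 * H ((M + x) / 2).
Proof.
move=> tl GM; have := tails_H_le tl GM; rewrite [x + M]addrC.
have := @tails_H_le _ _ _ _ _ (tails_reflect tl) (- x) M.
by rewrite (E_reflect S x) => /(_ GM); rewrite opprK HN sqrrN [- x + M]addrC; lra.
Qed.

Lemma tails_d_le1 (U T S K : R -> R) (d : R) : tails U T S K d -> d <= 1.
Proof.
move=> tl; have := tails_K_ge0 tl 0; have := tails_K_ge0 (tails_reflect tl) 0.
by rewrite oppr0; lra.
Qed.

(** By [tails_le] a positive value of E anywhere makes E positive everywhere, so one zero forces E =
    0 on the line. Then K = H, and the condition on K at minus infinity gives d = 0. *)
Lemma tails_E_gt0 (U T S K : R -> R) (d x : R) : tails U T S K d -> 0 < d -> 0 < G x - S x.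
Proof.
move=> tl d0; rewrite lt_neqAle (tails_E_ge0 tl) andbT; apply/negP => /eqP Ex.
have E0 y : G y - S y = 0.
  apply/eqP; rewrite eq_le (tails_E_ge0 tl) andbT leNgt; apply/negP => Ey.
  have [M GM] := G_surj Ey.
  have := tails_le (x - y) tl (_ : G M <= G y - S y); rewrite GM => /(_ (lexx _)).
  have -> : y + (x - y) = x by ring.
  by rewrite -Ex leNgt G_gt0.
pose F z := H z - K z.
have dF (z : R) : is_derive z 1 F 0.
  apply: is_derive_ext (is_deriveB' (dH z) (tails_dK tl z)) _ _ => //.
  by have := E0 z; lra.
have F0 : F z @[z --> +oo] --> (0 - 0 : R) by apply: cvgB => //; exact: tails_Ky tl.
rewrite subr0 in F0.
have Fc y z : y <= z -> F y = F z.
  move=> yz; apply/eqP; rewrite eq_le; apply/andP; split.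
    by apply: (derive_ge0_le yz (fun x _ => dF x)).
  by apply: (derive_le0_le yz (fun x _ => dF x)).
have FE z : 0 <= z -> F z = F 0 by move=> /Fc.
have H0 : F 0 = 0.
  apply: (cvg_unique _ _ F0) => //; apply: cvg_near_cst.
  by apply: filterS (nbhs_pinfty_ge (num_real 0)) => z /FE /esym.
have F0' : 1 - d + z ^+ 2 - K (- z) @[z --> +oo] --> (0 : R) := tails_KNy tl.
have : H z - (1 - d + z ^+ 2 - K (- z)) @[z --> +oo] --> (0 - 0 : R) by apply: cvgB.
rewrite subr0 => L.
have : (fun z => H z - (1 - d + z ^+ 2 - K (- z))) @ +oo --> d.
  apply: cvg_near_cst; apply: filterS (nbhs_pinfty_ge (num_real 0)) => z z0.
  have := Fc (- z) 0; rewrite oppr_le0 => /(_ z0).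
  by rewrite H0 /F HN; lra.
move=> L2; have E0' : 0 = d := cvg_unique (@norm_hausdorff _ R) L L2.
by move: d0; rewrite -E0' ltxx.
Qed.

End tail_bounds.

(** * Numerical inequalities behind the lower bound *)

Section pi_bounds.
Context {R : realType}.
Implicit Types x : R.

Let sin_le x : 0 <= x -> sin x <= x.
Proof.
move=> x0; rewrite -subr_ge0.
have d (z : R) : is_derive z 1 (fun z : R => z - sin z) (1 - cos z).
  by apply: is_deriveB'.
rewrite -[leLHS](_ : 0 - sin (0 : R) = 0); last by rewrite sin0 subr0.
by apply: (derive_ge0_le x0 (fun z _ => d z)) => z _; rewrite subr_ge0 cos_le1.
Qed.

Let cos_ge x : 0 <= x -> 1 - x * x / 2 <= cos x.
Proof.
move=> x0; rewrite -subr_ge0.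
have d (z : R) : is_derive z 1 (fun z : R => cos z - (1 - z * z / 2)) (z - sin z).
  apply: is_derive_ext (is_deriveB' (is_derive_cos z) (is_deriveB' (is_derive_cst' 1 z)
    (is_deriveM' (is_deriveM' (is_derive_id' z) (is_derive_id' z)) (is_derive_cst' 2^-1 z)))) _ _ => //.
  by field.
rewrite -[leLHS](_ : cos 0 - (1 - 0 * 0 / 2) = 0 :> R); last by rewrite cos0; ring.
by apply: (derive_ge0_le x0 (fun z _ => d z)) => z /andP[z0 _]; rewrite subr_ge0 sin_le// ltW.
Qed.

Let sin_ge x : 0 <= x -> x - x * x * x / 6 <= sin x.
Proof.
move=> x0; rewrite -subr_ge0.
have d (z : R) : is_derive z 1 (fun z : R => sin z - (z - z * z * z / 6)) (cos z - (1 - z * z / 2)).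
  apply: is_derive_ext (is_deriveB' (is_derive_sin z) (is_deriveB' (is_derive_id' z)
    (is_deriveM' (is_deriveM' (is_deriveM' (is_derive_id' z) (is_derive_id' z)) (is_derive_id' z)) (is_derive_cst' 6^-1 z)))) _ _ => //.
  by field.
rewrite -[leLHS](_ : sin 0 - (0 - 0 * 0 * 0 / 6) = 0 :> R); last by rewrite sin0; ring.
by apply: (derive_ge0_le x0 (fun z _ => d z)) => z /andP[z0 _]; rewrite subr_ge0 cos_ge// ltW.
Qed.

(** The triple-angle formula at a = pi / 6 reads 3 s - 4 s^3 = 1, that is (s + 1) (2 s - 1)^2 = 0,
    and s > 0. *)
Let sin_pi6 : sin (pi / 6) = 2^-1 :> R.
Proof.
set a := pi / 6; set s := sin a.
have s0 : 0 < s.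
  by apply: sin_gt0_pi; rewrite /a divr_gt0 ?pi_gt0//= ltr_pdivrMr// ltr_pMr ?pi_gt0// ltr1n.
have : sin (a + a + a) = 1 by rewrite -sin_pihalf; congr sin; rewrite /a; field.
rewrite sinD sinD cosD -/s.
have cs : cos a ^+ 2 = 1 - s ^+ 2 by rewrite cos2sin2.
move=> E; have {E} : (s + 1) * (2 * s - 1) ^+ 2 = 0.
  have -> : (s + 1) * (2 * s - 1) ^+ 2 = 1 - (3 * s - 4 * s ^+ 3) by ring.
  rewrite -[X in X - _]E.
  have -> : (s * cos a + cos a * s) * cos a + (cos a * cos a - s * s) * s = 3 * s * cos a ^+ 2 - s ^+ 3 by ring.
  by rewrite cs; ring.
move=> /eqP; rewrite mulf_eq0 sqrf_eq0 => /orP[|] /eqP; lra.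
Qed.

Lemma pi_ge3 : 3 <= pi :> R.
Proof.
have := @sin_le (pi / 6); rewrite sin_pi6 => /(_ _) H.
have : (2^-1 : R) <= pi / 6 by apply: H; rewrite divr_ge0// pi_ge0.
lra.
Qed.

(** If pi were above 16 / 5, then x - x^3 / 6 at x = pi / 6 would already exceed sin x = 1 / 2. *)
Lemma pi_le32 : 5 * pi <= 16 :> R.
Proof.
rewrite leNgt; apply/negP => p.
have p4 : pi < 4 :> R by have := @pihalf_lt2 R; lra.
have := @sin_ge (pi / 6); rewrite sin_pi6 => /(_ _) H.
have {H} : pi / 6 - pi / 6 * (pi / 6) * (pi / 6) / 6 <= (2^-1 : R) by apply: H; rewrite divr_ge0// pi_ge0.
set x : R := pi / 6; have x1 : 8 / 15 < x by rewrite /x; lra.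
have x2 : x < 2 / 3 by rewrite /x; lra.
nra.
Qed.

Lemma phi0E : phi 0 = (Num.sqrt (2 * pi))^-1 :> R.
Proof. by rewrite /phi expr2 !mul0r oppr0 expR0 mulr1. Qed.

Lemma phi0_sqr : phi 0 ^+ 2 = (2 * pi)^-1 :> R.
Proof. by rewrite phi0E exprVn sqr_sqrtr// mulr_ge0// pi_ge0. Qed.

Lemma phi0_le : phi 0 <= 49 / 120 :> R.
Proof.
rewrite -ler_sqr ?nnegrE ?(ltW (phi_gt0 _))// phi0_sqr.
rewrite invf_ple ?posrE ?mulr_gt0 ?pi_gt0//; have := pi_ge3; lra.
Qed.

Lemma phi0_ge : 79 / 200 <= phi 0 :> R.
Proof.
rewrite -ler_sqr ?nnegrE ?(ltW (phi_gt0 _))// phi0_sqr.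
rewrite invf_pge ?posrE ?mulr_gt0 ?pi_gt0//; have := pi_le32; lra.
Qed.
End pi_bounds.

Section numeric.
Context {R : realType}.
Implicit Types A B a b c s x : R.

(** Cauchy-Schwarz. Below, the square root is replaced by such tangent lines with Pythagorean
    coefficients, so that only rational polynomial inequalities remain. *)
Let tangent c s x : c ^+ 2 + s ^+ 2 = 1 -> c + s * x <= Num.sqrt (1 + x ^+ 2).
Proof.
move=> cs; have [n|p] := leP (c + s * x) 0; first by rewrite (le_trans n)// sqrtr_ge0.
rewrite -ler_sqr ?nnegrE ?sqrtr_ge0 ?(ltW p)// sqr_sqrtr; last by rewrite addr_ge0// sqr_ge0.
have := sqr_ge0 (c * x - s); nra.
Qed.

Let radius_large A B : 2^-1 <= A -> A <= B ->
  (A + B) * (121 / 500 / A + 121 / 500 / B) <= Num.sqrt (1 + (B - A) ^+ 2).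
Proof.
move=> hA AB.
have A0 : 0 < A by lra.
have B0 : 0 < B by lra.
have [x xE x0] : exists2 x, B = A + x & 0 <= x by exists (B - A); lra.
rewrite {}xE in AB B0 *; have -> : A + x - A = x by ring.
set S := Num.sqrt _.
have S1 : 1 <= S by have := @tangent 1 0 x; rewrite mul0r addr0; apply; ring.
have S2 : 5 / 13 * x + 12 / 13 <= S by rewrite addrC; apply: tangent; field.
have S4 : 4 / 5 * x + 3 / 5 <= S by rewrite addrC; apply: tangent; field.
have p0 : 0 < A * (A + x) by rewrite mulr_gt0.
rewrite -(ler_pM2r p0).
have -> : (A + (A + x)) * (121 / 500 / A + 121 / 500 / (A + x)) * (A * (A + x)) =
  121 / 500 * (x ^+ 2 + 4 * (A * (A + x))) by field; rewrite !gt_eqF.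
have pge : 4^-1 + x / 2 <= A * (A + x) by nra.
set p := A * (A + x) in p0 pge *.
(* The inequality is affine in p with slope S - 121 / 125 >= 0, where 121 / 125 = 4 * 121 / 500, so
   it suffices to treat the least value p = 1 / 4 + x / 2. One tangent line serves on each of three
   ranges of x. *)
suff : 121 / 500 * x ^+ 2 <= (4^-1 + x / 2) * (S - 121 / 125).
  have : (4^-1 + x / 2) * (S - 121 / 125) <= p * (S - 121 / 125) by apply: ler_wpM2r => //; lra.
  by move=> ? ?; lra.
have q0 : 0 <= 4^-1 + x / 2 by lra.
have [x1|x1] := leP x (1 / 5).
  have : (4^-1 + x / 2) * (1 - 121 / 125) <= (4^-1 + x / 2) * (S - 121 / 125) by apply: ler_wpM2l => //; lra.
  apply: le_trans; nra.
have [x2|x2] := leP x 1.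
  have : (4^-1 + x / 2) * (5 / 13 * x + 12 / 13 - 121 / 125) <= (4^-1 + x / 2) * (S - 121 / 125) by apply: ler_wpM2l => //; lra.
  apply: le_trans; nra.
have : (4^-1 + x / 2) * (4 / 5 * x + 3 / 5 - 121 / 125) <= (4^-1 + x / 2) * (S - 121 / 125) by apply: ler_wpM2l => //; lra.
apply: le_trans; nra.
Qed.

(** For A <= 1 / 2 the quadratic bound is used at A and the hyperbolic one at B. The tangent line
    (c, s) is chosen according to the range of A. *)
Let radius_small A B : 0 < A -> A <= 2^-1 -> 1 <= 4 * (A * B) ->
  (A + B) * (1 - 79 / 50 * A + A ^+ 2 + 121 / 500 / B) <= Num.sqrt (1 + (B - A) ^+ 2).
Proof.
move=> A0 A1 AB.
have B0 : 0 < B by rewrite -(pmulr_rgt0 _ A0); lra.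
set al := 1 - _ + _.
have alE : al = 1 - 79 / 50 * A + A ^+ 2 by [].
have A20 : 0 < A ^+ 2 by rewrite exprn_gt0.
suff [c [s [cs H]]] : exists c s, c ^+ 2 + s ^+ 2 = 1 /\
    (A + B) * (al * B + 121 / 500) <= (c + s * (B - A)) * B.
  apply: le_trans (tangent (B - A) cs); rewrite -(ler_pM2r B0).
  suff -> : (A + B) * (al + 121 / 500 / B) * B = (A + B) * (al * B + 121 / 500) by [].
  by field; rewrite gt_eqF.
(* Once s >= al, only the smallest admissible B = 1 / (4 A) matters. *)
have large_s c s : al <= s ->
    0 <= 4 * A * (c - 121 / 500) - 4 * A ^+ 2 * (s + al) - 484 / 125 * A ^+ 2 * A + (s - al) ->
    (A + B) * (al * B + 121 / 500) <= (c + s * (B - A)) * B.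
  move=> als Hp.
  have h1 : 0 <= (4 * (A * B) - 1) * (s - al) by rewrite mulr_ge0 ?subr_ge0.
  have h2 : 0 <= (4 * (A * B) - 1) * A ^+ 2 by rewrite mulr_ge0 ?subr_ge0// ltW.
  have h3 : 0 <= B * (4 * A * (c - 121 / 500) - 4 * A ^+ 2 * (s + al) - 484 / 125 * A ^+ 2 * A + (s - al)).
    by rewrite mulr_ge0// ltW.
  have h4 : 0 <= B * ((4 * (A * B) - 1) * (s - al)) by rewrite mulr_ge0// ltW.
  rewrite -subr_ge0 -(pmulr_rge0 _ (_ : 0 < 4 * A)); last by rewrite mulr_gt0.
  have -> : 4 * A * ((c + s * (B - A)) * B - (A + B) * (al * B + 121 / 500)) =
    B * (4 * A * (c - 121 / 500) - 4 * A ^+ 2 * (s + al) - 484 / 125 * A ^+ 2 * A + (s - al))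
    + B * ((4 * (A * B) - 1) * (s - al)) + 121 / 125 * ((4 * (A * B) - 1) * A ^+ 2) by field.
  by apply: addr_ge0; [exact: addr_ge0|exact: mulr_ge0].
have [a1|a1] := leP A (19 / 100).
  (* The line tangent at B - A for the extreme value B = 1 / (4 A), where s / c = 1 / (4 A) - A. For
     larger A, fixed Pythagorean pairs approximate it. *)
  have q0 : 0 < 1 + 4 * A ^+ 2 by nra.
  exists (4 * A / (1 + 4 * A ^+ 2)), ((1 - 4 * A ^+ 2) / (1 + 4 * A ^+ 2)); split.
    by field; rewrite gt_eqF.
  apply: large_s; first by rewrite ler_pdivlMr// alE; nra.
  rewrite -(ler_pM2r q0) mul0r.
  have -> : (4 * A * (4 * A / (1 + 4 * A ^+ 2) - 121 / 500) - 4 * A ^+ 2 * ((1 - 4 * A ^+ 2) / (1 + 4 * A ^+ 2) + al) -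
     484 / 125 * A ^+ 2 * A + ((1 - 4 * A ^+ 2) / (1 + 4 * A ^+ 2) - al)) * (1 + 4 * A ^+ 2) =
     (1 + 4 * A ^+ 2) ^+ 2 * (1 - al - 121 / 125 * A) by field; rewrite gt_eqF.
  by rewrite mulr_ge0 ?sqr_ge0// alE; nra.
have [a2|a2] := leP A (22 / 100).
  exists (3 / 5), (4 / 5); split; first by field.
  by apply: large_s; rewrite alE; nra.
have [a3|a3] := leP A (32 / 100).
  exists (20 / 29), (21 / 29); split; first by field.
  by apply: large_s; rewrite alE; nra.
have [a4|a4] := leP A (38 / 100).
  exists (4 / 5), (3 / 5); split; first by field.
  by apply: large_s; rewrite alE; nra.
have [b1|b1] := leP B (85 / 100).
  exists (24 / 25), (7 / 25); split; first by field.
  (* Here al exceeds the slope 7 / 25, so the difference of the two sides is concave in B.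
     Subtracting a multiple of (4 A B - 1) (85 / 100 - B), nonnegative on the range of B, leaves an
     affine function of B, whose slope has the sign of [L1] and whose value at 4 A B = 1 is
     [L1 + 4 * A * L0]. *)
  have a5 : al <= 544 / 1000 by rewrite alE; nra.
  have a6 : 46 / 100 <= al by rewrite alE; nra.
  pose L1 := 4 * A * (24 / 25 - 7 / 25 * A - al * A - 121 / 500) - (al - 7 / 25) * (34 / 10 * A + 1).
  pose L0 := 85 / 100 * (al - 7 / 25) - 121 / 125 * A ^+ 2.
  have hL1 : 0 <= L1 by rewrite /L1 alE; nra.
  have hL0 : 0 <= L1 + 4 * A * L0 by rewrite /L1 /L0 alE; nra.
  have h0 : 0 <= (al - 7 / 25) * ((4 * (A * B) - 1) * (85 / 100 - B)).
    apply: mulr_ge0; first lra.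
    by apply: mulr_ge0; rewrite subr_ge0.
  have h1 : 0 <= (4 * (A * B) - 1) * L1 by apply: mulr_ge0 => //; rewrite subr_ge0.
  rewrite -subr_ge0 -(pmulr_rge0 _ (_ : 0 < 16 * A ^+ 2)); last by rewrite mulr_gt0.
  have -> : 16 * A ^+ 2 * ((24 / 25 + 7 / 25 * (B - A)) * B - (A + B) * (al * B + 121 / 500)) =
      4 * A * ((al - 7 / 25) * ((4 * (A * B) - 1) * (85 / 100 - B))) + (4 * (A * B) - 1) * L1 + (L1 + 4 * A * L0).
    by rewrite /L1 /L0; field.
  apply: addr_ge0 => //; apply: addr_ge0 => //; apply: mulr_ge0 => //.
  by apply: mulr_ge0 => //; exact: ltW.
exists (4 / 5), (3 / 5); split; first by field.
(* Now al <= 3 / 5, so the leading coefficient in B is nonnegative and the difference is expanded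
   around B = 85 / 100. *)
have a5 : al <= 3 / 5 by rewrite alE; nra.
have h1 : 0 <= B * ((3 / 5 - al) * (B - 85 / 100)).
  by apply: mulr_ge0; [exact: ltW|apply: mulr_ge0; rewrite subr_ge0// ltW].
pose n := 4 / 5 - 3 / 5 * A - al * A - 121 / 500 + 85 / 100 * (3 / 5 - al).
have h2 : 121 / 500 * A <= 85 / 100 * n by rewrite /n alE; nra.
have h3 : 0 <= (B - 85 / 100) * n.
  by apply: mulr_ge0; [rewrite subr_ge0 ltW|nra].
rewrite -subr_ge0.
have -> : (4 / 5 + 3 / 5 * (B - A)) * B - (A + B) * (al * B + 121 / 500) =
    B * ((3 / 5 - al) * (B - 85 / 100)) + (B - 85 / 100) * n + (85 / 100 * n - 121 / 500 * A).
  by rewrite /n; field.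
by apply: addr_ge0; [exact: addr_ge0|rewrite subr_ge0].
Qed.

(** It is meant for A = (M - x) / 2, B = (M + x) / 2 and a, b the values of 2 H there. The
    coefficient 79 / 50 is a lower bound of 4 phi 0 ([phi0_ge]) and 121 / 500 an upper bound of 16 /
    27 * phi 0 ([phi0_le]). *)
Lemma radius_bound A B a b : 0 < A -> 0 < B -> 1 <= 4 * (A * B) ->
  a <= 1 - 79 / 50 * A + A ^+ 2 -> b <= 1 - 79 / 50 * B + B ^+ 2 ->
  a <= 121 / 500 / A -> b <= 121 / 500 / B ->
  (A + B) * (a + b) <= Num.sqrt (1 + (B - A) ^+ 2).
Proof.
wlog AB : A B a b / A <= B.
  move=> H A0 B0 AB1 a1 b1 a2 b2; have [AB|/ltW BA] := leP A B; first exact: H.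
  rewrite addrC [a + b]addrC -[(B - A) ^+ 2]sqrrN opprB.
  by apply: H => //; rewrite [B * A]mulrC.
move=> A0 B0 AB1 a1 b1 a2 b2; have AB0 : 0 <= A + B by rewrite addr_ge0// ltW.
have [A2|/ltW A2] := leP A 2^-1.
  by apply: le_trans (radius_small A0 A2 AB1); rewrite ler_wpM2l// lerD.
by apply: le_trans (radius_large A2 AB); rewrite ler_wpM2l// lerD.
Qed.

End numeric.

(** * Explicit bounds for the gap in terms of the variance deficit *)

Section std_bounds.
Context {R : realType}.
Implicit Types (x y s w l M u z : R).
Variable Q : R -> R.
Hypothesis dQ : forall x, is_derive x 1 Q (- phi x).
Hypothesis Qy : Q x @[x --> +oo] --> (0 : R).
Hypothesis QNy : Q (- x) @[x --> +oo] --> (1 : R).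
Let G := Gf Q.
Let H := Hf Q.
Let dG x : is_derive x 1 G (- Q x) := dG dQ x.
Let dH x : is_derive x 1 H (- (2 * G x)) := dH dQ x.
Let G_le a b : (G b <= G a) = (a <= b) := G_le dQ Qy a b.
Let G_gt0 x : 0 < G x := G_gt0 dQ Qy x.
Let G_ge0 x : 0 <= G x := G_ge0 dQ Qy x.
Let Gy : G x @[x --> +oo] --> (0 : R) := Gy dQ Qy.
Let Hy : H x @[x --> +oo] --> (0 : R) := Hy dQ Qy QNy.
Let GN x : G (- x) = G x + x := GN dQ Qy QNy x.
Let HN x : H (- x) = 1 + x ^+ 2 - H x := HN dQ Qy QNy x.
Let G_surj v : 0 < v -> exists u, G u = v := @G_surj _ Q dQ Qy QNy v.
Let Q_gt0 x : 0 < Q x := Q_gt0 dQ Qy x.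
Let Q_le a b : (Q b <= Q a) = (a <= b) := Q_le dQ a b.

Let G0 : G 0 = phi 0. Proof. by rewrite /G /Gf mul0r subr0. Qed.
Let H0 : H 0 = 2^-1. Proof. by have := HN 0; rewrite oppr0 expr2; lra. Qed.

Let H_gt0 x : 0 < H x.
Proof.
have nH y z : y < z -> H z < H y.
  move=> yz; apply: (derive_lt0_lt yz (fun x _ => dH x)) => t _.
  by rewrite oppr_lt0 mulr_gt0.
apply: (@le_lt_trans _ _ (H (x + 1))); last by rewrite nH// ltrDl.
apply: (@noninc_cvgy_le _ H 0 (x + 1) _ Hy) => // y z _.
by rewrite le_eqVlt => /predU1P[->//|/nH/ltW].
Qed.

Lemma G_le_phi x : G `|x| <= phi x.
Proof.
rewrite /G /Gf (_ : phi `|x| = phi x); last by rewrite /phi real_normK// num_real.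
by rewrite gerBl mulr_ge0// ltW.
Qed.

(** Cauchy-Schwarz for (N - x)^+, obtained from the derivative: Q H - G^2 has derivative - phi H and
    tends to 0. *)
Lemma G_sqr_le x : G x ^+ 2 <= Q x * H x.
Proof.
rewrite -subr_ge0; pose f z := Q z * H z - G z ^+ 2.
have df z : is_derive z 1 f (- (phi z * H z)).
  apply: is_derive_ext (is_deriveB' (is_deriveM' (dQ z) (dH z)) (is_deriveM' (dG z) (dG z))) _ _.
    by move=> t; rewrite /f -expr2.
  by ring.
have f0 : f z @[z --> +oo] --> (0 * 0 - 0 * 0 : R).
  have E : f =1 fun z => Q z * H z - G z * G z by move=> z; rewrite /f expr2.
  by rewrite (funext E); apply: cvgB; apply: cvgM.
rewrite mulr0 subrr in f0.
apply: (@noninc_cvgy_le _ f 0 x _ f0 x) => // a b xa ab.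
apply: (derive_le0_le ab (fun x _ => df x)) => z _.
by rewrite oppr_le0 mulr_ge0// ltW// phi_gt0.
Qed.

(** By [G_sqr_le] the quotient G^2 / H does not increase, and at 0 it equals 2 (phi 0)^2. *)
Let ratio_le M : 0 <= M -> G M ^+ 2 <= phi 0 ^+ 2 * (2 * H M).
Proof.
move=> M0; pose f z := G z ^+ 2 / H z.
have df z : is_derive z 1 f (2 * G z * (G z ^+ 2 - Q z * H z) / H z ^+ 2).
  apply: is_derive_ext (is_deriveM' (is_deriveM' (dG z) (dG z)) (is_deriveV _ (dH z))) _ _.
  - by rewrite gt_eqF.
  - by move=> t; rewrite /f -expr2.
  - by rewrite /GRing.scale/=; field; rewrite gt_eqF.
have : f M <= f 0.
  apply: (derive_le0_le M0 (fun x _ => df x)) => z _.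
  rewrite mulr_le0_ge0 ?invr_ge0 ?sqr_ge0// mulr_ge0_le0 ?subr_le0 ?G_sqr_le//.
  by rewrite mulr_ge0.
rewrite /f G0 H0 ler_pdivrMr// invrK; lra.
Qed.

(** At 0 both sides agree to first order, and the difference has second derivative 2 - 4 Q,
    nonnegative for u >= 0 since Q 0 = 1 / 2. *)
Let H_taylor u : 0 <= u -> 2 * H u <= 1 - 4 * phi 0 * u + u ^+ 2.
Proof.
move=> u0; pose f1 z := - (4 * phi 0) + 2 * z + 4 * G z.
have df1 z : is_derive z 1 f1 (2 - 4 * Q z).
  apply: is_derive_ext (is_deriveD' (is_deriveD' (is_derive_cst' _ z) (is_deriveM' (is_derive_cst' 2 z) (is_derive_id' z))) (is_deriveM' (is_derive_cst' 4 z) (dG z))) _ _ => //.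
  by ring.
have f1_ge0 z : 0 <= z -> 0 <= f1 z.
  move=> z0; have : f1 0 <= f1 z.
    apply: (derive_ge0_le z0 (fun x _ => df1 x)) => t /andP[t0 _].
    have : Q t <= Q 0 by rewrite Q_le ltW.
    by rewrite (Q0 dQ Qy QNy); lra.
  by rewrite {1}/f1 G0; lra.
pose f z := 1 - 4 * phi 0 * z + z ^+ 2 - 2 * H z.
have df z : is_derive z 1 f (f1 z).
  apply: is_derive_ext (is_deriveB' (is_deriveD' (is_deriveB' (is_derive_cst' 1 z) (is_deriveM' (is_derive_cst' (4 * phi 0) z) (is_derive_id' z))) (is_deriveM' (is_derive_id' z) (is_derive_id' z))) (is_deriveM' (is_derive_cst' 2 z) (dH z))) _ _.
    by move=> t; rewrite /f expr2.
  by rewrite /f1; ring.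
have : f 0 <= f u.
  by apply: (derive_ge0_le u0 (fun x _ => df x)) => t /andP[/ltW/f1_ge0].
by rewrite /f H0 expr2; lra.
Qed.

Let sqr_phi_cvgy : z ^+ 2 * phi z @[z --> +oo] --> (0 : R).
Proof.
apply: (@cvgy0_bound _ _ (32 * phi 0)) => x x0.
have p0 := phi_gt0 (0 : R); have x20 : 0 < x ^+ 2 by rewrite exprn_gt0.
have E : phi x = phi 0 * expR (- (x ^+ 2 / 4)) ^+ 2.
  by rewrite phi0E -expRM_natl; congr (_ * expR _); field.
have e1 : expR (- (x ^+ 2 / 4)) <= (1 + x ^+ 2 / 4)^-1.
  by rewrite expRN lef_pV2 ?posrE ?expR_gt0 ?expR_ge1Dx// addr_gt0// divr_gt0.
have e2 : (1 + x ^+ 2 / 4)^-1 <= x^-1.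
  rewrite lef_pV2 ?posrE ?addr_gt0 ?divr_gt0//.
  by have := sqr_ge0 (x / 2 - 1); rewrite !expr2; lra.
have e3 : (1 + x ^+ 2 / 4)^-1 <= 4 / x ^+ 2.
  by rewrite -[leRHS]invf_div lef_pV2 ?posrE ?addr_gt0 ?divr_gt0// lerDr.
have e0 := expR_ge0 (- (x ^+ 2 / 4)).
rewrite ger0_norm; last by rewrite mulr_ge0 ?sqr_ge0// ltW// phi_gt0.
rewrite E (_ : 32 * phi 0 / x = x ^+ 2 * (phi 0 * (x^-1 * (32 / x ^+ 2)))); last first.
  by field; rewrite gt_eqF.
rewrite ler_pM2l// ler_pM2l// expr2; apply: ler_pM => //; first exact: le_trans e2.
apply: (le_trans e1); apply: (le_trans e3); rewrite ler_pM2r ?invr_gt0//; lra.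
Qed.

(* With polynomial weights, F z is the integral of (s - 3u)^2 (s - 3u/4) phi(s) over
   [z, oo), so F u >= 0; this is the expectation of (s - u)^2 u <= (4/27) s^3. *)
Let H_cubic u : 0 < u -> u * (2 * H u) <= 16 / 27 * phi 0.
Proof.
move=> u0; pose F z := (z ^+ 2 + 2) * phi z - 27 / 4 * u * (z * phi z + Q z)
  + 27 / 2 * u ^+ 2 * phi z - 27 / 4 * u ^+ 3 * Q z.
have dF z : is_derive z 1 F (- ((z - 3 * u) ^+ 2 * (z - 3 / 4 * u) * phi z)).
  have d1 := is_deriveM' (is_deriveD' (is_deriveM' (is_derive_id' z) (is_derive_id' z)) (is_derive_cst' 2 z)) (is_derive_phi z).
  have d2 := is_deriveD' (is_deriveM' (is_derive_id' z) (is_derive_phi z)) (dQ z).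
  apply: is_derive_ext (is_deriveB' (is_deriveD' (is_deriveB' d1 (is_deriveM' (is_derive_cst' (27 / 4 * u) z) d2))
     (is_deriveM' (is_derive_cst' (27 / 2 * u ^+ 2) z) (is_derive_phi z))) (is_deriveM' (is_derive_cst' (27 / 4 * u ^+ 3) z) (dQ z))) _ _.
    by move=> t; rewrite /F expr2.
  by field.
have py := @phi_cvgy R.
have zpy : z * phi z @[z --> +oo] --> (0 : R).
  have : z * Q z @[z --> +oo] --> (0 : R); last first.
    move=> zQ; have : Gf Q z + z * Q z @[z --> +oo] --> (0 + 0 : R) by apply: cvgD.
    move=> _; apply: (squeeze_cvgr (f := fun=> 0) (h := fun z => z ^+ 2 * phi z)).
    - apply: filterS (nbhs_pinfty_ge (num_real 1)) => z z1.
      have p := ltW (phi_gt0 z); have z0 : 0 <= z by lra.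
      by rewrite mulr_ge0//= ler_wpM2r// expr2 ler_peMl.
    - exact: cvg_cst.
    - exact: sqr_phi_cvgy.
  have : phi z - Gf Q z @[z --> +oo] --> (0 - 0 : R) by apply: cvgB.
  by rewrite subr0 => /cvgy_ext; apply => z; rewrite /Gf; ring.
have Fy : F z @[z --> +oo] --> (0 : R).
  have : z ^+ 2 * phi z + 2 * phi z - 27 / 4 * u * (z * phi z + Q z)
    + 27 / 2 * u ^+ 2 * phi z - 27 / 4 * u ^+ 3 * Q z @[z --> +oo] -->
    (0 + 2 * 0 - 27 / 4 * u * (0 + 0) + 27 / 2 * u ^+ 2 * 0 - 27 / 4 * u ^+ 3 * 0 : R).
    by apply: cvgB; [apply: cvgD; [apply: cvgB; [apply: cvgD|]|]|] => //; apply: cvgM => //; try exact: cvg_cst; exact: cvgD.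
  rewrite !(mulr0, addr0, subr0) => /cvgy_ext; apply => z; rewrite /F; ring.
have Fu : 0 <= F u.
  apply: (@noninc_cvgy_le _ F 0 u _ Fy) => // a b ua ab.
  apply: (derive_le0_le ab (fun x _ => dF x)) => z /andP[az _].
  rewrite oppr_le0; apply: mulr_ge0; last exact/ltW/phi_gt0.
  by apply: mulr_ge0; [exact: sqr_ge0|rewrite subr_ge0; lra].
have Fl : (u ^+ 2 + 2) * phi u <= 2 * phi 0.
  have d1 z := is_deriveM' (is_deriveD' (is_deriveM' (is_derive_id' z) (is_derive_id' z)) (is_derive_cst' 2 z)) (is_derive_phi z).
  have : (u * u + 2) * phi u <= (0 * 0 + 2) * phi 0; last by rewrite expr2; lra.
  apply: (derive_le0_le (ltW u0) (fun x _ => d1 x)) => z /andP[z0 _].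
  have -> : (1 * z + z * 1 + 0) * phi z + (z * z + 2) * - (z * phi z) = - (z * z * z * phi z) by ring.
  by rewrite oppr_le0 !mulr_ge0// ltW// phi_gt0.
(* Thus u H u <= 4 / 27 * (u^2 + 2) phi u, and (u^2 + 2) phi u is at most its value at 0, which
   accounts for 16 / 27. *)
have FE : F u = (u ^+ 2 + 2) * phi u - 27 / 4 * (u * H u) by rewrite /F /H /Hf; field.
by move: Fu; rewrite FE; lra.
Qed.

Section fixed.
Variables (U T S K : R -> R) (d : R).
Hypothesis tl : tails U T S K d.
Let E x := G x - S x.

Let E_ge0 x : 0 <= E x := tails_E_ge0 dQ Qy QNy tl x.

Lemma tails_d_ge0 : 0 <= d.
Proof.
have [x Ex] : exists x, 0 < E x \/ E x = 0.
  by exists 0; have := E_ge0 0; rewrite le_eqVlt => /predU1P[<-|]; [right|left].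
case: Ex => Ex.
  have [M GM] := G_surj Ex.
  have := @tails_d_ge _ Q dQ Qy QNy _ _ _ _ _ x M tl; rewrite -/G GM => /(_ (lexx _)).
  by apply: le_trans; rewrite mulr_ge0// ltW// H_gt0.
have f0 (T' S' K' U' : R -> R) : tails U' T' S' K' d -> 0 <= H 0 - K' 0.
  move=> tl'; have f0 : H z - K' z @[z --> +oo] --> (0 - 0 : R).
    by apply: cvgB => //; exact: tails_Ky tl'.
  rewrite subr0 in f0.
  apply: (@noninc_cvgy_le _ (fun z => H z - K' z) 0 0 _ f0) => // a b _ ab.
  apply: (derive_le0_le ab (fun x _ => is_deriveB' (dH x) (tails_dK tl' x))) => z _.
  by have := tails_E_ge0 dQ Qy QNy tl' z; rewrite -/G; lra.
have := f0 _ _ _ _ tl; have := f0 _ _ _ _ (tails_reflect tl).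
by rewrite oppr0 expr2 H0; lra.
Qed.

Lemma tails_E_le_phi x : E x <= phi x.
Proof.
apply: le_trans (G_le_phi x); have [x0|x0] := leP 0 x.
  by rewrite ger0_norm// /E gerBl (tails_S_ge0 tl).
have := tails_S_ge0 (tails_reflect tl) (- x); rewrite opprK ltr0_norm// GN /E; lra.
Qed.

(** With E x = G M, [ratio_le] bounds G M^2 by (phi 0)^2 * 2 H M, and [tails_d_ge] bounds 2 H M by
    d. *)
Lemma tails_E_le_sqrt x : E x <= phi 0 * Num.sqrt d.
Proof.
have [E0|E0] := leP (E x) 0.
  by rewrite (le_trans E0)// mulr_ge0 ?sqrtr_ge0// ltW// phi_gt0.
have [M GM] := G_surj E0.
have M0 : 0 <= M.
  by rewrite (le_trans (normr_ge0 x))//; exact: (tails_radius dQ Qy QNy tl GM).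
have := @tails_d_ge _ Q dQ Qy QNy _ _ _ _ _ x M tl; rewrite -/G GM => /(_ (lexx _)) dM.
have p0 := phi_gt0 (0 : R).
rewrite -ler_sqr ?nnegrE ?mulr_ge0 ?sqrtr_ge0//; [|exact: ltW..].
rewrite exprMn sqr_sqrtr ?tails_d_ge0// -GM (le_trans (ratio_le M0))//.
by rewrite ler_pM2l ?exprn_gt0.
Qed.

(** With E x = G M the claim is M d <= sqrt (1 + x^2). If M^2 <= 1 + x^2, then d <= 1 is enough.
    Otherwise 4 A B = M^2 - x^2 >= 1, and [tails_d_le] together with [radius_bound] gives it. *)
Lemma tails_E_lower x : 0 < d -> G (Num.sqrt (1 + x ^+ 2) / d) <= E x.
Proof.
move=> d0; have [M GM] := G_surj (tails_E_gt0 dQ Qy QNy x tl d0).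
rewrite -/(E x) in GM; rewrite -GM G_le ler_pdivlMr//.
have xM := tails_radius dQ Qy QNy tl GM.
have d1 := tails_d_le1 tl.
have dq := tails_d_le dQ Qy QNy tl GM.
have M0 : 0 <= M by rewrite (le_trans (normr_ge0 x)).
have x20 : 0 <= 1 + x ^+ 2 by rewrite addr_ge0// sqr_ge0.
have [Mx|xM2] := leP (M ^+ 2) (1 + x ^+ 2).
  apply: (@le_trans _ _ M); first by rewrite ler_piMr.
  by rewrite -(ler_sqr (x := M)) ?nnegrE ?sqrtr_ge0// sqr_sqrtr.
move: xM; rewrite ler_norml => /andP[xM1 xM3].
pose A := (M - x) / 2; pose B := (M + x) / 2.
have AB : 1 <= 4 * (A * B) by rewrite /A /B; nra.
have A0 : 0 <= A by rewrite /A; lra.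
have B0 : 0 <= B by rewrite /B; lra.
have {}A0 : 0 < A by rewrite lt_neqAle A0 andbT eq_sym; apply: contraTneq AB => ->; rewrite mul0r mulr0 -ltNge ltr01.
have {}B0 : 0 < B by rewrite lt_neqAle B0 andbT eq_sym; apply: contraTneq AB => ->; rewrite !mulr0 -ltNge ltr01.
have q1 u : 0 < u -> 2 * H u <= 1 - 79 / 50 * u + u ^+ 2.
  move=> u0; apply: le_trans (H_taylor (ltW u0)) _; rewrite lerD2r lerD2l lerN2.
  by rewrite ler_pM2r//; have := @phi0_ge R; lra.
have q2 u : 0 < u -> 2 * H u <= 121 / 500 / u.
  move=> u0; rewrite ler_pdivlMr// mulrC; apply: le_trans (H_cubic u0) _.
  by have := @phi0_le R; lra.
have := radius_bound A0 B0 AB (q1 A A0) (q1 B B0) (q2 A A0) (q2 B B0).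
have -> : B - A = x by rewrite /A /B; field.
have MAB : A + B = M by rewrite /A /B; field.
by apply: le_trans; rewrite MAB ler_wpM2l.
Qed.

End fixed.
End std_bounds.

(** * Smooth functions of compact support *)

Section derive_criteria.
Context {R : realType}.
Implicit Types (f g : R -> R) (x a e h C : R).

Lemma is_derive_eps f x a :
  (forall e, 0 < e -> exists2 r, 0 < r & forall h, h != 0 -> `|h| < r ->
     `|(f (x + h) - f x) / h - a| <= e) -> is_derive x 1 f a.
Proof.
move=> H.
have L : h^-1 *: ((f \o shift x) (h *: (1 : R)) - f x) @[h --> 0^'] --> a.
  apply/cvgrPdist_le => e e0; have [r r0 Hr] := H e e0.
  near=> h; rewrite distrC.
  have -> : h^-1 *: ((f \o shift x) (h *: (1 : R)) - f x) = (f (x + h) - f x) / h.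
    by rewrite /GRing.scale/= mulr1 mulrC [h + x]addrC.
  apply: Hr; first by near: h; exact: nbhs_dnbhs_neq.
  near: h; apply/nbhs_ballP; exists r => //= h /=; rewrite /ball/= sub0r normrN //.
split; last exact: cvg_lim L.
by apply/cvg_ex; exists a.
Unshelve. all: by end_near. Qed.

Lemma is_derive_sqr_le f C : f 0 = 0 -> (forall h, `|f h| <= C * h ^+ 2) -> is_derive (0 : R) 1 f 0.
Proof.
move=> f0 fC; apply: is_derive_eps => e e0.
have C0 : 0 <= C by have := fC 1; rewrite expr1n mulr1; exact: le_trans.
exists (e / (C + 1)); first by rewrite divr_gt0// ltr_wpDl.
move=> h h0 hr; rewrite add0r f0 !subr0 normrM normfV.
have h1 : 0 < `|h| by rewrite normr_gt0.
rewrite ler_pdivrMr// (le_trans (fC h))//.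
rewrite -[h ^+ 2]real_normK ?num_real// expr2 mulrA ler_wpM2r//.
move: hr; rewrite ltr_pdivlMr ?ltr_wpDl// => hr; nra.
Qed.

Lemma is_derive_near f g x a r : 0 < r -> (forall z, `|z - x| < r -> f z = g z) ->
  is_derive x 1 f a -> is_derive x 1 g a.
Proof.
move=> r0 fg [df <-]; apply: is_derive_eps => e e0.
have L : h^-1 *: ((f \o shift x) (h *: (1 : R)) - f x) @[h --> 0^'] --> 'D_1 f x by exact: df.
have /cvgrPdist_le/(_ e e0)/nbhs_ballP [r' /= r'0 Hr'] := L.
exists (Num.min r r'); first by rewrite lt_min r0.
move=> h h0; rewrite lt_min => /andP[hr hr'].
have := Hr' h; rewrite /ball /= sub0r normrN => /(_ hr' h0).
rewrite /GRing.scale/= mulr1 [h + x]addrC fg ?[f x]fg ?subrr ?normr0//; last by rewrite addrAC subrr add0r.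
by rewrite distrC mulrC.
Qed.

End derive_criteria.

Section smooth.
Context {R : realType}.
Implicit Types (f g : R -> R) (x t c m : R).

Lemma expr_le_expR t k : 0 <= t -> t ^+ k <= k`!%:R * expR t.
Proof.
elim: k t => [|k IH] t t0.
  by rewrite expr0 mul1r -expR0 ler_expR.
have d (z : R) : is_derive z 1 (fun z => k.+1`!%:R * expR z - z ^+ k.+1) (k.+1`!%:R * expR z - k.+1%:R * z ^+ k).
  apply: is_derive_ext (is_deriveB' (is_deriveM' (is_derive_cst' _ z) (is_derive_expR z)) (is_deriveX' k.+1 (is_derive_id' z))) _ _ => //.
  by rewrite mul0r add0r mulr1.
rewrite -subr_ge0; apply: (@le_trans _ _ (k.+1`!%:R * expR 0 - 0 ^+ k.+1)).
  by rewrite expr0n subr0 mulr_ge0// expR_ge0.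
apply: (derive_ge0_le t0 (fun z _ => d z)) => z /andP[z0 _].
by rewrite factS natrM -mulrA -mulrBr mulr_ge0// subr_ge0 IH// ltW.
Qed.

(* The functions [flat n] vanish to infinite order at 0; with their products and affine
   reparametrizations they span a space stable under differentiation. *)
Definition flat n x := if 0 < x then x ^- n * expR (- x^-1) else 0.

Lemma flat_ge0 n x : 0 <= flat n x.
Proof.
rewrite /flat; case: ltP => // x0.
by rewrite mulr_ge0 ?expR_ge0// invr_ge0 exprn_ge0// ltW.
Qed.

(** A quadratic bound is all that the derivative at 0 needs; it is t^k <= k! exp t with t = 1 / x
    and k = n + 2. *)
Lemma flat_le n x : flat n x <= n.+2`!%:R * x ^+ 2.
Proof.
rewrite /flat; case: ltP => x0; last by rewrite mulr_ge0// sqr_ge0.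
rewrite expRN ler_pdivrMr ?expR_gt0// -mulrA mulrCA -ler_pdivrMl ?exprn_gt0//.
have -> : (x ^+ 2)^-1 * x ^- n = x^-1 ^+ n.+2.
  by rewrite -invfM -exprD -exprVn addnC addn2.
by apply: expr_le_expR; rewrite invr_ge0 ltW.
Qed.

Lemma is_derive_flat n x : is_derive x 1 (flat n) (flat n.+2 x - n%:R * flat n.+1 x).
Proof.
have [x0|x0|x0] := ltgtP x 0.
- have -> : flat n.+2 x - n%:R * flat n.+1 x = 0.
    by rewrite /flat ltNge ltW//= mulr0 subrr.
  apply: (@is_derive_near _ (fun=> 0) _ _ _ (- x)); [by rewrite oppr_gt0|].
  move=> z; rewrite ltr_norml ltrBlDr addNr => /andP[_ z0].
  by rewrite /flat ltNge ltW.
- apply: (@is_derive_near _ (fun z => z ^- n * expR (- z^-1)) _ _ _ x) => //.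
    move=> z; rewrite ltr_norml ltrBrDr addNr => /andP[z0 _].
    by rewrite /flat z0.
  have xn0 : x != 0 by rewrite gt_eqF.
  have d1 := @is_deriveV' _ (fun z => z ^+ n) _ _ (expf_neq0 n xn0) (is_deriveX' n (is_derive_id' x)).
  have d2 := is_derive_expR' (is_deriveN' (@is_deriveV' _ id _ _ xn0 (is_derive_id' x))).
  apply: is_derive_ext (is_deriveM' d1 d2) _ _ => //.
  rewrite /flat x0 !mulr1.
  case: n {d1 d2} => [|n]; first by rewrite !mul0r; field.
  rewrite [n.+1.-1]/= !exprS; field; by rewrite xn0 expf_neq0.
- rewrite x0 /flat ltxx mulr0 subrr; apply: (@is_derive_sqr_le _ _ n.+2`!%:R).
    by rewrite ltxx.
  by move=> h; rewrite -/(flat n h) ger0_norm ?flat_ge0// flat_le.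
Qed.

Inductive flat_span : (R -> R) -> Prop :=
| flat_span_gen n : flat_span (flat n)
| flat_span_add f g : flat_span f -> flat_span g -> flat_span (fun x => f x + g x)
| flat_span_mul f g : flat_span f -> flat_span g -> flat_span (fun x => f x * g x)
| flat_span_scale c f : flat_span f -> flat_span (fun x => c * f x)
| flat_span_comp m c f : flat_span f -> flat_span (fun x => f (m * x + c)).

Lemma flat_span_derive f : flat_span f ->
  exists2 f', flat_span f' & forall x, is_derive x 1 f (f' x).
Proof.
elim=> [n|{}f g _ [f' Sf' df] _ [g' Sg' dg]|{}f g Sf [f' Sf' df] Sg [g' Sg' dg]|c {}f _ [f' Sf' df]|m c {}f _ [f' Sf' df]].
- exists (fun x => flat n.+2 x + (- n%:R) * flat n.+1 x).
    by apply: flat_span_add; [|apply: flat_span_scale]; exact: flat_span_gen.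
  by move=> x; rewrite mulNr; exact: is_derive_flat.
- exists (fun x => f' x + g' x); first exact: flat_span_add.
  by move=> x; exact: is_deriveD'.
- exists (fun x => f' x * g x + f x * g' x).
    by apply: flat_span_add; exact: flat_span_mul.
  by move=> x; exact: is_deriveM'.
- exists (fun x => c * f' x); first exact: flat_span_scale.
  by move=> x; apply: is_derive_ext (is_deriveM' (is_derive_cst' c x) (df x)) _ _ => //; rewrite mul0r add0r.
- exists (fun x => m * f' (m * x + c)); first by apply: flat_span_scale; exact: flat_span_comp.
  by move=> x; rewrite mulrC; apply: is_derive_comp' (is_derive_affine m c x).
Qed.

(** A class of functions closed under differentiation contains only smooth functions, so no formula
    for higher derivatives is required. *)
Lemma derive1n_smooth (S : (R -> R) -> Prop) f :
  (forall g, S g -> exists2 g', S g' & forall x, is_derive x 1 g (g' x)) -> S f ->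
  forall k x, derivable (f^`(k)%classic) x 1.
Proof.
move=> HS Sf k.
have Sk : S (f^`(k)%classic).
  elim: k => [|k IH]; first by rewrite derive1n0.
  have [g' Sg' dg] := HS _ IH.
  have -> : f^`(k.+1)%classic = g' by rewrite derive1nS; apply/funext => x; rewrite derive1E; case: (dg x).
  exact: Sg'.
by have [g' _ dg] := HS _ Sk => x; case: (dg x).
Qed.

End smooth.

Section compact_support.
Context {R : realType}.
Implicit Types (f g k : R -> R) (a b c x : R).
Notation mu := lebesgue_measure.

Lemma patch_itv f a b : (forall x, ~~ (a <= x <= b) -> f x = 0) -> f \_ `[a, b] = f.
Proof.
move=> f0; apply/funext => x; rewrite patchE; case: ifPn => // xab.
rewrite f0//; apply: contra xab => xab; apply/mem_set => /=.
by rewrite in_itv.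
Qed.

Let leb_mkcond (D : set R) (f : R -> R) : measurable D ->
  mu.-integrable D (EFin \o f) <-> mu.-integrable [set: R] (EFin \o (f \_ D)).
Proof.
move=> mD; have := @integrable_mkcond _ (measurableTypeR R) R mu D (EFin \o f) mD.
by rewrite restrict_EFin.
Qed.

Lemma compact_support_integrable f a b : continuous f ->
  (forall x, ~~ (a <= x <= b) -> f x = 0) -> mu.-integrable [set: R] (EFin \o f).
Proof.
move=> cf f0.
have H : mu.-integrable `[a, b] (EFin \o f).
  apply: continuous_compact_integrable; first exact: segment_compact.
  exact: continuous_subspaceT.
by have := (leb_mkcond f (measurable_itv _)).1 H; rewrite patch_itv.
Qed.

Lemma antiderivative f : continuous f -> (forall x, x <= 0 -> f x = 0) ->
  exists2 F : R -> R, forall x, is_derive x 1 F (f x) & forall x, x <= 0 -> F x = 0.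
Proof.
move=> cf f0; exists (fun x => \int[mu]_(t in `]-oo, x]) f t)%R.
  move=> x.
  have fi : mu.-integrable `]-oo, (x + 1)] (EFin \o f).
    have H : mu.-integrable `[0, (x + 1)] (EFin \o f).
      apply: continuous_compact_integrable; first exact: segment_compact.
      exact: continuous_subspaceT.
    apply: (leb_mkcond f (measurable_itv _)).2.
    have := (leb_mkcond f (measurable_itv _)).1 H.
    rewrite (_ : f \_ `[0, (x + 1)] = f \_ `]-oo, (x + 1)]) //.
    apply/funext => z; rewrite !patchE !mem_setE !in_itv/=.
    have [//|z0] := leP 0 z; case: ifP => //= _.
    by rewrite f0// ltW.
  have xx : x < x + 1 by rewrite ltrDl.
  have [||dF F'] := @continuous_FTC1 R f -oo%O x (x + 1) xx fi; [exact: ltNyr|exact: cf|].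
  by split; [exact: dF|rewrite -derive1E; exact: F'].
move=> x x0; transitivity (\int[mu]_(t in `]-oo, x]) (0 : R))%R; last by rewrite Rintegral_cst// mul0r.
apply: eq_Rintegral => t; rewrite inE/= in_itv/= => tx; by rewrite f0// (le_trans tx).
Qed.

(** Since its primitive K rises from 0 to 1, k is a probability density on [a, b], and an average of
    psi stays as close to v as psi does on [a, b]. *)
Lemma bump_average (k K psi : R -> R) (a b v e : R) : a < b -> continuous k -> (forall x, 0 <= k x) ->
  (forall x, ~~ (a <= x <= b) -> k x = 0) -> (forall x, is_derive x 1 K (k x)) ->
  K a = 0 -> K b = 1 -> continuous psi -> (forall x, a <= x <= b -> `|psi x - v| <= e) ->
  `|(\int[mu]_x (psi x * k x))%R - v| <= e.
Proof.
move=> ab ck k0 ks dK Ka Kb cpsi pe.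
have k1 : (\int[mu]_x k x)%R = 1.
  rewrite -(patch_itv ks) -Rintegral_mkcond /Rintegral (@continuous_FTC2 _ k K)//.
  - by rewrite Ka Kb sube0.
  - exact: continuous_subspaceT.
  - split => [x _||]; first by case: (dK x).
      apply: cvg_at_right_filter; exact: (is_derive_continuous (dK a)).
    apply: cvg_at_left_filter; exact: (is_derive_continuous (dK b)).
  - by move=> x _; rewrite derive1E; case: (dK x).
have ik := compact_support_integrable ck ks.
have ipk : mu.-integrable [set: R] (EFin \o (fun x => psi x * k x)).
  apply: (@compact_support_integrable _ a b); last by move=> x /ks ->; rewrite mulr0.
  by move=> x; apply: cvgM; [exact: cpsi|exact: ck].
have le1 x : (v - e) * k x <= psi x * k x <= (v + e) * k x.
  have [xab|xab] := boolP (a <= x <= b); last by rewrite (ks _ xab) !mulr0 lexx.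
  by have := pe x xab; rewrite ler_norml => /andP[? ?]; rewrite !ler_wpM2r//; lra.
have icst c : mu.-integrable [set: R] (EFin \o (fun x => c * k x)).
  apply: (@compact_support_integrable _ a b); last by move=> x /ks ->; rewrite mulr0.
  by move=> x; apply: cvgM; [exact: cvg_cst|exact: ck].
rewrite ler_norml; apply/andP; split.
  have : (\int[mu]_x ((v - e) * k x) <= \int[mu]_x (psi x * k x))%R.
    by apply: le_Rintegral => // x _; case/andP: (le1 x).
  by rewrite RintegralZl// k1 mulr1 lerBrDr addrC.
have : (\int[mu]_x (psi x * k x) <= \int[mu]_x ((v + e) * k x))%R.
  by apply: le_Rintegral => // x _; case/andP: (le1 x).
by rewrite RintegralZl// k1 mulr1 lerBlDl.
Qed.

End compact_support.

Section ramp.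
Context {R : realType}.
Implicit Types (x e : R).

(* A smooth ramp: its second derivative is a probability density supported by [0, 1]. *)
Lemma smooth_ramp : exists r : (R -> R) * (R -> R) * (R -> R),
  [/\ flat_span r.2, forall x, is_derive x 1 r.1.1 (r.1.2 x), forall x, is_derive x 1 r.1.2 (r.2 x),
    (forall x, 0 <= r.2 x) /\ (forall x, ~~ (0 <= x <= 1) -> r.2 x = 0) &
    [/\ forall x, x <= 0 -> r.1.1 x = 0, forall x, x <= 0 -> r.1.2 x = 0, forall x, 1 <= x -> r.1.2 x = 1,
      forall x, 1 <= x -> r.1.1 x = x - 1 + r.1.1 1 & forall x, x - 1 <= r.1.1 x <= Num.max x 0]].
Proof.
(* The bump exp (- 1 / x) exp (- 1 / (1 - x)) on ]0, 1[. Its primitive divided by its total mass is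
   the derivative of the ramp. *)
pose rho x : R := flat 0 x * flat 0 (-1 * x + 1).
have Srho : flat_span rho by apply: flat_span_mul; [|apply: flat_span_comp]; exact: flat_span_gen.
have rho0 x : 0 <= rho x by rewrite mulr_ge0// flat_ge0.
have rhol x : x <= 0 -> rho x = 0 by rewrite /rho /flat; case: ltP; rewrite ?mul0r.
have rhor x : 1 <= x -> rho x = 0.
  move=> x1; have h : (0 < -1 * x + 1) = false by apply/negbTE; rewrite -leNgt; lra.
  by rewrite /rho /flat h mulr0.
have crho : continuous rho.
  have [rho' _ dr] := flat_span_derive Srho.
  by move=> x; apply: is_derive_continuous.
have [F1 dF1 F10] := antiderivative crho rhol.
have F1nd x y : x <= y -> F1 x <= F1 y.
  by move=> xy; apply: (derive_ge0_le xy (fun z _ => dF1 z)) => z _.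
have F1c x : 1 <= x -> F1 x = F1 1.
  move=> x1; apply/eqP; rewrite eq_le (F1nd _ _ x1) andbT.
  by apply: (derive_le0_le x1 (fun z _ => dF1 z)) => z /andP[/ltW z1 _]; rewrite rhor.
pose c := F1 1.
have c0 : 0 < c.
  have : F1 (1 / 4) < F1 (3 / 4).
    rewrite -subr_gt0; have [|z /andP[z1 z2] ->] := @MVT_itv R F1 rho (1 / 4) (3 / 4) _ (fun z _ => dF1 z); first lra.
    rewrite mulr_gt0//; last lra.
    by rewrite /rho /flat !ifT ?mulr_gt0 ?expR_gt0//; rewrite ?invr_gt0 ?expr0//; lra.
  have := F1nd (3 / 4) 1; have := F1nd 0 (1 / 4); rewrite F10// /c.
  by move=> /(_ _) H1 /(_ _) H2; have {}H1 := H1 ltac:(lra); have {}H2 := H2 ltac:(lra); lra.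
pose s x := F1 x / c.
have ds x : is_derive x 1 s (c^-1 * rho x).
  by apply: is_derive_ext (is_deriveM' (dF1 x) (is_derive_cst' c^-1 x)) _ _ => //; ring.
have s0 x : x <= 0 -> s x = 0 by move=> x0; rewrite /s F10// mul0r.
have s1 x : 1 <= x -> s x = 1 by move=> x1; rewrite /s F1c// divff// gt_eqF.
have snd x y : x <= y -> s x <= s y by move=> xy; rewrite /s ler_pM2r ?invr_gt0// F1nd.
have s_ge0 x : 0 <= s x.
  by have [/s0 ->//|/ltW x0] := leP x 0; rewrite -(s0 0)// snd.
have s_le1 x : s x <= 1.
  by have [/s1 ->//|/ltW x1] := leP 1 x; rewrite -(s1 1)// snd.
have [r dr r0] : exists2 F : R -> R, forall x, is_derive x 1 F (s x) & forall x, x <= 0 -> F x = 0.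
  apply: antiderivative => // x.
  exact: (@is_derive_continuous _ s (fun x => c^-1 * rho x) x (ds x)).
have r1 x : 1 <= x -> r x = x - 1 + r 1.
  move=> x1; have d (z : R) : is_derive z 1 (fun z => r z - z) (s z - 1).
    by apply: is_deriveB'.
  have H1 := derive_le0_le x1 (fun z _ => d z).
  have H2 := derive_ge0_le x1 (fun z _ => d z).
  have : r x - x <= r 1 - 1 by apply: H1 => z _; rewrite subr_le0.
  have : r 1 - 1 <= r x - x by apply: H2 => z /andP[/ltW z1 _]; rewrite s1// subrr.
  by move=> ? ?; lra.
exists (r, s, fun x => c^-1 * rho x); split => //=.
- exact: flat_span_scale.
- split=> [x|x]; first by rewrite mulr_ge0// invr_ge0 ltW.
  rewrite negb_and -!ltNge => /orP[/ltW/rhol|/ltW/rhor] ->; exact: mulr0.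
split=> //; move=> x.
have rge z : 0 <= z -> 0 <= r z <= z.
  move=> z0; apply/andP; split.
    by rewrite -(r0 0)//; apply: (derive_ge0_le z0 (fun z _ => dr z)).
  have d (w : R) : is_derive w 1 (fun w => r w - w) (s w - 1) by apply: is_deriveB'.
  have := derive_le0_le z0 (fun w _ => d w); rewrite (r0 0)// subrr subr_le0; apply => t _.
  by rewrite subr_le0.
have [x0|/ltW x0] := leP x 0.
  by rewrite r0//; apply/andP; split; lra.
have /andP[h1 h2] := rge x x0.
rewrite h2 andbT; have [x1|/ltW x1] := leP x 1; first lra.
by rewrite r1//; have /andP[] := rge 1 ler01; lra.
Qed.

End ramp.

(** * Convex functions as integrals of kernels against psi'' *)

Section convex_real.
Context {R : realType}.
Implicit Types (f psi : R -> R) (a b c x y e : R).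

Lemma convex_function_cvxR psi : convex_function (E := R^o) setT psi -> cvxR psi.
Proof.
move=> cpsi t x y t0 t1; have := cpsi (Itv01 t0 t1) x y.
by rewrite !inE => /(_ I I); rewrite !convRE.
Qed.

Lemma cvxR_chord psi x h : cvxR psi -> 0 <= h -> h <= 1 ->
  h * (psi x - psi (x - 1)) <= psi (x + h) - psi x <= h * (psi (x + 1) - psi x).
Proof.
move=> cpsi h0 h1; apply/andP; split.
  have h2 : 0 < 1 + h by lra.
  have := cpsi (1 + h)^-1 (x + h) (x - 1).
  rewrite invr_ge0 invf_le1 ?posrE// lerDl (ltW h2) h0 => /(_ isT isT).
  have -> : (1 + h)^-1 * (x + h) + (1 - (1 + h)^-1) * (x - 1) = x by field; rewrite gt_eqF.
  move=> /(ler_wpM2l (ltW h2)).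
  have -> : (1 + h) * ((1 + h)^-1 * psi (x + h) + (1 - (1 + h)^-1) * psi (x - 1)) =
    psi (x + h) + h * psi (x - 1) by field; rewrite gt_eqF.
  by lra.
have := cpsi h (x + 1) x h0 h1.
have -> : h * (x + 1) + (1 - h) * x = x + h by ring.
by lra.
Qed.

Lemma cvxR_comp_opp psi : cvxR psi -> cvxR (fun x => psi (- x)).
Proof. by move=> cpsi t x y t0 t1; rewrite opprD -!mulrN; exact: cpsi. Qed.

Lemma cvxR_lip psi x : cvxR psi -> exists2 L, 0 <= L & forall h, `|h| <= 1 -> `|psi (x + h) - psi x| <= L * `|h|.
Proof.
move=> cpsi; pose L := `|psi x - psi (x - 1)| + `|psi (x + 1) - psi x|.
exists L; first by rewrite addr_ge0.
have key f z h : cvxR f -> 0 <= h -> h <= 1 ->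
    `|f (z + h) - f z| <= (`|f z - f (z - 1)| + `|f (z + 1) - f z|) * h.
  move=> cf h0 h1; have /andP[l u] := cvxR_chord z cf h0 h1.
  have n1 := ler_norm (f z - f (z - 1)); have n2 := ler_norm (f (z + 1) - f z).
  have n3 := ler_norm (- (f z - f (z - 1))); have n4 := normr_ge0 (f (z + 1) - f z).
  have n5 := normr_ge0 (f z - f (z - 1)); rewrite normrN in n3.
  by rewrite ler_norml; apply/andP; split; nra.
move=> h; rewrite ler_norml => /andP[hl hr]; have [h0|/ltW h0] := leP 0 h.
  by rewrite (ger0_norm h0); exact: key.
rewrite (ler0_norm h0); have := @key (fun z => psi (- z)) (- x) (- h) (cvxR_comp_opp cpsi).
rewrite oppr_ge0 lerNl => /(_ h0 hl); rewrite opprD !opprK.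
have -> : - (- x - 1) = x + 1 by ring.
have -> : - (- x + 1) = x - 1 by ring.
rewrite (distrC (psi x) (psi (x + 1))) (distrC (psi (x - 1)) (psi x)) /L => H.
by rewrite [X in X * _]addrC.
Qed.

Lemma cvxR_continuous psi : cvxR psi -> continuous psi.
Proof.
move=> cpsi x; have [L L0 HL] := cvxR_lip x cpsi.
apply/cvgrPdist_le => e e0; apply/nbhs_ballP; exists (Num.min 1 (e / (L + 1))).
  by rewrite /= lt_min ltr01 divr_gt0// ltr_wpDl.
move=> y; rewrite /ball/= lt_min => /andP[y1 y2]; rewrite distrC.
rewrite distrC in y1; have := HL (y - x) (ltW y1); rewrite [x + _]addrC subrK => /le_trans; apply.
move: y2; rewrite ltr_pdivlMr ?ltr_wpDl// distrC => y2.
by have := normr_ge0 (y - x); nra.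
Qed.

End convex_real.

Section locally_finite.
Context {R : realType}.
Variable m : {measure set R -> \bar R}.
Hypothesis mfin : forall K : set R, compact K -> (m K < +oo)%E.
Implicit Types (f g : R -> R) (a b c x y e C : R).

Lemma bounded_support_integrable f a b C : measurable_fun setT f ->
  (forall x, `|f x| <= C) -> (forall x, ~~ (a <= x <= b) -> f x = 0) ->
  m.-integrable setT (EFin \o f).
Proof.
move=> mf fC f0.
have mab : measurable `[a, b]%classic by exact: measurable_itv.
have H : m.-integrable `[a, b] (EFin \o f).
  apply: measurable_bounded_integrable => //.
  - exact/mfin/segment_compact.
  - exact: measurable_funTS.
  - exists C; split; first exact: num_real.
    by move=> D CD x _; exact: le_trans (fC x) (ltW CD).
have := (integrable_mkcond (EFin \o f) mab).1 H.
by rewrite restrict_EFin patch_itv.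
Qed.

Lemma integral_close f g a b C : a <= b -> m.-integrable setT (EFin \o f) -> m.-integrable setT (EFin \o g) ->
  0 <= C -> (forall x, `|f x - g x| <= C) -> (forall x, ~~ (a <= x <= b) -> f x = g x) ->
  `|\int[m]_x f x - \int[m]_x g x|%R <= C * fine (m `[a, b]%classic).
Proof.
move=> ab fi gi C0 fgC fg0; rewrite -RintegralB//.
have mab : measurable `[a, b]%classic by exact: measurable_itv.
have ifg : m.-integrable setT (EFin \o (fun x => f x - g x)).
  by have := integrableB measurableT fi gi; apply: eq_integrable.
apply: le_trans (le_normr_Rintegral _ ifg) _ => //.
have s0 x : ~~ (a <= x <= b) -> `|f x - g x| = 0 by move=> /fg0 ->; rewrite subrr normr0.
rewrite -(patch_itv s0) -Rintegral_mkcond.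
have mabfin : (m `[a, b]%classic < +oo)%E by exact/mfin/segment_compact.
rewrite -Rintegral_cst//; apply: le_Rintegral => //.
- have := integrable_norm ifg; exact: (integrableS measurableT mab (@subsetT _ _)).
- apply: measurable_bounded_integrable => //; exists C; split; first exact: num_real.
  by move=> D CD x _ /=; rewrite ger0_norm// ltW.
Qed.

End locally_finite.

Section tents.
Context {R : realType}.
Implicit Types (f g : R -> R) (a b c x y e C : R).
Notation mu := lebesgue_measure.

Definition pos x : R := Num.max x 0.

(** The hat function on [a, c] with peak 1 at b, written as a combination of ramps so that smoothing
    each ramp turns it into a test function. *)
Definition tent a b c x : R :=
  (b - a)^-1 * pos (x - a) - ((b - a)^-1 + (c - b)^-1) * pos (x - b) + (c - b)^-1 * pos (x - c).

(** Each ramp is replaced by a smooth one rescaled to width e. The second derivative is then a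
    combination of bumps just to the right of a, b and c, so integrating psi against it gives nearly
    the difference of the two chord slopes. *)
Lemma smooth_tent psi (m : {measure set R -> \bar R}) a b c e eta : continuous psi ->
  second_derivative_measure psi m -> a < b -> b < c -> 0 < e ->
  (forall z x, z \in [:: a; b; c] -> z <= x <= z + e -> `|psi x - psi z| <= eta) ->
  exists phi : R -> R,
  [/\ continuous phi, forall x, ~~ (a <= x <= c + e) -> phi x = 0,
     forall x, `|phi x - tent a b c x| <= 2 * ((b - a)^-1 + (c - b)^-1) * e &
     `|\int[m]_x phi x - ((c - b)^-1 * (psi c - psi b) - (b - a)^-1 * (psi b - psi a))|%R
       <= 2 * ((b - a)^-1 + (c - b)^-1) * eta].
Proof.
move=> cpsi [mfin mtest] ab bc e0 psie.
have [[[r s] rho] /= [Srho dr ds [rho0 rhos] [r0 s0 s1 r1 rb]]] := @smooth_ramp R.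
set al := (b - a)^-1; set be := (c - b)^-1.
have al0 : 0 < al by rewrite invr_gt0 subr_gt0.
have be0 : 0 < be by rewrite invr_gt0 subr_gt0.
have eV0 : 0 < e^-1 by rewrite invr_gt0.
have aff z x : e^-1 * x + - (z / e) = (x - z) / e by field; rewrite gt_eqF.
pose comb (f : R -> R) x := al * f ((x - a) / e) - (al + be) * f ((x - b) / e) + be * f ((x - c) / e).
have dcomb f f' x : (forall x, is_derive x 1 f (f' x)) ->
    is_derive x 1 (comb f) (e^-1 * comb f' x).
  move=> df.
  have d z : is_derive x 1 (fun x => f ((x - z) / e)) (f' ((x - z) / e) * e^-1).
    apply: is_derive_ext (is_derive_comp' (g := fun x => e^-1 * x + - (z / e)) (df _) (is_derive_affine e^-1 (- (z / e)) x)) _ _.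
      by move=> t /=; rewrite aff.
    by rewrite aff.
  apply: is_derive_ext (is_deriveD' (is_deriveB' (is_deriveM' (is_derive_cst' al x) (d a)) (is_deriveM' (is_derive_cst' (al + be) x) (d b))) (is_deriveM' (is_derive_cst' be x) (d c))) _ _ => //.
  by rewrite /comb; ring.
pose phi x := e * comb r x.
have dphi x : is_derive x 1 phi (comb s x).
  apply: is_derive_ext (is_deriveM' (is_derive_cst' e x) (dcomb r s x dr)) _ _ => //.
  by rewrite mul0r add0r mulrA divff ?gt_eqF// mul1r.
pose phi2 x := e^-1 * comb rho x.
have dphi1 x : is_derive x 1 (comb s) (phi2 x) by exact: dcomb.
have Sphi2 : flat_span phi2.
  have Sz z : flat_span (fun x => rho ((x - z) / e)).
    have := flat_span_comp e^-1 (- (z / e)) Srho.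
    by congr flat_span; apply/funext => x; rewrite aff.
  apply: flat_span_scale.
  have -> : comb rho = fun x => (al * rho ((x - a) / e) + (- (al + be)) * rho ((x - b) / e)) + be * rho ((x - c) / e).
    by apply/funext => x; rewrite /comb mulNr.
  by apply: flat_span_add; [apply: flat_span_add|]; apply: flat_span_scale.
have phi_supp x : ~~ (a <= x <= c + e) -> phi x = 0.
  rewrite negb_and -!ltNge => /orP[xa|cx].
    have neg z : a <= z -> r ((x - z) / e) = 0.
      by move=> az; rewrite r0// pmulr_lle0 ?invr_gt0//; lra.
    by rewrite /phi /comb !neg ?mulr0 ?subrr ?addr0 ?mulr0// ltW// (lt_trans ab).
  have big z : z <= c -> r ((x - z) / e) = (x - z) / e - 1 + r 1.
    by move=> zc; rewrite r1// ler_pdivlMr//; lra.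
  rewrite /phi /comb (big a (ltW (lt_trans ab bc))) (big b (ltW bc)) (big c (lexx c)).
  have -> : al * ((x - a) / e - 1 + r 1) - (al + be) * ((x - b) / e - 1 + r 1) + be * ((x - c) / e - 1 + r 1) =
     (al * (b - a) - be * (c - b)) / e by ring.
  by rewrite /al /be !mulVf ?subr_eq0 ?gt_eqF// subrr mul0r mulr0.
have cphi : continuous phi by move=> t; exact: (is_derive_continuous (dphi t)).
(* The function and its first derivative are primitives outside [flat_span]; from the second
   derivative on everything lies in the span. *)
have phi_test : test_function phi.
  split.
    apply: (@derive1n_smooth _ (fun g => [\/ flat_span g, g = comb s | g = phi])); last by apply: Or33.
    move=> g [Sg|->|->].
    - by have [g' Sg' dg] := flat_span_derive Sg; exists g' => //; exact: Or31.
    - by exists phi2 => //; exact: Or31.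
    - by exists (comb s) => //; exact: Or32.
  apply: (@subclosed_compact _ _ `[a, (c + e)]); first exact: closed_closure.
    exact: segment_compact.
  have -> : `[a, (c + e)]%classic = closure `[a, (c + e)]%classic.
    by apply/closure_id; exact: itv_closed.
  apply: closure_subset => t /= /eqP pt; rewrite in_itv/=; apply: contra_notT pt; exact: phi_supp.
have E2 : phi^`(2)%classic = phi2.
  rewrite derive1nS derive1n1.
  have -> : phi^`()%classic = comb s by apply/funext => x; rewrite derive1E; case: (dphi x).
  by apply/funext => x; rewrite derive1E; case: (dphi1 x).
have := mtest phi phi_test; rewrite E2 => Eint.
exists phi; split => //.
  move=> x; have near z : `|e * r ((x - z) / e) - pos (x - z)| <= e.
    have /andP[h1 h2] := rb ((x - z) / e).
    have h3 : x - z - e <= e * r ((x - z) / e).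
      have -> : x - z - e = e * ((x - z) / e - 1) by field; rewrite gt_eqF.
      by rewrite ler_pM2l.
    have h4 : e * r ((x - z) / e) <= pos (x - z).
      have -> : pos (x - z) = e * Num.max ((x - z) / e) 0.
        by rewrite maxr_pMr ?(ltW e0)// mulr0; congr Num.max; field; rewrite gt_eqF.
      by rewrite ler_pM2l.
    have h5 : 0 <= e * r ((x - z) / e).
      apply: mulr_ge0; first exact: ltW.
      have [/r0 ->//|z0] := leP ((x - z) / e) 0.
      rewrite -(r0 0)//; apply: (derive_ge0_le (ltW z0) (fun z _ => dr z)) => t _.
      have [/s0 ->//|/ltW t0] := leP t 0.
      by rewrite -(s0 0)//; apply: (derive_ge0_le t0 (fun z _ => ds z)).
    rewrite ler_norml; apply/andP; split; last lra.
    by rewrite /pos; case: (leP (x - z) 0) => ?; lra.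
  have -> : phi x - tent a b c x = al * (e * r ((x - a) / e) - pos (x - a))
     - (al + be) * (e * r ((x - b) / e) - pos (x - b)) + be * (e * r ((x - c) / e) - pos (x - c)).
    by rewrite /phi /comb /tent -/al -/be; ring.
  move: (near a) (near b) (near c); rewrite !ler_norml => /andP[? ?] /andP[? ?] /andP[? ?].
  by apply/andP; split; nra.
pose k z x := e^-1 * rho ((x - z) / e).
have ck z : continuous (k z).
  have [rho' _ drho] := flat_span_derive Srho.
  move=> x; apply: cvgM; first exact: cvg_cst.
  apply: (@cvg_comp _ _ _ (fun x => (x - z) / e) rho _ (nbhs ((x - z) / e))); last exact: (@is_derive_continuous _ rho rho').
  by apply: cvgM; [apply: cvgB; [exact: cvg_id|exact: cvg_cst]|exact: cvg_cst].
have ks z x : ~~ (z <= x <= z + e) -> k z x = 0.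
  move=> zx; rewrite /k rhos ?mulr0//; apply: contra zx => /andP[].
  by rewrite pmulr_lge0// ler_pdivrMr// mul1r => ? ?; apply/andP; split; lra.
have kge z x : 0 <= k z x by rewrite mulr_ge0// ltW.
have dK z x : is_derive x 1 (fun x => s ((x - z) / e)) (k z x).
  apply: is_derive_ext (is_derive_comp' (g := fun x => e^-1 * x + - (z / e)) (ds _) (is_derive_affine e^-1 (- (z / e)) x)) _ _.
    by move=> t /=; rewrite aff.
  by rewrite aff mulrC.
have avg z : z \in [:: a; b; c] -> `|(\int[mu]_x (psi x * k z x))%R - psi z| <= eta.
  move=> zin; apply: (bump_average (a := z) (b := z + e) (K := fun x => s ((x - z) / e))) => //.
  - by rewrite ltrDl.
  - exact: ks.
  - by rewrite subrr mul0r s0.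
  - by rewrite [z + e]addrC addrK divff ?gt_eqF// s1.
  - by move=> x; exact: psie.
have ik z : mu.-integrable [set: R] (EFin \o (fun x => psi x * k z x)).
  apply: (@compact_support_integrable _ _ z (z + e)); last by move=> x /ks ->; rewrite mulr0.
  by move=> x; apply: cvgM; [exact: cpsi|exact: ck].
pose J z := (\int[mu]_x (psi x * k z x))%R.
have ikZ t z : mu.-integrable [set: R] (EFin \o (fun x => t * (psi x * k z x))).
  apply: (@compact_support_integrable _ _ z (z + e)); last by move=> x /ks ->; rewrite !mulr0.
  by move=> x; apply: cvgM; [exact: cvg_cst|apply: cvgM; [exact: cpsi|exact: ck]].
have RHS : (\int[mu]_x (psi x * phi2 x))%R = al * J a - (al + be) * J b + be * J c.
  transitivity (\int[mu]_x (al * (psi x * k a x) + - (al + be) * (psi x * k b x) + be * (psi x * k c x)))%R.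
    by apply: eq_Rintegral => x _; rewrite /phi2 /comb /k; ring.
  rewrite RintegralD//; last first.
    have := integrableD measurableT (ikZ al a) (ikZ (- (al + be)) b).
    by apply: eq_integrable.
  by rewrite RintegralD// !RintegralZl// mulNr.
have -> : (\int[m]_x phi x)%R = al * J a - (al + be) * J b + be * J c.
  by rewrite -RHS /Rintegral Eint.
move: (avg a) (avg b) (avg c); rewrite !inE !eqxx !orbT -!/(J _) !ler_norml.
move=> /(_ isT)/andP[? ?] /(_ isT)/andP[? ?] /(_ isT)/andP[? ?].
by apply/andP; split; nra.
Qed.

End tents.

Section tent_identity.
Context {R : realType}.
Implicit Types (f g : R -> R) (a b c x y e C : R).

Lemma pos_continuous : continuous (@pos R).
Proof. by move=> x; apply: continuous_max; [exact: cvg_id|exact: cvg_cst]. Qed.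

Lemma pos_shift_continuous a : continuous (fun x => pos (x - a)).
Proof.
move=> x; apply: (@continuous_comp _ _ _ (fun x => x - a) (@pos R)); last exact: pos_continuous.
by apply: cvgB; [exact: cvg_id|exact: cvg_cst].
Qed.

Lemma tent_continuous a b c : continuous (tent a b c).
Proof.
move=> x; apply: cvgD; first apply: cvgB.
- by apply: cvgM; [exact: cvg_cst|exact: pos_shift_continuous].
- by apply: cvgM; [exact: cvg_cst|exact: pos_shift_continuous].
- by apply: cvgM; [exact: cvg_cst|exact: pos_shift_continuous].
Qed.

Lemma posE x : 0 <= x -> pos x = x.
Proof. by move=> x0; rewrite /pos max_l. Qed.

Lemma pos0 x : x <= 0 -> pos x = 0.
Proof. by move=> x0; rewrite /pos max_r. Qed.

Lemma tent_supp a b c x : a < b -> b < c -> ~~ (a <= x <= c) -> tent a b c x = 0.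
Proof.
move=> ab bc; rewrite negb_and -!ltNge => /orP[xa|cx]; rewrite /tent.
  by rewrite !pos0 ?mulr0 ?subrr ?addr0//; lra.
rewrite !posE ?subr_ge0 ?(ltW cx)//; try lra.
have ba : b - a != 0 by rewrite subr_eq0 gt_eqF.
have cb : c - b != 0 by rewrite subr_eq0 gt_eqF.
by field; apply/andP.
Qed.

Lemma tent_up a b c x : a < b -> b < c -> a <= x <= b -> tent a b c x = (b - a)^-1 * (x - a).
Proof.
move=> ab bc /andP[ax xb]; rewrite /tent (@posE (x - a)) ?subr_ge0// (@pos0 (x - b)) ?subr_le0// (@pos0 (x - c)); first by rewrite !mulr0 subr0 addr0.
by lra.
Qed.

Lemma tent_down a b c x : a < b -> b < c -> b <= x <= c -> tent a b c x = (c - b)^-1 * (c - x).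
Proof.
move=> ab bc /andP[bx xc]; have ba : b - a != 0 by rewrite subr_eq0 gt_eqF.
have cb : c - b != 0 by rewrite subr_eq0 gt_eqF.
rewrite /tent (@pos0 (x - c)) ?subr_le0// (@posE (x - b)) ?subr_ge0// posE; first by field; apply/andP.
by lra.
Qed.

Lemma tent_bound a b c x : a < b -> b < c -> 0 <= tent a b c x <= 1.
Proof.
move=> ab bc.
have [/andP[ax xc]|xac] := boolP (a <= x <= c); last by rewrite tent_supp// lexx ler01.
have [xb|/ltW bx] := leP x b.
  rewrite tent_up ?ax// mulrC; have ba : 0 < b - a by lra.
  by apply/andP; split; [apply: divr_ge0; lra|rewrite ler_pdivrMr// mul1r; lra].
rewrite tent_down ?bx// mulrC; have cb : 0 < c - b by lra.
by apply/andP; split; [apply: divr_ge0; lra|rewrite ler_pdivrMr// mul1r; lra].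
Qed.

Lemma tent_norm a b c x : a < b -> b < c -> `|tent a b c x| <= 1.
Proof. by move=> ab bc; have /andP[? ?] := tent_bound x ab bc; rewrite ger0_norm. Qed.

Variables (psi : R -> R) (m : {measure set R -> \bar R}).
Hypotheses (cpsi : continuous psi) (mpsi : second_derivative_measure psi m).

Lemma tent_integrable a b c : a < b -> b < c -> m.-integrable setT (EFin \o tent a b c).
Proof.
move=> ab bc; apply: (bounded_support_integrable mpsi.1 (a := a) (b := c)).
- exact: (continuous_measurable_fun (@tent_continuous a b c)).
- by move=> x; exact: tent_norm.
- by move=> x; exact: tent_supp.
Qed.

(** The defining identity of psi'', extended from test functions to hats by letting the smoothing
    width tend to 0. *)
Lemma tent_integral a b c : a < b -> b < c ->
  (\int[m]_x tent a b c x)%R = (c - b)^-1 * (psi c - psi b) - (b - a)^-1 * (psi b - psi a).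
Proof.
move=> ab bc; apply/eqP; rewrite -subr_eq0 -normr_le0; apply/ler_addgt0Pr => /= t; rewrite add0r => t0.
set al := (b - a)^-1; set be := (c - b)^-1.
have al0 : 0 < al by rewrite invr_gt0 subr_gt0.
have be0 : 0 < be by rewrite invr_gt0 subr_gt0.
pose eta := t / (2 * (2 * (al + be))).
have eta0 : 0 < eta by rewrite divr_gt0// !mulr_gt0// addr_gt0.
have near z : exists2 e, 0 < e & forall x, z <= x <= z + e -> `|psi x - psi z| <= eta.
  have /cvgrPdist_le cz : psi y @[y --> z] --> psi z by exact: cpsi.
  have /nbhs_ballP[e /= e0 He] := cz _ eta0.
  exists (e / 2); first by rewrite divr_gt0.
  move=> x /andP[x1 x2]; rewrite distrC; apply: He; rewrite /ball/= ler0_norm; lra.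
have [ea ea0 Ha] := near a; have [eb eb0 Hb] := near b; have [ec ec0 Hc] := near c.
set M := fine (m `[a, (c + 1)]%classic).
have M0 : 0 <= M by exact: fine_ge0.
(* The width respects the moduli of continuity at a, b and c; e <= 1 keeps the supports inside
   [a, c + 1], and e (M + 1) <= eta controls the uniform error times the mass M of that interval. *)
pose e := Num.min (Num.min (Num.min ea eb) (Num.min ec 1)) (eta / (M + 1)).
have e0 : 0 < e by rewrite !lt_min ea0 eb0 ec0 ltr01 divr_gt0// ltr_wpDl.
have : e <= e by [].
rewrite {2}/e !le_min => /andP[/andP[/andP[ea1 eb1] /andP[ec1 e1]] e2].
rewrite ler_pdivlMr ?ltr_wpDl// in e2.
have pe z x : z \in [:: a; b; c] -> z <= x <= z + e -> `|psi x - psi z| <= eta.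
  rewrite !inE => zin /andP[x1 x2].
  by case/or3P : zin => /eqP zE; subst z; [apply: Ha|apply: Hb|apply: Hc]; rewrite x1/= (le_trans x2)// lerD2l.
have [f [cf fs ft fi]] := smooth_tent cpsi mpsi ab bc e0 pe.
have fi' : m.-integrable setT (EFin \o f).
  apply: (bounded_support_integrable mpsi.1 (a := a) (b := c + e) (C := 2 * (al + be) * e + 1)).
  - exact: (continuous_measurable_fun cf).
  - move=> x; rewrite -[f x](subrK (tent a b c x)); apply: le_trans (ler_normD _ _) _.
    by rewrite lerD ?ft// tent_norm.
  - exact: fs.
have ac1 : a <= c + 1 by lra.
have C0 : 0 <= 2 * (al + be) * e by apply: mulr_ge0; [apply: mulr_ge0 => //; lra|exact: ltW].
have D := integral_close mpsi.1 ac1 fi' (tent_integrable ab bc) C0 ft.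
have {}D : `|\int[m]_x f x - \int[m]_x tent a b c x|%R <= 2 * (al + be) * e * M.
  apply: D => x xac; rewrite tent_supp ?fs//; apply: contra xac => /andP[h1 h2]; apply/andP; split => //; lra.
move: fi D; rewrite -/al -/be.
set I := (\int[m]_x f x)%R; set J := (\int[m]_x tent a b c x)%R; set L := be * _ - al * _ => fi D.
have -> : J - L = (I - L) - (I - J) by ring.
apply: le_trans (ler_normB _ _) _; apply: le_trans (lerD fi D) _.
have -> : t = 2 * (al + be) * eta + 2 * (al + be) * eta.
  by rewrite /eta; field; rewrite gt_eqF// addr_gt0.
rewrite lerD2l -mulrA ler_wpM2l//; last by nra.
by apply: mulr_ge0 => //; lra.
Qed.

End tent_identity.

Section kernel.
Context {R : realType}.
Implicit Types (f g : R -> R) (a b c x y e C : R).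

(** The remainder kernel of Taylor's formula at 0. The point x = 0 belongs to the second branch, so
    an atom of psi'' at 0 acts on negative y; this matches the right derivative of psi at 0 in the
    affine part. *)
Definition kern y x : R := if 0 < x then pos (y - x) else pos (x - y).

Lemma kern_ge0 y x : 0 <= kern y x.
Proof. by rewrite /kern /pos; case: ifP => _; rewrite le_max lexx orbT. Qed.

Lemma measurable_pos d (T : measurableType d) (f : T -> R) :
  measurable_fun setT f -> measurable_fun setT (fun t => pos (f t)).
Proof. by move=> mf; apply: measurable_maxr. Qed.

Lemma measurable_kern d (T : measurableType d) (f g : T -> R) :
  measurable_fun setT f -> measurable_fun setT g -> measurable_fun setT (fun t => kern (f t) (g t)).
Proof.
move=> mf mg; apply: measurable_fun_ifT; first exact: measurable_fun_ltr.
  by apply: measurable_pos; exact: measurable_funB.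
by apply: measurable_pos; exact: measurable_funB.
Qed.

Lemma bounded_support_cvg (m : {measure set R -> \bar R}) (f : (R -> R)^nat) g a b C :
  (forall K : set R, compact K -> (m K < +oo)%E) ->
  (forall k, measurable_fun setT (f k)) -> measurable_fun setT g ->
  (forall k x, `|f k x| <= C) -> (forall k x, ~~ (a <= x <= b) -> f k x = 0) ->
  (forall x, \forall k \near \oo, f k x = g x) ->
  (\int[m]_x (f k x)%:E)%E @[k --> \oo] --> (\int[m]_x (g x)%:E)%E.
Proof.
move=> mfin mf mg fC fs fg.
have mab : measurable `[a, b]%classic by exact: measurable_itv.
have iG : m.-integrable setT (EFin \o (fun x => `|C| * \1_(`[a, b]%classic) x)).
  apply: (bounded_support_integrable mfin (a := a) (b := b) (C := `|C|)).
  - by apply: measurable_funM => //; exact: measurable_indic.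
  - move=> x; rewrite indicE normrM normr_id; case: (_ \in _); rewrite ?normr1 ?normr0 ?mulr1 ?mulr0//.
  - by move=> x xab; rewrite indicE memNset ?mulr0//= in_itv/=; apply/negP.
have [] // := @dominated_convergence _ _ R m setT measurableT (fun k => EFin \o f k) (EFin \o g) _
  (fun k => (measurable_EFinP _ _).2 (mf k)) ((measurable_EFinP _ _).2 mg) (aeW _ _) iG (aeW _ _).
- move=> x _; apply: cvg_near_cst; have := fg x; apply: filterS => k /= <-//.
- move=> x k _ /=; rewrite lee_fin indicE; have [xab|xab] := boolP (a <= x <= b).
    by rewrite mem_set/= ?in_itv//= mulr1 (le_trans (fC k x))// ler_norm.
  by rewrite fs// normr0 mulr_ge0.
Qed.

(** Slopes from 0 are nondecreasing in b and bounded below by the slope on [-1, 0], so they converge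
    to their infimum. *)
Lemma cvxR_right_derivative psi : cvxR psi ->
  exists l : R, (psi b - psi 0) / b @[b --> 0^'+] --> l.
Proof.
move=> cpsi; pose s b := (psi b - psi 0) / b.
have snd b c : 0 < b -> b <= c -> s b <= s c.
  move=> b0 bc; have c0 := lt_le_trans b0 bc.
  have := cpsi (b / c) c 0; rewrite (divr_ge0 (ltW b0) (ltW c0)) ler_pdivrMr// mul1r => /(_ isT bc).
  rewrite mulr0 addr0 divfK ?gt_eqF// => h.
  rewrite /s ler_pdivrMr// mulrAC ler_pdivlMr//.
  have : (psi b - psi 0) * c <= (b / c * (psi c - psi 0)) * c by rewrite ler_wpM2r ?(ltW c0)//; lra.
  by have -> : (b / c * (psi c - psi 0)) * c = (psi c - psi 0) * b by field; rewrite gt_eqF.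
have slb b : 0 < b -> psi 0 - psi (-1) <= s b.
  move=> b0; have b1 : 0 < 1 + b by lra.
  have := cpsi (1 + b)^-1 b (-1); rewrite invr_ge0 (ltW b1) invf_le1 ?posrE// lerDl (ltW b0) => /(_ isT isT).
  have -> : (1 + b)^-1 * b + (1 - (1 + b)^-1) * -1 = 0 by field; rewrite gt_eqF.
  move=> /(ler_wpM2l (ltW b1)).
  have -> : (1 + b) * ((1 + b)^-1 * psi b + (1 - (1 + b)^-1) * psi (-1)) = psi b + b * psi (-1) by field; rewrite gt_eqF.
  by move=> h; rewrite /s ler_pdivlMr//; lra.
pose S := [set s b | b in [set b | 0 < b]].
have S0 : has_inf S.
  split; first by exists (s 1), 1 => //=; exact: ltr01.
  by exists (psi 0 - psi (-1)) => _ [b b0 <-]; exact: slb.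
exists (inf S); apply/cvgrPdist_le => e e0.
have [_ [b0 /= b00 <-] hb0] := inf_adherent e0 S0.
near=> b.
have bp : 0 < b by near: b; exact: nbhs_right_gt.
have h1 : inf S <= s b by apply: ge_inf; [exact: S0.2|exists b].
have h2 : s b <= s b0 by apply: snd => //; near: b; exact: nbhs_right_le.
by rewrite -/(s b) ler0_norm; lra.
Unshelve. all: end_near. Qed.

Lemma kernel_representation psi (m : {measure set R -> \bar R}) : cvxR psi ->
  second_derivative_measure psi m -> exists l : R, forall y,
  (\int[m]_x (kern y x)%:E = (psi y - psi 0 - l * y)%:E)%E.
Proof.
move=> cpsi mpsi; have [l hl] := cvxR_right_derivative cpsi; exists l => y.
have cpsi' := cvxR_continuous cpsi.
have mtent a b c t : measurable_fun setT (fun x => t * tent a b c x).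
  apply: measurable_funM => //; exact: (continuous_measurable_fun (@tent_continuous _ a b c)).
have tint t a b c : a < b -> b < c -> (\int[m]_x (t * tent a b c x)%:E)%E =
   (t * ((c - b)^-1 * (psi c - psi b) - (b - a)^-1 * (psi b - psi a)))%:E.
  move=> ab bc; have it := tent_integrable mpsi ab bc.
  transitivity (\int[m]_x (t%:E * (tent a b c x)%:E))%E; first by apply: eq_integral.
  rewrite integralZl// EFinM -(tent_integral cpsi' mpsi ab bc) /Rintegral fineK//.
  exact: integrable_fin_num.
have mk : measurable_fun setT (kern y) by exact: measurable_kern.
have [y0|y0|->] := ltgtP y 0; last first.
- rewrite (_ : (psi 0 - psi 0 - l * 0) = 0); last by ring.
  apply: integral0_eq => x _; rewrite /kern sub0r subr0; case: ltP => x0.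
    by rewrite pos0// oppr_le0 ltW.
  by rewrite pos0.
(* For y > 0 the hats rise from 0 to b k and descend to y; after scaling they converge to (y - x)^+
   for x > 0 and vanish for x <= 0. The shift by 2 keeps b k < y. *)
- pose b (k : nat) : R := y / k.+2%:R.
  have b0 k : 0 < b k by rewrite divr_gt0.
  have by_ k : b k < y by rewrite ltr_pdivrMr// ltr_pMr// ltr1n.
  have bcvg : b k @[k --> \oo] --> (0 : R).
    have -> : 0 = y * 0 by rewrite mulr0.
    apply: cvgM; first exact: cvg_cst.
    have := @cvg_harmonic R; rewrite -cvg_shiftS; exact.
  have /cvg_at_rightP/(_ b (conj b0 bcvg)) slope := hl.
  have psib : psi (b k) @[k --> \oo] --> psi 0 by apply: continuous_cvg => //; exact: cpsi'.
  have L1 : (\int[m]_x ((y - b k) * tent 0 (b k) y x)%:E)%E @[k --> \oo] --> (psi y - psi 0 - l * y)%:E.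
    have -> : (fun k => (\int[m]_x ((y - b k) * tent 0 (b k) y x)%:E)%E) =
        (fun k => (psi y - psi (b k) - (psi (b k) - psi 0) / b k * (y - b k))%:E).
      apply/funext => k; rewrite tint//; congr EFin; rewrite subr0; field.
      by rewrite subr_eq0 gt_eqF//= gt_eqF.
    apply: cvg_EFin; first exact: nearW.
    apply: cvgB; first by apply: cvgB => //; exact: cvg_cst.
    have -> : l * y = l * (y - 0) by rewrite subr0.
    by apply: cvgM => //; apply: cvgB => //; exact: cvg_cst.
  have L2 := bounded_support_cvg (f := fun k x => (y - b k) * tent 0 (b k) y x) (a := 0) (b := y) (C := y) mpsi.1 (fun k => mtent _ _ _ _) mk.
  apply: cvg_unique L1; first exact: ereal_hausdorff.
  apply: L2 => [k x|k x xs|x].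
  - have /andP[h1 h2] := tent_bound x (b0 k) (by_ k); have := b0 k; have := by_ k => ? ?.
    by rewrite ger0_norm; [nra|apply: mulr_ge0 => //; lra].
  - by rewrite tent_supp ?mulr0.
  have [x0|x0] := leP x 0.
    apply: nearW => k; rewrite /kern ltNge x0/= pos0; last by lra.
    have [xn|xp|->] := ltgtP x 0; first by rewrite tent_supp ?mulr0//; apply/negP => /andP[]; lra.
      by move: x0; rewrite leNgt xp.
    by rewrite tent_up ?lexx ?ltW// subrr !mulr0.
  rewrite /kern x0; have [xy|xy] := leP x y; last first.
    by apply: nearW => k; rewrite tent_supp ?mulr0 ?pos0//; [lra|apply/negP => /andP[]; lra].
  near=> k; have bx : b k <= x by near: k; exact: (cvgr_le _ bcvg).
  rewrite tent_down ?bx// posE ?subr_ge0// mulrA divff ?mul1r// subr_eq0 gt_eqF//.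
(* For y < 0 the peak sits at 0 itself, so that an atom there keeps its full weight, and the descent
   on [0, b k] disappears in the limit. *)
- pose b (k : nat) : R := k.+1%:R^-1.
  have b0 k : 0 < b k by rewrite invr_gt0.
  have b1 k : b k <= 1 by rewrite invf_le1// ler1n.
  have bcvg : b k @[k --> \oo] --> (0 : R) by exact: cvg_harmonic.
  have /cvg_at_rightP/(_ b (conj b0 bcvg)) slope := hl.
  have psib : psi (b k) @[k --> \oo] --> psi 0 by apply: continuous_cvg => //; exact: cpsi'.
  have L1 : (\int[m]_x (- y * tent y 0 (b k) x)%:E)%E @[k --> \oo] --> (psi y - psi 0 - l * y)%:E.
    have -> : (fun k => (\int[m]_x (- y * tent y 0 (b k) x)%:E)%E) =
        (fun k => (psi y - psi 0 - (psi (b k) - psi 0) / b k * y)%:E).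
      apply/funext => k; rewrite tint//; congr EFin; rewrite subr0 sub0r; field.
      by rewrite gt_eqF//= lt_eqF.
    apply: cvg_EFin; first exact: nearW.
    apply: cvgB; first exact: cvg_cst.
    by apply: cvgM => //; exact: cvg_cst.
  have L2 := bounded_support_cvg (f := fun k x => - y * tent y 0 (b k) x) (a := y) (b := 1) (C := - y) mpsi.1 (fun k => mtent _ _ _ _) mk.
  apply: cvg_unique L1; first exact: ereal_hausdorff.
  apply: L2 => [k x|k x xs|x].
  - have /andP[h1 h2] := tent_bound x y0 (b0 k).
    by rewrite ger0_norm; [nra|apply: mulr_ge0 => //; lra].
  - rewrite tent_supp ?mulr0//; apply: contra xs => /andP[-> /le_trans]; exact.
  have [x0|x0] := leP x 0.
    apply: nearW => k; rewrite /kern ltNge x0/=.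
    have [xy|/ltW xy] := leP y x.
      rewrite tent_up ?xy// posE ?subr_ge0// sub0r mulrA divff ?mul1r// oppr_eq0 lt_eqF//.
    move: xy; rewrite le_eqVlt => /predU1P[->|xy].
      by rewrite tent_up ?lexx ?ltW// subrr !mulr0 pos0.
    by rewrite tent_supp ?mulr0 ?pos0//; [lra|apply/negP => /andP[]; lra].
  rewrite /kern x0 pos0; last by lra.
  near=> k; have bx : b k < x by near: k; exact: (cvgr_lt _ bcvg).
  by rewrite tent_supp ?mulr0//; apply/negP => /andP[_]; rewrite leNgt bx.
Unshelve. all: end_near. Qed.

End kernel.

Section integral_add.
Context d (T : measurableType d) (R : realType) (mu : {measure set T -> \bar R}).

(** Additivity also when h has infinite integral: the negative part of a + h is dominated by |a|,
    and then the positive part must have infinite integral. This carries the inequalities through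
    infinite expectations. *)
Lemma integralD_ge0 (a h : T -> R) : mu.-integrable setT (EFin \o a) ->
  measurable_fun setT h -> (forall t, 0 <= h t) ->
  (\int[mu]_t (a t + h t)%:E = \int[mu]_t (a t)%:E + \int[mu]_t (h t)%:E)%E.
Proof.
move=> ia mh h0.
have ma : measurable_fun setT a by apply/measurable_EFinP; case/integrableP: ia.
have [hfin|] := boolP (\int[mu]_t (h t)%:E < +oo)%E.
  have ih : mu.-integrable setT (EFin \o h).
    apply/integrableP; split; first exact/measurable_EFinP.
    by under eq_integral => t _ do rewrite /= ger0_norm//.
  by have := integralD measurableT ia ih.
rewrite -leNgt leye_eq => /eqP hoo; rewrite hoo addey; last first.
  by have := integrable_fin_num measurableT ia; rewrite fin_numE => /andP[].
have iabs : (\int[mu]_t `|a t|%:E < +oo)%E by case/integrableP: ia.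
have mah : measurable_fun setT (fun t => (a t + h t)%:E) by apply/measurable_EFinP; exact: measurable_funD.
have mabs : measurable_fun setT (fun t => `|a t|%:E) by apply/measurable_EFinP; exact: measurableT_comp.
rewrite integralE.
have neg : (\int[mu]_t ((fun t => (a t + h t)%:E)^\- t) <= \int[mu]_t `|a t|%:E)%E.
  apply: ge0_le_integral => //; first exact: measurable_funeneg.
  move=> t _; rewrite funenegE /= /maxe; case: ifP => _; rewrite lee_fin//.
  have := ler_norm (- a t); rewrite normrN; have := h0 t; lra.
have pos : (\int[mu]_t ((fun t => (a t + h t)%:E)^\+ t) = +oo)%E.
  apply/eqP; rewrite -leye_eq leNgt; apply/negP => posfin.
  have : (\int[mu]_t (h t)%:E <= \int[mu]_t ((fun t => (a t + h t)%:E)^\+ t + `|a t|%:E))%E.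
    apply: ge0_le_integral => //.
    - by move=> t _; rewrite lee_fin.
    - exact/measurable_EFinP.
    - by apply: emeasurable_funD => //; exact: measurable_funepos.
    move=> t _; rewrite funeposE /= /maxe; have := ler_norm (- a t); rewrite normrN => na.
    by case: ifPn; rewrite -EFinD !lee_fin ?lte_fin -?leNgt; have := h0 t; lra.
  rewrite hoo ge0_integralD//; last exact: measurable_funepos.
  by rewrite leye_eq => /eqP E; have := lte_add_pinfty posfin iabs; rewrite E ltxx.
rewrite pos addye// eqe_oppLR/= lt_eqF//; exact: le_lt_trans neg iabs.
Qed.

End integral_add.

(** Attaches a proof of sigma-finiteness to m, so that Fubini-Tonelli accepts psi'', which is only
    given as finite on compact sets. *)
Definition sigma_finite_of d (T : measurableType d) (R : realType) (m : {measure set T -> \bar R})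
  of sigma_finite setT m : set T -> \bar R := m.

Section sigma_finite_of.
Context d (T : measurableType d) (R : realType) (m : {measure set T -> \bar R}).
Variable H : sigma_finite setT m.
HB.instance Definition _ := Measure.copy (sigma_finite_of H) m.
HB.instance Definition _ := Measure_isSigmaFinite.Build _ _ _ (sigma_finite_of H) H.
End sigma_finite_of.

Section kernel_expectation.
Context {R : realType}.
Variables (psi : R -> R) (m : {measure set R -> \bar R}).
Hypotheses (cpsi : cvxR psi) (mpsi : second_derivative_measure psi m).

Let msf : sigma_finite setT m.
Proof.
exists (fun k => `[- k%:R, k%:R]%classic).
  apply/esym; rewrite -subTset => x _; exists (Num.bound `|x|) => //=; rewrite in_itv/= -ler_norml ltW//.
  exact: (archi_boundP (normr_ge0 x)).
by move=> k; split; [exact: measurable_itv|exact/mpsi.1/segment_compact].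
Qed.


Variables (d : measure_display) (T : measurableType d) (P : probability T R) (f : T -> R).
Hypotheses (mf : measurable_fun setT f).

Let mk2 : measurable_fun setT (fun tx : T * R => (kern (f tx.1) tx.2)%:E).
Proof.
apply/measurable_EFinP; apply: measurable_kern; last exact: measurable_snd.
exact: measurableT_comp.
Qed.

Lemma measurable_kernel_expectation : measurable_fun setT (fun x : R => \int[P]_t (kern (f t) x)%:E)%E.
Proof.
have := @measurable_fun_fubini_tonelli_G _ _ T R R P _ mk2; apply.
by move=> tx; rewrite lee_fin kern_ge0.
Qed.

(** The pointwise representation is integrated: its linear term has expectation 0 by centring, and
    the nonnegative kernel allows the exchange of integrals. *)
Lemma kernel_expectation : P.-integrable setT (EFin \o f) -> (\int[P]_t (f t)%:E = 0)%E ->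
  (\int[P]_t (psi (f t))%:E = (psi 0)%:E + \int[m]_x \int[P]_t (kern (f t) x)%:E)%E.
Proof.
move=> fi f0; have [l Hl] := kernel_representation cpsi mpsi.
pose h t := psi (f t) - psi 0 - l * f t.
have hE t : (h t)%:E = (\int[m]_x (kern (f t) x)%:E)%E by rewrite Hl.
have ia : P.-integrable setT (EFin \o (fun t => psi 0 + l * f t)).
  have := integrableD measurableT (finite_measure_integrable_cst P (psi 0) measurableT) (integrableZl measurableT l fi).
  by apply: eq_integrable.
transitivity (\int[P]_t (psi 0 + l * f t + h t)%:E)%E.
  by apply: eq_integral => t _; congr EFin; rewrite /h; ring.
rewrite integralD_ge0//; first last.
- by move=> t; rewrite -lee_fin hE integral_ge0// => x _; rewrite lee_fin kern_ge0.
- apply: measurable_funB; first apply: measurable_funB => //.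
    by apply: measurableT_comp mf; apply: continuous_measurable_fun; exact: cvxR_continuous.
  exact: measurable_funM.
congr (_ + _)%E.
  transitivity (\int[P]_t ((psi 0)%:E + l%:E * (f t)%:E))%E; first by apply: eq_integral.
  rewrite integralD//; last exact: integrableZl.
    rewrite integralZl// f0 mule0 adde0 integral_cst//= (@probability_setT _ T R P) mule1//.
  exact: (finite_measure_integrable_cst P (psi 0) measurableT).
transitivity (\int[P]_t \int[(sigma_finite_of msf)]_x (kern (f t) x)%:E)%E; first by apply: eq_integral => t _; rewrite hE.
have := @fubini_tonelli _ _ T R R P (sigma_finite_of msf) _ mk2; apply.
by move=> tx; rewrite lee_fin kern_ge0.
Qed.

End kernel_expectation.

(** * Random variables with density phi exp (- U) *)

Section density.
Context d d' (T : measurableType d) (T' : measurableType d') (R : realType).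
Variables (mu : {measure set T -> \bar R}) (nu : {measure set T' -> \bar R}).
Variables (f : T -> T') (W : T' -> R).
Hypotheses (mf : measurable_fun setT f) (mW : measurable_fun setT W) (W0 : forall x, 0 <= W x).
Hypothesis law : forall B, measurable B -> (mu (f @^-1` B) = \int[nu]_(x in B) (W x)%:E)%E.
Import HBNNSimple.

Let density_sfun (g : {nnsfun T' >-> R}) :
  (\int[mu]_t (g (f t))%:E = \int[nu]_x (g x * W x)%:E)%E.
Proof.
have gE x : g x = \sum_(k \in range g) k * \1_(g @^-1` [set k]) x by rewrite fimfunE.
have mg k : measurable (g @^-1` [set k]) by [].
have nn k x : 0 <= k * \1_(g @^-1` [set k]) x by rewrite -lee_fin EFinM nnfun_muleindic_ge0.
transitivity (\sum_(k \in range g) (\int[mu]_t (k * \1_(g @^-1` [set k]) (f t))%:E))%E.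
  rewrite -ge0_integral_fsum//; last 2 first.
  - move=> k; apply/measurable_EFinP; apply: measurable_funM => //.
    by apply: measurableT_comp mf; exact: measurable_indic.
  - by move=> k t _; rewrite lee_fin.
  by apply: eq_integral => t _; rewrite fsumEFin// -gE.
transitivity (\sum_(k \in range g) (\int[nu]_x (k * \1_(g @^-1` [set k]) x * W x)%:E))%E; last first.
  rewrite -ge0_integral_fsum//; last 2 first.
  - move=> k; apply/measurable_EFinP; apply: measurable_funM => //.
    by apply: measurable_funM => //; exact: measurable_indic.
  - by move=> k t _; rewrite lee_fin mulr_ge0.
  apply: eq_integral => t _; rewrite fsumEFin//; congr EFin.
  rewrite [in RHS]gE mulr_fsuml//.
apply: eq_fsbigr => k; rewrite inE => -[x _ <-].
under eq_integral => t _ do rewrite EFinM.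
rewrite ge0_integralZl//; last 2 first.
- by apply/measurable_EFinP; apply: measurableT_comp mf; exact: measurable_indic.
- by rewrite lee_fin fun_ge0.
transitivity ((g x)%:E * mu (f @^-1` (g @^-1` [set g x])))%E.
  have mB : measurable (f @^-1` (g @^-1` [set g x])).
    by rewrite -[X in measurable X]setTI; exact: mf.
  by congr (_ * _)%E; have := @integral_indic _ _ _ mu setT measurableT _ mB; rewrite setIT.
rewrite law//; under [RHS]eq_integral => t _ do rewrite -mulrA EFinM.
rewrite ge0_integralZl//; last 3 first.
- apply/measurable_EFinP; apply: measurable_funM => //; exact: measurable_indic.
- by move=> t _; rewrite lee_fin mulr_ge0.
- by rewrite lee_fin fun_ge0.
congr (_ * _)%E; rewrite [LHS]integral_mkcond; apply: eq_integral => t _.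
by rewrite patchE indicE; case: (_ \in _); rewrite ?mul1r ?mul0r.
Qed.

Lemma density_integral (F : T' -> R) : measurable_fun setT F -> (forall x, 0 <= F x) ->
  (\int[mu]_t (F (f t))%:E = \int[nu]_x (F x * W x)%:E)%E.
Proof.
move=> mF F0; have mF' : measurable_fun setT (EFin \o F) by apply/measurable_EFinP.
pose g := nnsfun_approx measurableT mF'.
have gF x : (g n x)%:E @[n --> \oo] --> (F x)%:E.
  by apply: (cvg_nnsfun_approx measurableT mF') => // y _; rewrite lee_fin.
have gnd x : {homo (fun n => g n x) : a b / (a <= b)%N >-> a <= b}.
  by move=> a b ab; exact/lefP/nd_nnsfun_approx.
have mgW n : measurable_fun setT (fun x => (g n x * W x)%:E).
  by apply/measurable_EFinP; apply: measurable_funM.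
have L1 : (\int[mu]_t (g n (f t))%:E)%E @[n --> \oo] --> (\int[mu]_t (F (f t))%:E)%E.
  have -> : (\int[mu]_t (F (f t))%:E = \int[mu]_t (limn (fun n => (g n (f t))%:E)))%E.
    by apply: eq_integral => t _; apply/esym/cvg_lim.
  apply: cvg_monotone_convergence => //.
  - by move=> n; apply/measurable_EFinP; exact: measurableT_comp.
  - by move=> n t _; rewrite lee_fin.
  - by move=> t _ a b ab; rewrite lee_fin gnd.
have L2 : (\int[nu]_x (g n x * W x)%:E)%E @[n --> \oo] --> (\int[nu]_x (F x * W x)%:E)%E.
  have -> : (\int[nu]_x (F x * W x)%:E = \int[nu]_x (limn (fun n => (g n x * W x)%:E)))%E.
    apply: eq_integral => t _; apply/esym/cvg_lim => //.
    rewrite EFinM; under eq_fun do rewrite EFinM.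
    by apply: cvgeMr.
  apply: cvg_monotone_convergence => //.
  - by move=> n t _; rewrite lee_fin mulr_ge0.
  - by move=> t _ a b ab; rewrite lee_fin ler_wpM2r// gnd.
apply: cvg_unique L1 _; first exact: ereal_hausdorff.
by have -> : (fun n => \int[mu]_t (g n (f t))%:E)%E = (fun n => \int[nu]_x (g n x * W x)%:E)%E by apply/funext => n; exact: density_sfun.
Qed.
End density.

Section gauss_moments.
Context {R : realType}.
Implicit Types (x y z k C : R) (U : R -> R).
Notation mu := lebesgue_measure.

Lemma cvxR_linear_lower U : cvxR U -> exists2 k, 0 <= k & forall x, U 0 - k * `|x| <= U x.
Proof.
move=> cU; exists (`|U 0 - U (-1)| + `|U 1 - U 0|); first by rewrite addr_ge0.
have key (V : R -> R) x : cvxR V -> 0 <= x -> V 0 - `|V 0 - V (-1)| * x <= V x.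
  move=> cV x0; have x1 : 0 < 1 + x by lra.
  have := cV (1 + x)^-1 x (-1); rewrite invr_ge0 (ltW x1) invf_le1 ?posrE// lerDl x0 => /(_ isT isT).
  have -> : (1 + x)^-1 * x + (1 - (1 + x)^-1) * -1 = 0 by field; rewrite gt_eqF.
  move=> /(ler_wpM2l (ltW x1)).
  have -> : (1 + x) * ((1 + x)^-1 * V x + (1 - (1 + x)^-1) * V (-1)) = V x + x * V (-1) by field; rewrite gt_eqF.
  have := ler_norm (- (V 0 - V (-1))); rewrite normrN => h1 h2.
  have : - (V 0 - V (-1)) * x <= `|V 0 - V (-1)| * x by rewrite ler_wpM2r.
  by lra.
move=> x; have n0 := normr_ge0 (U 0 - U (-1)); have n1 := normr_ge0 (U 1 - U 0).
have [x0|/ltW x0] := leP 0 x.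
  by rewrite (ger0_norm x0); apply: le_trans (key U x cU x0); rewrite lerD2l lerN2 ler_wpM2r// lerDl.
have := key (fun z => U (- z)) (- x) (cvxR_comp_opp cU); rewrite oppr_ge0 oppr0 !opprK => /(_ x0).
apply: le_trans; rewrite (ler0_norm x0) lerD2l lerN2 (distrC (U 0) (U 1)) ler_wpM2r ?oppr_ge0//.
by rewrite lerDr.
Qed.

Lemma phi_continuous : continuous (@phi R).
Proof. by move=> x; exact: (@is_derive_continuous _ phi (fun x => - (x * phi x)) x (is_derive_phi x)). Qed.

Lemma phi_normal_pdf x : phi x = normal_pdf 0 1 x.
Proof.
rewrite /normal_pdf oner_eq0 /normal_peak /normal_fun /phi.
by rewrite expr1n mul1r subr0 mulNr mulr_natl.
Qed.

Lemma phi_shift k x : expR (k * x) * phi x = expR (k ^+ 2 / 2) * normal_pdf k 1 x.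
Proof.
rewrite /normal_pdf oner_eq0 /normal_peak /normal_fun /phi.
rewrite expr1n mul1r mulr_natl mulrCA [RHS]mulrCA -!expRD; congr (_ * expR _).
by rewrite mulNr; field.
Qed.

Lemma gauss_exp_integrable k : mu.-integrable [set: R] (EFin \o (fun x => expR (k * `|x|) * phi x)).
Proof.
have i1 c : mu.-integrable [set: R] (EFin \o (fun x => expR (c * x) * phi x)).
  have := integrableZl measurableT (expR (c ^+ 2 / 2)) (integrable_normal_pdf c 1).
  by apply: eq_integrable => // x _; rewrite /= phi_shift.
have := integrableD measurableT (i1 k) (i1 (- k)).
apply: le_integrable => //.
  apply/measurable_EFinP; apply: continuous_measurable_fun => x; apply: cvgM; last exact: phi_continuous.
  apply: continuous_comp; last exact: continuous_expR.
  by apply: cvgM; [exact: cvg_cst|exact: norm_continuous].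
move=> x _ /=; have e0 c : 0 <= expR c * phi x by rewrite mulr_ge0 ?expR_ge0 ?(ltW (phi_gt0 _)).
rewrite lee_fin (ger0_norm (e0 _)) (ger0_norm (addr_ge0 (e0 _) (e0 _))) -mulrDl ler_wpM2r ?(ltW (phi_gt0 _))//.
have [x0|x0] := leP 0 x; first by rewrite ger0_norm// lerDl expR_ge0.
by rewrite ltr0_norm// mulrN -mulNr lerDr expR_ge0.
Qed.

End gauss_moments.

Section logconcave.
Context {R : realType}.
Variable U : R -> R.
Hypothesis cU : cvxR U.
Implicit Types (x y z k C : R).
Notation mu := lebesgue_measure.

Definition tilt (U : R -> R) x : R := phi x * expR (- U x).

Lemma tilt_gt0 x : 0 < tilt U x.
Proof. by rewrite mulr_gt0 ?phi_gt0 ?expR_gt0. Qed.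

Lemma tilt_continuous : continuous (tilt U).
Proof.
move=> x; apply: cvgM; first exact: phi_continuous.
apply: continuous_comp; last exact: continuous_expR.
by apply: cvgN; exact: cvxR_continuous.
Qed.

Lemma measurable_tilt : measurable_fun setT (tilt U).
Proof. exact: (continuous_measurable_fun tilt_continuous). Qed.

(** A convex U lies above U 0 - k |x|, and |x|^n <= n! exp |x|; exponential moments of the normal
    law dominate. *)
Lemma tilt_moment (n : nat) : (\int[mu]_x (`|x| ^+ n * tilt U x)%:E < +oo)%E.
Proof.
have [k k0 Uk] := cvxR_linear_lower cU.
have i := integrableZl measurableT (n`!%:R * expR (- U 0)) (gauss_exp_integrable (1 + k)).
apply: le_lt_trans (integral_fune_lt_pinfty measurableT i).
apply: ge0_le_integral => //.
- by move=> x _; rewrite lee_fin mulr_ge0 ?exprn_ge0 ?(ltW (tilt_gt0 _)).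
- apply/measurable_EFinP; apply: measurable_funM; last exact: measurable_tilt.
  by apply: measurable_funX; apply: continuous_measurable_fun; exact: norm_continuous.
- by case/integrableP: i.
move=> x _; rewrite -EFinM lee_fin /tilt.
have -> : n`!%:R * expR (- U 0) * (expR ((1 + k) * `|x|) * phi x) =
    (n`!%:R * expR `|x|) * (phi x * (expR (- U 0) * expR (k * `|x|))).
  by rewrite mulrDl mul1r expRD; ring.
apply: ler_pM; rewrite ?exprn_ge0//.
- by rewrite mulr_ge0 ?expR_ge0 ?(ltW (phi_gt0 _)).
- exact: expr_le_expR.
by rewrite ler_wpM2l ?(ltW (phi_gt0 _))// -expRD ler_expR; have := Uk x; lra.
Qed.

End logconcave.

Section squeeze.
Context {R : realType}.
Implicit Types (F g : R -> R) (x y z : R).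

(** Replaces differentiation under the integral: for the stop-loss functions, with g = T or g = 2 S,
    both bounds already hold pointwise inside the expectation. *)
Lemma is_derive_squeeze F g : continuous g ->
  (forall y z, y < z -> (z - y) * g z <= F y - F z <= (z - y) * g y) ->
  forall x, is_derive x 1 F (- g x).
Proof.
move=> cg H x; apply: is_derive_eps => e e0.
have /cvgrPdist_le cz : g y @[y --> x] --> g x by exact: cg.
have /nbhs_ballP[r /= r0 Hr] := cz _ e0; exists r => // h h0 hr.
have [hp|hn|hz] := ltgtP 0 h; last by rewrite -hz eqxx in h0.
- have /andP[l u] := H x (x + h) ltac:(lra).
  have : `|g x - g (x + h)| <= e by apply: Hr; rewrite /ball/= opprD addrA subrr sub0r normrN.
  rewrite !ler_norml => /andP[l' u']; apply/andP; split.
    by rewrite opprK -lerBlDr ler_pdivlMr//; nra.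
  by rewrite opprK -lerBrDr ler_pdivrMr//; nra.
have /andP[l u] := H (x + h) x ltac:(lra).
have : `|g x - g (x + h)| <= e by apply: Hr; rewrite /ball/= opprD addrA subrr sub0r normrN.
rewrite !ler_norml => /andP[l' u']; apply/andP; split.
  by rewrite opprK -lerBlDr ler_ndivlMr//; nra.
by rewrite opprK -lerBrDr ler_ndivrMr//; nra.
Qed.

End squeeze.

Section law.
Context {R : realType} d (T : measurableType d) (P : probability T R) (f : T -> R) (U : R -> R).
Notation mu := lebesgue_measure.
Hypotheses (mf : measurable_fun setT f) (cU : cvxR U).
Hypothesis law : forall B : set R, measurable B -> (P (f @^-1` B) = \int[mu]_(x in B) (tilt U x)%:E)%E.
Implicit Types (g h : T -> R) (x y z C : R).

Lemma law_expectation (F : R -> R) : measurable_fun setT F -> (forall x, 0 <= F x) ->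
  (\int[P]_t (F (f t))%:E = \int[mu]_x (F x * tilt U x)%:E)%E.
Proof.
move=> mF F0; apply: (@density_integral _ _ _ (measurableTypeR R) R P mu f (tilt U)) => //.
- exact: measurable_tilt.
- by move=> x; exact: ltW (tilt_gt0 _ _).
Qed.

Lemma law_moment n : P.-integrable setT (EFin \o (fun t => f t ^+ n)).
Proof.
apply/integrableP; split; first by apply/measurable_EFinP; exact: measurable_funX.
have mn : measurable_fun setT (fun x : R => `|x| ^+ n).
  by apply: measurable_funX; apply: continuous_measurable_fun; exact: norm_continuous.
have <- : (\int[mu]_x (`|x| ^+ n * tilt U x)%:E = \int[P]_t `|(f t ^+ n)%:E|)%E.
  rewrite -(law_expectation mn) => [|x]; last by rewrite exprn_ge0.
  by apply: eq_integral => t _; rewrite /= normrX.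
exact: tilt_moment.
Qed.

Local Notation EE g := (\int[P]_t g t)%R.

Lemma moment_dominated g C : measurable_fun setT g ->
  (forall t, `|g t| <= C * (1 + f t ^+ 2 + f t ^+ 4)) -> P.-integrable setT (EFin \o g).
Proof.
move=> mg gC.
have i : P.-integrable setT (EFin \o (fun t => C * (1 + f t ^+ 2 + f t ^+ 4))).
  have := integrableZl measurableT C (integrableD measurableT (integrableD measurableT (law_moment 0) (law_moment 2)) (law_moment 4)).
  by apply: eq_integrable.
apply: le_integrable i => //; first exact/measurable_EFinP.
by move=> t _ /=; rewrite lee_fin (le_trans (gC t))// ler_norm.
Qed.

Lemma expectation_le g h : P.-integrable setT (EFin \o g) -> P.-integrable setT (EFin \o h) ->
  (forall t, g t <= h t) -> EE g <= EE h.
Proof. by move=> ig ih gh; apply: le_Rintegral. Qed.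

Definition law_T x : R := fine (P (f @^-1` `]x, +oo[)).
Definition law_S x : R := (\int[P]_t pos (f t - x))%R.
Definition law_K x : R := (\int[P]_t (pos (f t - x) ^+ 2))%R.

Definition above x t : R := \1_(`]x, +oo[%classic) (f t).

Lemma aboveE x t : above x t = (x < f t)%R%:R.
Proof. by rewrite /above indicE mem_setE in_itv/= andbT. Qed.

Lemma measurable_above x : measurable_fun setT (above x).
Proof. by apply: measurableT_comp mf; apply: measurable_indic; exact: measurable_itv. Qed.

Lemma integrable_above x : P.-integrable setT (EFin \o above x).
Proof.
apply: (@moment_dominated _ 1); first exact: measurable_above.
move=> t; rewrite aboveE mul1r; have := sqr_ge0 (f t); have := sqr_ge0 (f t ^+ 2).
have h7 : 0 <= f t ^+ 4 by rewrite exprn_even_ge0.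
by move=> _ ?; case: (_ < _); rewrite ?normr1 ?normr0; lra.
Qed.

Lemma law_TE x : law_T x = EE (above x).
Proof.
rewrite /law_T /Rintegral; congr fine.
have mB : measurable (f @^-1` `]x, +oo[).
  by rewrite -[X in measurable X]setTI; apply: mf => //; exact: measurable_itv.
by have := @integral_indic _ _ _ P setT measurableT _ mB; rewrite setIT => <-.
Qed.

Lemma pos_ge0 z : 0 <= pos z.
Proof. by rewrite /pos le_max lexx orbT. Qed.

Lemma pos_lt0 x : x < 0 -> pos x = 0. Proof. by move/ltW; exact: pos0. Qed.

Lemma pos_cases z : (0 <= z /\ pos z = z) \/ (z < 0 /\ pos z = 0).
Proof.
have [z0|z0] := leP 0 z; [by left; split => //; exact: posE|by right; split => //; exact: pos_lt0].
Qed.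

Lemma integrable_pos x : P.-integrable setT (EFin \o (fun t => pos (f t - x))).
Proof.
apply: (@moment_dominated _ (1 + `|x|)).
  by apply: measurable_pos; exact: measurable_funB.
move=> t; rewrite ger0_norm ?pos_ge0//.
have h1 := sqr_ge0 (f t - 1); have h2 := sqr_ge0 (f t ^+ 2); have h3 := normr_ge0 x.
have h4 := ler_norm (- x); rewrite normrN in h4.
have h5 := sqr_ge0 (f t).
have h7 : 0 <= f t ^+ 4 by rewrite exprn_even_ge0.
have h6 : 0 <= `|x| * (f t ^+ 2 + f t ^+ 4) by rewrite mulr_ge0// addr_ge0.
by have [[_ ->]|[_ ->]] := pos_cases (f t - x); nra.
Qed.

Lemma integrable_pos2 x : P.-integrable setT (EFin \o (fun t => pos (f t - x) ^+ 2)).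
Proof.
apply: (@moment_dominated _ (2 * (1 + x ^+ 2))).
  by apply: measurable_funX; apply: measurable_pos; exact: measurable_funB.
move=> t; rewrite ger0_norm ?exprn_ge0 ?pos_ge0//.
have h1 := sqr_ge0 (f t + x); have h5 := sqr_ge0 (f t); have h3 := sqr_ge0 x.
have h7 : 0 <= f t ^+ 4 by rewrite exprn_even_ge0.
have h6 : 0 <= x ^+ 2 * (f t ^+ 2 + f t ^+ 4) by rewrite mulr_ge0// addr_ge0.
by have [[_ ->]|[_ ->]] := pos_cases (f t - x); rewrite ?expr0n/=; nra.
Qed.

Lemma law_T_diff x : is_derive x 1 law_T (- tilt U x).
Proof.
have iT : mu.-integrable [set: R] (EFin \o tilt U).
  apply/integrableP; split; first by apply/measurable_EFinP; exact: measurable_tilt.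
  have := tilt_moment cU 0; congr (_ < _)%E; apply: eq_integral => y _.
  by rewrite /= expr0 mul1r ger0_norm// ltW// tilt_gt0.
have it z : mu.-integrable `]-oo, z] (EFin \o tilt U).
  by apply: integrableS iT => //; exact: measurable_itv.
have E z : law_T z = 1 - (\int[mu]_(t in `]-oo, z]) tilt U t)%R.
  rewrite /law_T /Rintegral -law; last exact: measurable_itv.
  rewrite (_ : f @^-1` `]z, +oo[ = ~` (f @^-1` `]-oo, z])); last first.
    by apply/seteqP; split=> t /=; rewrite !in_itv/= andbT => h; [apply/negP; rewrite -ltNge|rewrite ltNge; apply/negP].
  rewrite probability_setC; last first.
    by rewrite -[X in measurable X]setTI; apply: mf => //; exact: measurable_itv.
  by rewrite fineB// fin_num_measure// -[X in measurable X]setTI; apply: mf => //; exact: measurable_itv.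
have xx : x < x + 1 by rewrite ltrDl.
have [||dF F'] := @continuous_FTC1 R (tilt U) -oo%O x (x + 1) xx (it _); [exact: ltNyr|exact: tilt_continuous|].
have D : is_derive x 1 (fun z => \int[mu]_(t in `]-oo, z]) tilt U t)%R (tilt U x).
  by split; [exact: dF|rewrite -derive1E; exact: F'].
apply: is_derive_ext (is_deriveB' (is_derive_cst' 1 x) D) _ _; first by move=> z; rewrite E.
by rewrite sub0r.
Qed.

Lemma expectationZ C g : P.-integrable setT (EFin \o g) -> EE (fun t => C * g t) = C * EE g.
Proof. by move=> ig; rewrite RintegralZl. Qed.

Lemma expectationB g h : P.-integrable setT (EFin \o g) -> P.-integrable setT (EFin \o h) ->
  EE (fun t => g t - h t) = EE g - EE h.
Proof. by move=> ig ih; rewrite RintegralB. Qed.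

Lemma integrableZ' C g : P.-integrable setT (EFin \o g) -> P.-integrable setT (EFin \o (fun t => C * g t)).
Proof. by move=> ig; have := integrableZl measurableT C ig; apply: eq_integrable. Qed.

Lemma integrableB' g h : P.-integrable setT (EFin \o g) -> P.-integrable setT (EFin \o h) ->
  P.-integrable setT (EFin \o (fun t => g t - h t)).
Proof. by move=> ig ih; have := integrableB measurableT ig ih; apply: eq_integrable. Qed.

Lemma law_S_diff x : is_derive x 1 law_S (- law_T x).
Proof.
apply: is_derive_squeeze => [z|y z yz]; first exact: (@is_derive_continuous _ law_T (fun z => - tilt U z) z (law_T_diff z)).
rewrite !law_TE -!expectationZ -?expectationB; try exact: integrable_above; try exact: integrable_pos.
apply/andP; split; apply: expectation_le => [||t]; try (by apply: integrableZ'; exact: integrable_above); try (by apply: integrableB'; exact: integrable_pos).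
  rewrite aboveE; have [zf|fz] := ltP z (f t); first by rewrite /= mulr1 !posE; lra.
  by rewrite mulr0 (@pos0 _ (f t - z)) ?subr_le0// subr0 pos_ge0.
rewrite aboveE; have [zf|fz] := ltP y (f t); last by rewrite /= mulr0 !pos0; lra.
rewrite /= mulr1 (@posE _ (f t - y)); last lra.
by case: (pos_cases (f t - z)) => -[? ->]; lra.
Qed.

Lemma law_K_diff x : is_derive x 1 law_K (- (2 * law_S x)).
Proof.
apply: (@is_derive_squeeze _ law_K (fun x => 2 * law_S x)) => [z|y z yz].
  by apply: cvgM; [exact: cvg_cst|exact: (@is_derive_continuous _ law_S (fun z => - law_T z) z (law_S_diff z))].
rewrite !mulrA -!expectationZ -?expectationB; try exact: integrable_pos; try exact: integrable_pos2.
apply/andP; split; apply: expectation_le => [||t]; try (by apply: integrableZ'; exact: integrable_pos); try (by apply: integrableB'; exact: integrable_pos2).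
  case: (pos_cases (f t - y)) => -[? ->]; case: (pos_cases (f t - z)) => -[? ->]; rewrite ?expr0n/=; nra.
case: (pos_cases (f t - y)) => -[? ->]; case: (pos_cases (f t - z)) => -[? ->]; rewrite ?expr0n/=; nra.
Qed.

Hypothesis f0 : EE f = 0.

Let M := EE (fun t => 1 + f t ^+ 2 + f t ^+ 4).

Let iM : P.-integrable setT (EFin \o (fun t => 1 + f t ^+ 2 + f t ^+ 4)).
Proof.
have := integrableD measurableT (integrableD measurableT (law_moment 0) (law_moment 2)) (law_moment 4).
by apply: eq_integrable.
Qed.

(** Markov's inequality with a spare factor x. The fourth moment enters because x ((f - x)^+)^2 is
    of order |f|^3. *)
Lemma markov_decay (h : R -> T -> R) : (forall x, P.-integrable setT (EFin \o h x)) ->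
  (forall x t, 0 < x -> 0 <= h x t) -> (forall x t, 0 < x -> x * h x t <= 1 + f t ^+ 2 + f t ^+ 4) ->
  EE (h x) @[x --> +oo] --> (0 : R).
Proof.
move=> ih h0 hM; apply: (@cvgy0_bound _ _ M) => x x0.
rewrite ger0_norm; last by apply: Rintegral_ge0 => t _; exact: h0.
rewrite ler_pdivlMr// mulrC -expectationZ//; apply: expectation_le => // [|t]; [exact: integrableZ'|exact: hM].
Qed.

Let if1 : P.-integrable setT (EFin \o f).
Proof. by have := law_moment 1; apply: eq_integrable => // t _ /=; rewrite expr1. Qed.

Let i1 : P.-integrable setT (EFin \o (fun=> 1 : R)).
Proof. by have := law_moment 0; apply: eq_integrable => // t _ /=; rewrite expr0. Qed.

Let E1 C : EE (fun=> C) = C.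
Proof. by rewrite Rintegral_cst//= (@probability_setT _ T R P) mulr1. Qed.

Let f4 t : 0 <= f t ^+ 4. Proof. by rewrite exprn_even_ge0. Qed.
Let f2 t : 0 <= f t ^+ 2. Proof. exact: sqr_ge0. Qed.
Let f3 t : `|f t| ^+ 3 <= f t ^+ 2 + f t ^+ 4.
Proof.
rewrite -(real_normK (num_real (f t))) -[f t ^+ 4]ger0_norm// normrX.
have := sqr_ge0 (`|f t| - 1); have := sqr_ge0 `|f t|; set n := `|f t| => h1 h2.
have : 0 <= n ^+ 2 * (n - 1) ^+ 2 by rewrite mulr_ge0.
have -> : n ^+ 2 * (n - 1) ^+ 2 = n ^+ 4 - 2 * n ^+ 3 + n ^+ 2 by ring.
by rewrite !exprS expr0 in h1 *; nra.
Qed.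

Let s := fun t => - f t.

Let pos_decay1 x z : 0 < x -> x * pos (z - x) <= z ^+ 2.
Proof. by move=> x0; case: (pos_cases (z - x)) => -[? ->]; nra. Qed.

Let pos_decay2 x z : 0 < x -> x * pos (z - x) ^+ 2 <= `|z| ^+ 3.
Proof.
move=> x0; case: (pos_cases (z - x)) => -[zx ->]; last by rewrite expr0n/= mulr0 exprn_ge0.
rewrite ger0_norm; last lra.
have h : (z - x) ^+ 2 <= z ^+ 2 by nra.
apply: (@le_trans _ _ (x * z ^+ 2)); first by rewrite ler_pM2l.
by rewrite exprS ler_wpM2r ?sqr_ge0//; lra.
Qed.

(** The conditions at minus infinity are decay statements for (- f - x)^+, since (f + x)^+ - (f + x)
    = (- f - x)^+ and f is centred. *)
Lemma law_tails : tails U law_T law_S law_K (1 - EE (fun t => f t ^+ 2)).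
Proof.
have posN x t : pos (f t + x) - (f t + x) = pos (- f t - x).
  by rewrite /pos; case: (leP (f t + x) 0); case: (leP (- f t - x) 0); lra.
have pos2N x t : (f t + x) ^+ 2 - pos (f t + x) ^+ 2 = pos (- f t - x) ^+ 2.
  by rewrite /pos; case: (leP (f t + x) 0); case: (leP (- f t - x) 0) => ? ?; nra.
have inp x : P.-integrable setT (EFin \o (fun t => pos (- f t - x))).
  have := integrableB' (integrable_pos (- x)) (integrableB' if1 (integrableZ' (- x) i1)).
  by apply: eq_integrable => // t _ /=; rewrite opprK mulr1 opprK posN.
have ip2 x : P.-integrable setT (EFin \o (fun t => (f t + x) ^+ 2)).
  have := integrableB' (integrableB' (law_moment 2) (integrableZ' (- (2 * x)) if1)) (integrableZ' (- x ^+ 2) i1).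
  by apply: eq_integrable => // t _ /=; congr EFin; ring.
have inp2 x : P.-integrable setT (EFin \o (fun t => pos (- f t - x) ^+ 2)).
  have := integrableB' (ip2 x) (integrable_pos2 (- x)).
  by apply: eq_integrable => // t _ /=; rewrite opprK pos2N.
split.
- exact: cU.
- exact: law_T_diff.
- exact: law_S_diff.
- exact: law_K_diff.
- rewrite (_ : law_T = fun x => EE (above x)); last by apply/funext => x; exact: law_TE.
  apply: markov_decay => [x|x t x0|x t x0]; first exact: integrable_above.
    by rewrite aboveE.
  rewrite aboveE; have := f2 t; have := f4 t; case: ltP => /= ? ? ?; nra.
- apply: markov_decay => [x|x t x0|x t x0]; [exact: integrable_pos|exact: pos_ge0|].
  by apply: le_trans (pos_decay1 _ x0) _; have := f4 t; lra.
- apply: markov_decay => [x|x t x0|x t x0]; [exact: integrable_pos2|by rewrite exprn_ge0 ?pos_ge0|].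
  by apply: le_trans (pos_decay2 _ x0) _; have := f3 t; lra.
- have h : EE (fun t => 1 - above (- x) t) @[x --> +oo] --> (0 : R).
    apply: markov_decay => [x|x t x0|x t x0]; first by apply: integrableB' => //; exact: integrable_above.
      by rewrite aboveE subr_ge0; case: ltP.
    rewrite aboveE; have := f2 t; have := f4 t; case: ltP => /= ? ? ?; nra.
  have -> : (1 : R) = 1 - 0 by rewrite subr0.
  have -> : (fun x => law_T (- x)) = (fun x => 1 - EE (fun t => 1 - above (- x) t)).
    by apply/funext => x; rewrite expectationB ?E1 ?law_TE//; [ring|exact: integrable_above].
  by apply: cvgB => //; exact: cvg_cst.
- rewrite (_ : (fun x => law_S (- x) - x) = fun x => EE (fun t => pos (- f t - x))).
    apply: markov_decay => [x|x t x0|x t x0]; [exact: inp|exact: pos_ge0|].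
    by apply: le_trans (pos_decay1 _ x0) _; rewrite sqrrN; have := f4 t; lra.
  apply/funext => x.
  have -> : EE (fun t => pos (- f t - x)) = EE (fun t => pos (f t - - x) - (f t - - x * 1)).
    by apply: eq_Rintegral => t _; rewrite -posN mulr1 !opprK.
  rewrite expectationB; [|exact: integrable_pos|by apply: integrableB' => //; exact: (integrableZ' (- x) i1)].
  by rewrite expectationB// ?f0 ?E1; [rewrite /law_S; ring|exact: (integrableZ' (- x) i1)].
rewrite (_ : (fun x => _ - law_K (- x)) = fun x => EE (fun t => pos (- f t - x) ^+ 2)).
  apply: markov_decay => [x|x t x0|x t x0]; [exact: inp2|by rewrite exprn_ge0 ?pos_ge0|].
  by apply: le_trans (pos_decay2 _ x0) _; rewrite normrN; have := f3 t; lra.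
apply/funext => x.
have -> : EE (fun t => pos (- f t - x) ^+ 2) = EE (fun t => (f t + x) ^+ 2 - pos (f t - - x) ^+ 2).
  by apply: eq_Rintegral => t _; rewrite -pos2N opprK.
rewrite expectationB//; last exact: integrable_pos2.
have -> : EE (fun t => (f t + x) ^+ 2) = EE (fun t => f t ^+ 2 - (- (2 * x)) * f t - (- x ^+ 2) * 1).
  by apply: eq_Rintegral => t _; ring.
have j1 := law_moment 2; have j2 := integrableZ' (- (2 * x)) if1; have j3 := integrableZ' (- x ^+ 2) i1.
rewrite expectationB//; last exact: integrableB'.
by rewrite expectationB// !expectationZ// f0 E1 /law_K; ring.
Qed.

End law.

(** * The heat kernel integral, and the gap bounds in the original scale *)

Section heat.
Context {R : realType}.
Variable Q : R -> R.
Hypothesis dQ : forall x : R, is_derive x 1 Q (- phi x).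
Hypothesis Qy : Q x @[x --> +oo] --> (0 : R).
Implicit Types (s t x z : R).
Notation mu := lebesgue_measure.
Notation G := (Gf Q).

Lemma heat_kernelE s z : 0 < s -> heat_kernel s z = phi (z / Num.sqrt s) / Num.sqrt s.
Proof.
move=> s0; rewrite /heat_kernel /phi sqrtrM ?mulr_ge0 ?pi_ge0//.
have q0 : Num.sqrt s != 0 by rewrite gt_eqF// sqrtr_gt0.
rewrite invfM expr_div_n sqr_sqrtr ?(ltW s0)// mulrAC; congr (_ * expR _ * _).
by field; rewrite gt_eqF.
Qed.

(** By the convention 0^-1 = 0 the value at time 0 is the limit from the right for z > 0, so the
    fundamental theorem applies on [0, t]. *)
Lemma heat_kernel0 z : heat_kernel 0 z = 0.
Proof. by rewrite /heat_kernel mulr0 sqrtr0 invr0 mul0r. Qed.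

Lemma heat_kernel_ge0 s z : 0 <= heat_kernel s z.
Proof. by rewrite mulr_ge0 ?invr_ge0 ?sqrtr_ge0 ?expR_ge0. Qed.

Lemma heat_kernel_continuous z s : 0 < s -> {for s, continuous (fun s : R => heat_kernel s z)}.
Proof.
move=> s0; apply: cvgM.
  apply: cvgV; first by rewrite gt_eqF// sqrtr_gt0 !mulr_gt0 ?pi_gt0.
  apply: (@continuous_comp _ _ _ (fun s => 2 * pi * s) Num.sqrt); last exact: sqrt_continuous.
  by apply: cvgM; [exact: cvg_cst|exact: cvg_id].
apply: (@continuous_comp _ _ _ (fun s => - (z ^+ 2 / (2 * s))) expR); last exact: continuous_expR.
apply: cvgN; apply: cvgM; first exact: cvg_cst.
apply: cvgV; first by rewrite mulf_neq0// gt_eqF.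
by apply: cvgM; [exact: cvg_cst|exact: cvg_id].
Qed.

Let F z s := Num.sqrt s * G (z / Num.sqrt s).

Let dF z s : 0 < s -> is_derive s 1 (F z) (2^-1 * heat_kernel s z).
Proof.
move=> s0; have q0 : 0 < Num.sqrt s by rewrite sqrtr_gt0.
have dS : is_derive s 1 (Num.sqrt : R -> R) (2 * Num.sqrt s)^-1 by exact: is_derive1_sqrt.
have dV : is_derive s 1 (fun s => z / Num.sqrt s) (- z * (2 * Num.sqrt s)^-1 / Num.sqrt s ^+ 2).
  have dVV : is_derive s 1 (fun s => (Num.sqrt s)^-1) (- (Num.sqrt s) ^- 2 *: (2 * Num.sqrt s)^-1).
    by apply: is_deriveV; rewrite gt_eqF.
  apply: is_derive_ext (is_deriveM' (is_derive_cst' z s) dVV) _ _ => //.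
  by rewrite /GRing.scale/=; field; rewrite gt_eqF.
rewrite /F; apply: is_derive_ext (is_deriveM' dS (is_derive_comp' (f := G) (g := fun s : R => z / Num.sqrt s) (dG dQ (z / Num.sqrt s)) dV)) _ _ => //.
rewrite heat_kernelE// /Gf; field; rewrite gt_eqF//.
Qed.

(** The function sqrt s * G (z / sqrt s) is E (sqrt s * N - z)^+, whose derivative in s is half the
    heat kernel. The correction term of (i) is therefore a normal stop-loss. *)
Lemma heat_integral t z : 0 <= t -> 0 < z ->
  ((2^-1)%:E * \int[mu]_(s in `]0%R, t]) (heat_kernel s z)%:E = (Num.sqrt t * G (z / Num.sqrt t))%:E)%E.
Proof.
rewrite le_eqVlt => /predU1P[<-|t0] z0.
  by rewrite set_itvoc0 integral_set0 mule0 sqrtr0 mul0r.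
have G0 x : 0 <= G x by exact: G_ge0.
have sq0 : (Num.sqrt s : R) @[s --> 0^'+] --> (0 : R).
  by apply: cvg_at_right_filter; rewrite -[X in _ --> X]sqrtr0; exact: sqrt_continuous.
have h0 : heat_kernel s z @[s --> 0^'+] --> (0 : R).
  pose C := 2 * (Num.sqrt (2 * pi))^-1 / z ^+ 2 : R.
  apply: (@squeeze_cvgr _ _ _ _ (cst 0) (fun s => C * Num.sqrt s)); last 2 first.
  - exact: cvg_cst.
  - by rewrite -[X in _ --> X](mulr0 C); apply: cvgM => //; exact: cvg_cst.
  near=> s; have s0 : 0 < s by near: s; exact: nbhs_right_gt.
  have q0 : 0 < Num.sqrt s by rewrite sqrtr_gt0.
  rewrite heat_kernel_ge0/= heat_kernelE// ler_pdivrMr//.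
  apply: le_trans (phi_le (divr_gt0 z0 q0)) _; rewrite /C le_eqVlt; apply/orP; left; apply/eqP.
  have n1 : Num.sqrt (2 * pi) != 0 :> R by rewrite gt_eqF// sqrtr_gt0 mulr_gt0// pi_gt0.
  have n2 : Num.sqrt s != 0 by rewrite gt_eqF.
  have n3 : z != 0 by rewrite gt_eqF.
  by field; rewrite n1 n2 n3.
have F0 : F z s @[s --> 0^'+] --> (0 : R).
  apply: (@squeeze_cvgr _ _ _ _ (cst 0) (fun s => phi 0 * Num.sqrt s)); last 2 first.
  - exact: cvg_cst.
  - by rewrite -[X in _ --> X](mulr0 (phi 0)); apply: cvgM => //; exact: cvg_cst.
  near=> s; have s0 : 0 < s by near: s; exact: nbhs_right_gt.
  rewrite /F mulr_ge0 ?sqrtr_ge0//= mulrC ler_wpM2r ?sqrtr_ge0//.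
  have zs : 0 <= z / Num.sqrt s by rewrite divr_ge0 ?sqrtr_ge0// ltW.
  rewrite -[z / _]ger0_norm//; apply: le_trans (G_le_phi dQ Qy _) _.
  rewrite /phi ler_wpM2l ?(ltW sqrt2pi_gt0)// ler_expR expr0n/= mul0r oppr0 oppr_le0.
  by rewrite divr_ge0// sqr_ge0.
have Fz0 : F z 0 = 0 by rewrite /F sqrtr0 mul0r.
have mh : measurable_fun (`]0, t]%classic : set R) (fun s : R => heat_kernel s z).
  have mh0 : measurable_fun (`]0%R, +oo[%classic : set R) (fun s : R => heat_kernel s z).
    apply: open_continuous_measurable_fun; first exact: interval_open.
    by move=> s; rewrite inE/= in_itv/= andbT; exact: heat_kernel_continuous.
  apply: measurable_funS mh0; first exact: measurable_itv.
  by move=> s /=; rewrite !in_itv/= andbT => /andP[].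
rewrite -ge0_integralZl//; last 2 first.
- exact/measurable_EFinP.
- by move=> s _; rewrite lee_fin heat_kernel_ge0.
rewrite (_ : (\int[mu]_(s in _) _ = \int[mu]_(s in `[0%R, t]) (2^-1 * heat_kernel s z)%:E)%E); last first.
  by rewrite -integral_itv_obnd_cbnd//; apply/measurable_EFinP; apply: measurable_funM.
rewrite (@continuous_FTC2 R _ (F z) 0 t t0).
- by rewrite Fz0 sube0.
- apply/(continuous_within_itvP _ t0); split.
  + move=> s; rewrite in_itv/= => /andP[s0 _].
    by apply: cvgM; [exact: cvg_cst|exact: heat_kernel_continuous].
  + by rewrite heat_kernel0; apply: cvgM; [exact: cvg_cst|exact: h0].
  + apply: cvg_at_left_filter.
    by apply: cvgM; [exact: cvg_cst|exact: heat_kernel_continuous].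
- split.
  + by move=> s; rewrite in_itv/= => /andP[s0 _]; case: (dF z s0).
  + by rewrite Fz0.
  + apply: cvg_at_left_filter.
    exact: (@is_derive_continuous _ (F z) (fun s => 2^-1 * heat_kernel s z) t (dF z t0)).
- by move=> s; rewrite in_itv/= => /andP[s0 _]; rewrite derive1E; case: (dF z s0).
Unshelve. all: end_near. Qed.

End heat.

Section stop_loss.
Context {R : realType} d (T : measurableType d) (P : probability T R) (f : T -> R) (U : R -> R).
Notation mu := lebesgue_measure.
Hypotheses (mf : measurable_fun setT f) (cU : cvxR U).
Hypothesis law : forall B : set R, measurable B -> (P (f @^-1` B) = \int[mu]_(x in B) (tilt U x)%:E)%E.
Hypothesis f0 : (\int[P]_t f t)%R = 0.

Lemma law_integrable : P.-integrable setT (EFin \o f).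
Proof. by have := law_moment mf cU law 1; apply: eq_integrable => // t _ /=; rewrite expr1. Qed.

(** For x <= 0 the identity (x - y)^+ = (y - x)^+ + (x - y) is used, so that one stop-loss function
    serves both signs of x. *)
Lemma kern_scale (s y x : R) : 0 < s -> kern (s * y) x = s * (pos (y - x / s) + (if 0 < x then 0 else x / s - y)).
Proof.
move=> s0; have scale z : pos (s * z) = s * pos z by rewrite /pos maxr_pMr ?mulr0// ltW.
have e1 : s * y - x = s * (y - x / s) by field; rewrite gt_eqF.
have e2 : x - s * y = s * (x / s - y) by field; rewrite gt_eqF.
rewrite /kern; case: ifP => _; first by rewrite addr0 e1 scale.
rewrite e2 scale; congr (_ * _).
by rewrite /pos; case: (leP (x / s - y) 0); case: (leP (y - x / s) 0) => ? ?; lra.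
Qed.

Lemma law_kern (s x : R) : 0 < s ->
  (\int[P]_t (kern (s * f t) x)%:E = (s * (law_S P f (x / s) + (if 0 < x then 0 else x / s)))%:E)%E.
Proof.
move=> s0; have ip := integrable_pos mf cU law (x / s); have if1 := law_integrable.
pose c := if 0 < x then 0 else 1 : R.
have i1 C : P.-integrable setT (EFin \o (fun=> C : R)).
  by have := finite_measure_integrable_cst P C measurableT.
have icB : P.-integrable setT (EFin \o (fun t => x / s - f t)) by exact: integrableB'.
have icc : P.-integrable setT (EFin \o (fun t => c * (x / s - f t))) by exact: integrableZ'.
have iD : P.-integrable setT (EFin \o (fun t => pos (f t - x / s) + c * (x / s - f t))).
  by have := integrableD measurableT ip icc; apply: eq_integrable.
transitivity (\int[P]_t (s * (pos (f t - x / s) + c * (x / s - f t)))%:E)%E.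
  apply: eq_integral => t _; rewrite kern_scale// /c; case: ifP => _; first by rewrite mul0r.
  by rewrite mul1r.
transitivity ((\int[P]_t (s * (pos (f t - x / s) + c * (x / s - f t))))%R%:E)%E.
  by rewrite /Rintegral fineK//; apply: integrable_fin_num => //; exact: integrableZ'.
congr EFin; rewrite RintegralZl//; congr (_ * _); rewrite RintegralD// RintegralZl// RintegralB//.
rewrite f0 Rintegral_cst//= (@probability_setT _ T R P) mulr1 subr0; congr (_ + _).
by rewrite /c; case: ifP => _; rewrite ?mul0r ?mul1r.
Qed.

End stop_loss.

Section comparison.
Context {R : realType} d (T : measurableType d) (P : probability T R) (f g : T -> R) (U : R -> R).
Notation mu := lebesgue_measure.
Hypotheses (mf : measurable_fun setT f) (mg : measurable_fun setT g) (cU : cvxR U).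
Hypothesis lawf : forall B : set R, measurable B -> (P (f @^-1` B) = \int[mu]_(x in B) (tilt U x)%:E)%E.
Hypothesis lawg : forall B : set R, measurable B -> (P (g @^-1` B) = \int[mu]_(x in B) (tilt (fun=> 0) x)%:E)%E.
Hypotheses (f0 : (\int[P]_t f t)%R = 0) (g0 : (\int[P]_t g t)%R = 0).
Implicit Types (x y z s p q : R).

Let c0 : @cvxR R (fun=> 0).
Proof. by move=> t x y _ _; rewrite !mulr0 addr0. Qed.

Local Notation Q := (law_T P g).
Local Notation S := (law_S P f).
Local Notation delta := (1 - (\int[P]_t (f t ^+ 2))%R).

Let tl : tails U (law_T P f) S (law_K P f) delta.
Proof. exact: law_tails. Qed.

Let tlg := law_tails mg c0 lawg g0.

Let dQ x : is_derive x 1 Q (- phi x).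
Proof. by have := tails_dT tlg x; rewrite oppr0 expR0 mulr1. Qed.

Let Qy : Q x @[x --> +oo] --> (0 : R) := tails_Ty tlg.
Let QNy : Q (- x) @[x --> +oo] --> (1 : R) := tails_TNy tlg.

(** Both sides have derivative - Q and limit 0 at infinity. *)
Lemma gauss_stop_loss x : law_S P g x = Gf Q x.
Proof.
pose h z := law_S P g z - Gf Q z.
have dh z : is_derive z 1 h (- Q z - - Q z) by exact: (is_deriveB' (tails_dS tlg z) (dG dQ z)).
have hy : h z @[z --> +oo] --> (0 - 0 : R) by apply: cvgB; [exact: tails_Sy tlg|exact: Gy dQ Qy].
rewrite subr0 in hy.
have hc y z : y <= z -> h y = h z.
  move=> yz; apply/eqP; rewrite eq_le; apply/andP; split.
    by apply: (derive_ge0_le yz (fun x _ => dh x)) => w _; rewrite subrr.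
  by apply: (derive_le0_le yz (fun x _ => dh x)) => w _; rewrite subrr.
have h1 : 0 <= h x by apply: (@noninc_cvgy_le _ h 0 x _ hy) => // y z _ /hc ->.
have hy' : (fun z => - h z) z @[z --> +oo] --> (0 : R) by rewrite -[X in _ --> X]oppr0; exact: cvgN.
have h2 : 0 <= - h x by apply: (@noninc_cvgy_le _ (fun z => - h z) 0 x _ hy') => // y z _ /hc ->.
by move: h1 h2; rewrite /h; lra.
Qed.

Local Notation E x := (Gf Q x - S x).

Lemma kern_gap s x : 0 < s ->
  (\int[P]_t (kern (s * g t) x)%:E = \int[P]_t (kern (s * f t) x)%:E + (s * E (x / s))%:E)%E.
Proof.
move=> s0; rewrite (law_kern mg c0 lawg g0 x s0) (law_kern mf cU lawf f0 x s0) -EFinD gauss_stop_loss.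
by congr EFin; ring.
Qed.

Lemma variance_deficit_ge0 : 0 <= delta.
Proof. exact: (tails_d_ge0 dQ Qy QNy tl). Qed.

Lemma gap_ge0 x : 0 <= E x. Proof. exact: (tails_E_ge0 dQ Qy QNy tl). Qed.

(** The time horizon is (s delta)^2, so the left side is s delta G (sqrt (1 + (x / s)^2) / delta).
    [tails_E_lower] bounds even s G of the same argument, and delta <= 1. The case delta = 0 is
    separate because of the quotient. *)
Lemma gap_lower s x : 0 < s ->
  ((2^-1)%:E * \int[mu]_(t in `]0%R, ((s ^+ 2)^-1 * (s ^+ 2 * delta) ^+ 2)%R])
     (heat_kernel t (Num.sqrt (x ^+ 2 + s ^+ 2)))%:E <= (s * E (x / s))%:E)%E.
Proof.
move=> s0; have s20 : 0 < s ^+ 2 by rewrite exprn_gt0.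
have z0 : 0 < Num.sqrt (x ^+ 2 + s ^+ 2) by rewrite sqrtr_gt0 ltr_wpDl ?sqr_ge0.
have d0 := variance_deficit_ge0.
have tE : (s ^+ 2)^-1 * (s ^+ 2 * delta) ^+ 2 = (s * delta) ^+ 2 by field; rewrite gt_eqF.
rewrite tE (heat_integral dQ Qy (sqr_ge0 _) z0).
have sd : Num.sqrt ((s * delta) ^+ 2) = s * delta.
  by rewrite sqrtr_sqr ger0_norm// mulr_ge0// ltW.
rewrite sd lee_fin -mulrA ler_pM2l//.
move: d0; rewrite le_eqVlt => /predU1P[<-|d0]; first by rewrite mul0r gap_ge0.
have e : Num.sqrt (x ^+ 2 + s ^+ 2) / (s * delta) = Num.sqrt (1 + (x / s) ^+ 2) / delta.
  have -> : x ^+ 2 + s ^+ 2 = s ^+ 2 * (1 + (x / s) ^+ 2) by field; rewrite gt_eqF.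
  by rewrite sqrtrM ?(ltW s20)// sqrtr_sqr ger0_norm ?(ltW s0)//; field; rewrite !gt_eqF.
rewrite e; apply: le_trans (tails_E_lower dQ Qy QNy tl (x / s) d0).
by rewrite ler_piMl ?(G_ge0 dQ Qy)// (tails_d_le1 tl).
Qed.

(** With e = E / phi 0, both e <= exp (- y^2 / 2) and e <= sqrt delta hold; writing e = e^(1/q)
    e^(1/p) interpolates between them. The stated constant follows from 1 / q >= 1 / (1 + q) and (1
    + q)^(1 / (2 q)) >= 1. *)
Lemma gap_upper s x p q : 0 < s -> 1 < p -> p^-1 + q^-1 = 1 ->
  s * E (x / s) <= (s ^+ 2 * (1 + q)) `^ (2 * q)^-1 * (s ^+ 2 * delta) `^ (2 * p)^-1 *
     heat_kernel 1 (x / Num.sqrt (s ^+ 2 * (1 + q))).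
Proof.
move=> s0 p1 pq; have s20 : 0 < s ^+ 2 by rewrite exprn_gt0.
have p0 : 0 < p by lra.
have q1 : 0 < q^-1 by have := invf_lt1 p0; rewrite p1; lra.
have q0 : 0 < q by rewrite -invr_gt0.
have d0 := variance_deficit_ge0.
set y := x / s.
have hk : heat_kernel 1 (x / Num.sqrt (s ^+ 2 * (1 + q))) = phi 0 * expR (- (y ^+ 2 / (2 * (1 + q)))).
  rewrite /heat_kernel /phi !mulr1 expr0n/= mul0r oppr0 expR0 mulr1; congr (_ * expR (- _)).
  rewrite expr_div_n sqr_sqrtr; last by rewrite mulr_ge0 ?(ltW s20)//; lra.
  by rewrite /y; field; rewrite !gt_eqF//; lra.
(* The exponents 1 / (2 q) and 1 / (2 p) add up to 1 / 2, so the two powers of s^2 combine into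
   s. *)
have powE : (s ^+ 2 * (1 + q)) `^ (2 * q)^-1 * (s ^+ 2 * delta) `^ (2 * p)^-1 =
    s * ((1 + q) `^ (2 * q)^-1 * delta `^ (2 * p)^-1).
  have q1' : 0 <= 1 + q by lra.
  rewrite (powRM _ (ltW s20) q1') (powRM _ (ltW s20) d0).
  rewrite mulrACA -powRD; last by apply/implyP => _; rewrite gt_eqF.
  have -> : (2 * q)^-1 + (2 * p)^-1 = 2^-1 by rewrite !invfM -mulrDr addrC pq mulr1.
  by rewrite powR12_sqrt ?(ltW s20)// sqrtr_sqr ger0_norm ?(ltW s0).
rewrite powE hk -[leRHS]mulrA ler_pM2l//.
have E1 := tails_E_le_phi dQ Qy QNy tl y; have E2 := tails_E_le_sqrt dQ Qy QNy tl y.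
have E0 := gap_ge0 y.
have f00 : 0 < phi (0 : R) := phi_gt0 0.
set A := expR (- (y ^+ 2 / 2)); set B := Num.sqrt delta.
have phE : phi y = phi 0 * A by rewrite /phi expr0n/= mul0r oppr0 expR0 mulr1.
pose e := E y / phi 0.
have e0 : 0 <= e by rewrite divr_ge0// ltW.
have eA : e <= A by rewrite ler_pdivrMr// mulrC -phE.
have eB : e <= B by rewrite ler_pdivrMr// mulrC.
have eE : E y = e * phi 0 by rewrite /e divfK// gt_eqF.
have ipow : e = e `^ q^-1 * e `^ p^-1.
  rewrite -powRD; last by rewrite addrC pq oner_eq0.
  by rewrite addrC pq powRr1.
have h1 : e `^ q^-1 <= expR (- (y ^+ 2 / (2 * (1 + q)))).
  apply: (@le_trans _ _ (A `^ q^-1)); first by apply: ge0_ler_powR => //; rewrite ?nnegrE ?expR_ge0 ?(ltW q1).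
  have -> : A `^ q^-1 = expR (- (y ^+ 2 / (2 * q))).
    by rewrite /A -expRM; congr expR; field; rewrite gt_eqF.
  rewrite ler_expR lerN2 ler_wpM2l ?sqr_ge0//.
  by rewrite lef_pV2 ?posrE ?mulr_gt0//; lra.
have h2 : e `^ p^-1 <= delta `^ (2 * p)^-1.
  rewrite invfM powRrM powR12_sqrt// -/B.
  by apply: ge0_ler_powR => //; rewrite ?nnegrE ?sqrtr_ge0// invr_ge0 ltW.
have h3 : 1 <= (1 + q) `^ (2 * q)^-1.
  rewrite -[leLHS](powRr0 (1 + q)); apply: ler_powR; first lra.
  by rewrite invr_ge0 mulr_ge0// ltW.
set X := expR _ in h1 *; set D := delta `^ _ in h2 *; set C := (1 + q) `^ _ in h3 *.
have X0 : 0 <= X by exact: expR_ge0.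
have D0 : 0 <= D by exact: powR_ge0.
have h4 : e <= X * D by rewrite ipow ler_pM ?powR_ge0.
have h5 : X * D <= C * (X * D) by rewrite ler_peMl// mulr_ge0.
rewrite eE [leRHS](_ : _ = C * (X * D) * phi 0); last by ring.
by rewrite ler_pM2r//; exact: le_trans h4 h5.
Qed.

End comparison.

(** * Convex domination through a separating affine function *)

Section convex_facts.
Context {R : realType}.
Implicit Types (f h : R -> R) (a b c x y z : R).

Lemma cvxR_slopes h a b c : cvxR h -> a < b -> b < c -> (h b - h a) / (b - a) <= (h c - h b) / (c - b).
Proof.
move=> ch ab bc; have ac : 0 < c - a by lra.
have t0 : 0 <= (c - b) / (c - a) by apply: divr_ge0; lra.
have t1 : (c - b) / (c - a) <= 1 by rewrite ler_pdivrMr//; lra.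
have := ch _ a c t0 t1.
have -> : (c - b) / (c - a) * a + (1 - (c - b) / (c - a)) * c = b by field; rewrite gt_eqF.
move=> /(ler_wpM2l (ltW ac)).
have -> : (c - a) * ((c - b) / (c - a) * h a + (1 - (c - b) / (c - a)) * h c) =
  (c - b) * h a + (b - a) * h c by field; rewrite gt_eqF.
have ba : 0 < b - a by lra.
have cb : 0 < c - b by lra.
by move=> H; rewrite ler_pdivrMr// mulrAC ler_pdivlMr//; lra.
Qed.

Lemma cvxR_support h x : cvxR h -> exists l, forall y, h x + l * (y - x) <= h y.
Proof.
move=> ch; pose S := [set (h y - h x) / (y - x) | y in [set y | x < y]].
have lb z : z < x -> lbound S ((h x - h z) / (x - z)).
  by move=> zx _ [y /= xy <-]; exact: cvxR_slopes.
have S0 : has_inf S.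
  split; first by exists ((h (x + 1) - h x) / (x + 1 - x)), (x + 1) => //=; lra.
  by exists ((h x - h (x - 1)) / (x - (x - 1))); apply: lb; lra.
exists (inf S) => y; have [yx|xy|->] := ltgtP y x; last by rewrite subrr mulr0 addr0.
  have : (h x - h y) / (x - y) <= inf S by apply: lb_le_inf; [exact: S0.1|exact: lb].
  by rewrite ler_pdivrMr ?subr_gt0//; lra.
have : inf S <= (h y - h x) / (y - x) by apply: ge_inf; [exact: S0.2|exists y].
by rewrite ler_pdivlMr ?subr_gt0//; lra.
Qed.

Lemma cvxR_affine h a b : cvxR h -> cvxR (fun x => h x - (a + b * x)).
Proof.
by move=> ch t x y t0 t1; have := ch t x y t0 t1; move: (h _) (h x) (h y) => u v w; lra.
Qed.

Lemma cvxR_scale h a : cvxR h -> cvxR (fun x => h (a * x)).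
Proof. by move=> ch t x y t0 t1; have := ch t (a * x) (a * y) t0 t1; congr (h _ <= _); ring. Qed.

Lemma cvxR_outside U a b z : cvxR U -> a < b -> 0 <= U a -> U b < 0 -> z <= a -> 0 <= U z.
Proof.
move=> cU ab Ua Ub za; rewrite leNgt; apply/negP => Uz.
have := cvxR_between (l := Num.max (U z) (U b)) cU za (ltW ab); rewrite !le_max !lexx orbT => /(_ isT isT).
by case/orP => ?; lra.
Qed.

End convex_facts.

Section crossing.
Context {R : realType} (Q : R -> R).
Hypothesis dQ : forall x : R, is_derive x 1 Q (- phi x).
Hypothesis Qy : Q x @[x --> +oo] --> (0 : R).
Hypothesis QNy : Q (- x) @[x --> +oo] --> (1 : R).
Implicit Types (U T S K : R -> R) (d x y z : R).

(** Otherwise the density would be at least phi on [x, +oo), strictly more near x, and two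
    integrations would give S x > G x, against [tails_E_ge0]. *)
Lemma tails_exit U T S K d x : tails U T S K d -> U x < 0 -> exists2 y, x < y & 0 < U y.
Proof.
move=> tl Ux; apply: contrapT => /forall2NP H.
have Ule y : x <= y -> U y <= 0.
  rewrite le_eqVlt => /predU1P[<-|xy]; first exact: ltW.
  by have [//|/negP] := H y; rewrite -leNgt.
have dA z : is_derive z 1 (fun z => T z - Q z) (- (phi z * expR (- U z)) - - phi z).
  exact: is_deriveB' (tails_dT tl z) (dQ z).
have dB z : is_derive z 1 (fun z => S z - Gf Q z) (- T z - - Q z).
  exact: is_deriveB' (tails_dS tl z) (dG dQ z).
have dA0 z : x <= z -> - (phi z * expR (- U z)) - - phi z <= 0.
  move=> xz; rewrite opprK addrC subr_le0 ler_peMr ?(ltW (phi_gt0 _))//.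
  by rewrite -expR0 ler_expR oppr_ge0 Ule.
have A0 z : x <= z -> 0 <= T z - Q z.
  move=> xz; have Ay : (T z - Q z) @[z --> +oo] --> (0 : R).
    by rewrite -[X in _ --> X](subrr 0); apply: cvgB; [exact: tails_Ty tl|].
  apply: (@noninc_cvgy_le _ (fun z => T z - Q z) 0 x _ Ay) => // y w xy yw.
  by apply: (derive_le0_le yw (fun x _ => dA x)) => t /andP[yt _]; apply: dA0; lra.
have Bni y w : x <= y -> y <= w -> S w - Gf Q w <= S y - Gf Q y.
  move=> xy yw; apply: (derive_le0_le yw (fun x _ => dB x)) => t /andP[yt _].
  by have := A0 t ltac:(lra); lra.
have B0 z : x <= z -> 0 <= S z - Gf Q z.
  move=> xz; have By : (S z - Gf Q z) @[z --> +oo] --> (0 : R).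
    by rewrite -[X in _ --> X](subrr 0); apply: cvgB; [exact: tails_Sy tl|exact: Gy dQ Qy].
  exact: (@noninc_cvgy_le _ (fun z => S z - Gf Q z) 0 x Bni By).
have /cvgrPdist_lt cU : U y @[y --> x] --> U x by exact: cvxR_continuous (tails_cvx tl) x.
have /nbhs_ballP[r /= r0 Hr] := cU (- U x) ltac:(lra).
have Uneg y : x <= y -> y < x + r -> U y < 0.
  move=> xy yr; have : `|U x - U y| < - U x by apply: Hr; rewrite /ball/= ler0_norm; lra.
  by rewrite ltr_norml => /andP[? ?]; lra.
pose x1 := x + r / 2.
have As y : x <= y -> y < x1 -> 0 < T y - Q y.
  move=> xy y1; apply: le_lt_trans (A0 x1 _) _; first by rewrite /x1; lra.
  apply: (derive_lt0_lt y1 (fun x _ => dA x)) => t /andP[yt t1].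
  rewrite opprK addrC subr_lt0 ltr_pMr ?phi_gt0// -expR0 ltr_expR oppr_gt0.
  by apply: Uneg; move: t1; rewrite /x1; lra.
have : S x1 - Gf Q x1 < S x - Gf Q x.
  have xx1 : x < x1 by rewrite /x1; lra.
  apply: (derive_lt0_lt xx1 (fun x _ => dB x)) => t /andP[xt t1].
  by have := As t (ltW xt) t1; lra.
have := B0 x1 ltac:(rewrite /x1; lra); have := tails_E_ge0 dQ Qy QNy tl x.
by lra.
Qed.

(* A chord of h through the two sign changes of U (or a support line of h if U >= 0). *)
Lemma tails_separating_line U T S K d h : tails U T S K d -> cvxR h ->
  exists a b, forall x, 0 <= (h x - (a + b * x)) * (phi x - tilt U x).
Proof.
move=> tl ch; have cU := tails_cvx tl.
have tiltE x : phi x - tilt U x = phi x * (1 - expR (- U x)) by rewrite /tilt; ring.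
have pos x : 0 <= U x -> 0 <= phi x - tilt U x.
  by move=> Ux; rewrite tiltE mulr_ge0 ?(ltW (phi_gt0 _))// subr_ge0 -expR0 ler_expR oppr_le0.
have neg x : U x <= 0 -> phi x - tilt U x <= 0.
  move=> Ux; rewrite tiltE mulr_ge0_le0 ?(ltW (phi_gt0 _))// subr_le0 -expR0 ler_expR.
  by rewrite oppr_ge0.
have [[x0 Ux0]|/forallNP U0] := pselect (exists x, U x < 0); last first.
  have [l Hl] := cvxR_support 0 ch; exists (h 0), l => x.
  rewrite mulr_ge0 ?pos//; first by have := Hl x; rewrite subr0; lra.
  by rewrite leNgt; apply/negP/U0.
have [w xw Uw] := tails_exit tl Ux0.
have [u xu Uu] : exists2 u, u < x0 & 0 < U u.
  have Ux0' : U (- - x0) < 0 by rewrite opprK.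
  have [y xy Uy] := tails_exit (tails_reflect tl) Ux0'.
  by exists (- y) => //; lra.
have cUc := cvxR_continuous cU.
have root y z : y <= z -> Num.min (U y) (U z) <= 0 <= Num.max (U y) (U z) -> exists t, [/\ y <= t, t <= z & U t = 0].
  move=> yz H; have [||t] := @IVT R U y z 0 yz; [exact: continuous_subspaceT|exact: H|].
  by rewrite in_itv/= => /andP[? ?] ?; exists t.
have [al [ual alx Ual]] : exists z, [/\ u <= z, z <= x0 & U z = 0].
  by apply: root; [exact: ltW|rewrite ge_min le_max (ltW Ux0) (ltW Uu) orbT].
have [be [xbe bew Ube]] : exists z, [/\ x0 <= z, z <= w & U z = 0].
  by apply: root; [exact: ltW|rewrite ge_min le_max (ltW Ux0) (ltW Uw) orbT].
have {}alx : al < x0 by rewrite lt_neqAle alx andbT; apply/eqP => E; rewrite E in Ual; lra.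
have {}xbe : x0 < be by rewrite lt_neqAle xbe andbT; apply/eqP => E; rewrite -E in Ube; lra.
pose b := (h be - h al) / (be - al); exists (h al - b * al), b => x.
pose k z := h z - (h al - b * al + b * z).
have ck : cvxR k by exact: cvxR_affine.
have kal : k al = 0 by rewrite /k; ring.
have kbe : k be = 0 by rewrite /k /b; field; rewrite gt_eqF//; lra.
(* Outside [al, be] both factors are nonnegative, inside both are nonpositive. *)
rewrite -/(k x); have [xal|alx'] := leP x al.
  apply: mulr_ge0; last by apply: pos; apply: (cvxR_outside cU alx _ Ux0 xal); rewrite Ual.
  have [-> |xal'] := eqVneq x al; first by rewrite kal.
  have {}xal' : x < al by rewrite lt_neqAle xal'.
  have := cvxR_slopes ck xal' (lt_trans alx xbe); rewrite kal kbe subrr mul0r sub0r.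
  by rewrite pmulr_lle0 ?invr_gt0 ?subr_gt0// oppr_le0.
have [xb|bex] := leP x be.
  apply: mulr_le0; first by apply: (cvxR_between (l := 0) ck (ltW alx') xb); rewrite ?kal ?kbe.
  by apply: neg; apply: (cvxR_between (l := 0) cU (ltW alx') xb); rewrite ?Ual ?Ube.
apply: mulr_ge0.
  have := cvxR_slopes ck (lt_trans alx xbe) bex; rewrite kal kbe subrr mul0r subr0.
  by rewrite pmulr_lge0// invr_gt0 subr_gt0.
apply: pos; have := @cvxR_outside R (fun z => U (- z)) (- be) (- x0) (- x) (cvxR_comp_opp cU).
by rewrite !opprK; apply; rewrite ?Ube//; lra.
Qed.

End crossing.

Section signed_density.
Context d d' (T : measurableType d) (T' : measurableType d') (R : realType).
Variables (mu : {measure set T -> \bar R}) (nu : {measure set T' -> \bar R}).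
Variables (f : T -> T') (W : T' -> R).
Hypotheses (mf : measurable_fun setT f) (mW : measurable_fun setT W) (W0 : forall x, 0 <= W x).
Hypothesis law : forall B, measurable B -> (mu (f @^-1` B) = \int[nu]_(x in B) (W x)%:E)%E.

Lemma density_integrable (F : T' -> R) : measurable_fun setT F ->
  mu.-integrable setT (EFin \o (fun t => F (f t))) -> nu.-integrable setT (EFin \o (fun x => F x * W x)).
Proof.
move=> mF /integrableP[_ iF]; apply/integrableP; split; first by apply/measurable_EFinP; exact: measurable_funM.
have mN : measurable_fun setT (fun x => `|F x|) by exact: measurableT_comp.
have <- : (\int[mu]_t `|F (f t)|%:E = \int[nu]_x `|(F x * W x)%:E|)%E.
  rewrite (density_integral mf mW W0 law mN (fun=> normr_ge0 _)).
  by apply: eq_integral => x _; rewrite /= normrM (ger0_norm (W0 x)).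
exact: iF.
Qed.

Lemma density_integral_signed (F : T' -> R) : measurable_fun setT F ->
  (\int[mu]_t (F (f t))%:E = \int[nu]_x (F x * W x)%:E)%E.
Proof.
move=> mF; rewrite integralE [RHS]integralE; congr (_ - _)%E.
  have mp : measurable_fun setT (fun x => Num.max (F x) 0) by exact: measurable_maxr.
  have := density_integral mf mW W0 law mp; rewrite (_ : (\int[mu]_t _ = \int[mu]_t ((fun t => (F (f t))%:E)^\+ t))%E); last first.
    by apply: eq_integral => t _; rewrite funeposE -EFin_max.
  move=> ->; first by apply: eq_integral => x _; rewrite funeposE -EFin_max maxr_pMl ?mul0r.
  by move=> x; rewrite le_max lexx orbT.
have mp : measurable_fun setT (fun x => Num.max (- F x) 0).
  by apply: measurable_maxr => //; exact: measurableT_comp.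
have := density_integral mf mW W0 law mp; rewrite (_ : (\int[mu]_t _ = \int[mu]_t ((fun t => (F (f t))%:E)^\- t))%E); last first.
  by apply: eq_integral => t _; rewrite funenegE -EFinN -EFin_max.
move=> ->; first by apply: eq_integral => x _; rewrite funenegE -EFinN -EFin_max maxr_pMl ?mul0r ?mulNr.
by move=> x; rewrite le_max lexx orbT.
Qed.

End signed_density.

Section domination.
Context {R : realType} d (T : measurableType d) (P : probability T R) (f g : T -> R) (U : R -> R).
Notation mu := lebesgue_measure.
Hypotheses (mf : measurable_fun setT f) (mg : measurable_fun setT g) (cU : cvxR U).
Hypothesis lawf : forall B : set R, measurable B -> (P (f @^-1` B) = \int[mu]_(x in B) (tilt U x)%:E)%E.
Hypothesis lawg : forall B : set R, measurable B -> (P (g @^-1` B) = \int[mu]_(x in B) (tilt (fun=> 0) x)%:E)%E.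
Hypotheses (f0 : (\int[P]_t f t)%R = 0) (g0 : (\int[P]_t g t)%R = 0).
Implicit Types (x y z s p q : R).

Let c0 : @cvxR R (fun=> 0).
Proof. by move=> t x y _ _; rewrite !mulr0 addr0. Qed.

Let affine_law (h : T -> R) V a b : measurable_fun setT h -> cvxR V ->
  (forall B : set R, measurable B -> (P (h @^-1` B) = \int[mu]_(x in B) (tilt V x)%:E)%E) ->
  (\int[P]_t h t)%R = 0 ->
  mu.-integrable [set: R] (EFin \o (fun x => (a + b * x) * tilt V x)) /\
  (\int[mu]_x ((a + b * x) * tilt V x)%:E = a%:E)%E.
Proof.
move=> mh cV lawh h0; have V0 x : 0 <= tilt V x by exact: ltW (tilt_gt0 _ _).
have ih := law_integrable mh cV lawh.
have i1 C : P.-integrable setT (EFin \o (fun=> C : R)).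
  by have := finite_measure_integrable_cst P C measurableT.
have iF : P.-integrable setT (EFin \o (fun t => a + b * h t)).
  by have := integrableD measurableT (i1 a) (integrableZ' b ih); apply: eq_integrable.
have mF : measurable_fun setT (fun x : R => a + b * x).
  by apply: measurable_funD => //; exact: measurable_funM.
split.
  exact: (@density_integrable _ _ _ (measurableTypeR R) R P mu h (tilt V) mh (measurable_tilt cV) V0 lawh _ mF iF).
rewrite -(@density_integral_signed _ _ _ (measurableTypeR R) R P mu h (tilt V) mh (measurable_tilt cV) V0 lawh _ mF).
rewrite -[LHS]fineK; last exact: (integrable_fin_num measurableT iF).
congr EFin; transitivity (\int[P]_t (a + b * h t))%R; first by [].
rewrite RintegralD//; last exact: integrableZ'.
by rewrite RintegralZl// h0 mulr0 addr0 Rintegral_cst//= (@probability_setT _ T R P) mulr1.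
Qed.

(** The separating line has the same integral against both centred densities, so adding its
    difference A changes nothing and makes the integrands comparable pointwise. Nonnegativity of h
    lets infinite values through. *)
Lemma convex_domination_ge0 (h : R -> R) : cvxR h -> (forall x, 0 <= h x) ->
  (\int[P]_t (h (f t))%:E <= \int[P]_t (h (g t))%:E)%E.
Proof.
move=> ch h0; have mh : measurable_fun setT h by apply: continuous_measurable_fun; exact: cvxR_continuous.
have tl := law_tails mf cU lawf f0; have tlg := law_tails mg c0 lawg g0.
have dQ x : is_derive x 1 (law_T P g) (- phi x) by have := tails_dT tlg x; rewrite oppr0 expR0 mulr1.
have [a [b Hab]] := tails_separating_line dQ (tails_Ty tlg) (tails_TNy tlg) tl ch.
rewrite (law_expectation mf cU lawf mh h0) (law_expectation mg c0 lawg mh h0).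
have [iU EU] := affine_law a b mf cU lawf f0; have [i0 E0] := affine_law a b mg c0 lawg g0.
have tilt0 x : tilt (fun=> 0) x = phi x by rewrite /tilt oppr0 expR0 mulr1.
pose A x := (a + b * x) * tilt U x - (a + b * x) * tilt (fun=> 0) x.
have iA : mu.-integrable [set: R] (EFin \o A).
  by have := integrableB measurableT iU i0; apply: eq_integrable.
have EA : (\int[mu]_x (A x)%:E = 0)%E.
  by have := integralB measurableT iU i0; rewrite [X in (_ - X)%E]E0 [X in (X - _)%E]EU subee.
have mhp : measurable_fun [set: R] (fun x => h x * tilt (fun=> 0) x).
  by apply: measurable_funM => //; exact: measurable_tilt.
have -> : (\int[mu]_x (h x * tilt (fun=> 0) x)%:E = \int[mu]_x (A x + h x * tilt (fun=> 0) x)%:E)%E.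
  rewrite (@integralD_ge0 _ (measurableTypeR R) R mu A (fun x => h x * tilt (fun=> 0) x))//.
    by rewrite EA add0e.
  by move=> x; rewrite mulr_ge0// ltW// tilt_gt0.
apply: ge0_le_integral => //.
- by move=> x _; rewrite lee_fin mulr_ge0// ltW// tilt_gt0.
- by apply/measurable_EFinP; apply: measurable_funM => //; exact: measurable_tilt.
- apply/measurable_EFinP; apply: measurable_funD => //.
  by apply/measurable_EFinP; case/integrableP: iA.
by move=> x _; rewrite lee_fin /A tilt0; have := Hab x; lra.
Qed.

(** Subtracting a support line at 0 leaves a nonnegative convex function, and the line has
    expectation h 0 under both laws. *)
Lemma convex_domination (h : R -> R) : cvxR h ->
  (\int[P]_t (h (f t))%:E <= \int[P]_t (h (g t))%:E)%E.
Proof.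
move=> ch; have [l Hl] := cvxR_support 0 ch.
pose k y := h y - (h 0 + l * y).
have ck : cvxR k by exact: cvxR_affine.
have k0 y : 0 <= k y by rewrite /k; have := Hl y; rewrite subr0; lra.
have i1 C : P.-integrable setT (EFin \o (fun=> C : R)).
  by have := finite_measure_integrable_cst P C measurableT.
have key (w : T -> R) : measurable_fun setT w -> P.-integrable setT (EFin \o w) -> (\int[P]_t w t)%R = 0 ->
    (\int[P]_t (h (w t))%:E = (h 0)%:E + \int[P]_t (k (w t))%:E)%E.
  move=> mw iw w0; have ia : P.-integrable setT (EFin \o (fun t => h 0 + l * w t)).
    by have := integrableD measurableT (i1 (h 0)) (integrableZ' l iw); apply: eq_integrable.
  transitivity (\int[P]_t (h 0 + l * w t + k (w t))%:E)%E.
    by apply: eq_integral => t _; congr EFin; rewrite /k; ring.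
  rewrite integralD_ge0//; last first.
    apply: measurableT_comp mw; apply: continuous_measurable_fun; exact: cvxR_continuous.
  congr (_ + _)%E; rewrite -[LHS]fineK; last exact: (integrable_fin_num measurableT ia).
  congr EFin; transitivity (\int[P]_t (h 0 + l * w t))%R; first by [].
  rewrite RintegralD//; last exact: integrableZ'.
  by rewrite RintegralZl// w0 mulr0 addr0 Rintegral_cst//= (@probability_setT _ T R P) mulr1.
rewrite (key f)//; last exact: (law_integrable mf cU lawf).
rewrite (key g)//; last exact: (law_integrable mg c0 lawg).
by rewrite leeD2l// convex_domination_ge0.
Qed.

End domination.

(** * The inequalities for the normalised one-dimensional variables *)

Section one_dimensional.
Context {R : realType} d (T : measurableType d) (P : probability T R) (f g : T -> R) (U : R -> R).
Notation mu := lebesgue_measure.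
Hypotheses (mf : measurable_fun setT f) (mg : measurable_fun setT g) (cU : cvxR U).
Hypothesis lawf : forall B : set R, measurable B -> (P (f @^-1` B) = \int[mu]_(x in B) (tilt U x)%:E)%E.
Hypothesis lawg : forall B : set R, measurable B -> (P (g @^-1` B) = \int[mu]_(x in B) (tilt (fun=> 0) x)%:E)%E.
Hypotheses (f0 : (\int[P]_t f t)%R = 0) (g0 : (\int[P]_t g t)%R = 0).
Variable s : R.
Hypothesis s0 : 0 < s.

Let c0 : @cvxR R (fun=> 0).
Proof. by move=> t x y _ _; rewrite !mulr0 addr0. Qed.

Local Notation delta := (1 - (\int[P]_t (f t ^+ 2))%R).

Lemma one_dim_domination (psi : R -> R) : cvxR psi ->
  (\int[P]_t (psi (s * f t))%:E <= \int[P]_t (psi (s * g t))%:E)%E.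
Proof.
move=> cpsi.
exact: (convex_domination mf mg cU lawf lawg f0 g0 (h := fun x => psi (s * x)) (cvxR_scale s cpsi)).
Qed.

Variables (psi : R -> R) (m : {measure set R -> \bar R}).
Hypotheses (cpsi : cvxR psi) (mpsi : second_derivative_measure psi m).

Let mG := Gf (law_T P g).
Let e (x : R) := s * (mG (x / s) - law_S P f (x / s)).

Let psi_kern (h : T -> R) : measurable_fun setT h -> P.-integrable setT (EFin \o h) -> (\int[P]_t h t)%R = 0 ->
  (\int[P]_t (psi (s * h t))%:E = (psi 0)%:E + \int[m]_x \int[P]_t (kern (s * h t) x)%:E)%E /\
  measurable_fun setT (fun x : R => \int[P]_t (kern (s * h t) x)%:E)%E.
Proof.
move=> mh ih h0; have msh : measurable_fun setT (fun t => s * h t) by exact: measurable_funM.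
split; last exact: (measurable_kernel_expectation P msh).
apply: (kernel_expectation cpsi mpsi msh); first exact: integrableZ'.
rewrite -[LHS]fineK; last exact: (integrable_fin_num measurableT (integrableZ' s ih)).
by congr EFin; transitivity (\int[P]_t (s * h t))%R => //; rewrite RintegralZl// h0 mulr0.
Qed.

Let e_ge0 x : 0 <= e x.
Proof. by apply: mulr_ge0; [exact: ltW|exact: (gap_ge0 mf mg cU lawf lawg f0 g0)]. Qed.

Let measurable_e : measurable_fun setT e.
Proof.
have tl := law_tails mf cU lawf f0; have tlg := law_tails mg c0 lawg g0.
have dQ (x : R) : is_derive x 1 (law_T P g) (- phi x) by have := tails_dT tlg x; rewrite oppr0 expR0 mulr1.
apply: continuous_measurable_fun => x; apply: cvgM; first exact: cvg_cst.
have cd : {for x, continuous (fun x : R => x / s)} by apply: cvgM; [exact: cvg_id|exact: cvg_cst].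
apply: cvgB.
  apply: (@continuous_comp _ _ _ (fun x : R => x / s) mG _ cd).
  exact: (@is_derive_continuous _ mG (fun x => - law_T P g x) _ (dG dQ (x / s))).
apply: (@continuous_comp _ _ _ (fun x : R => x / s) (law_S P f) _ cd).
exact: (@is_derive_continuous _ _ (fun x => - law_T P f x) _ (tails_dS tl (x / s))).
Qed.

Let kern_int_ge0 (h : T -> R) x : (0 <= \int[P]_t (kern (s * h t) x)%:E)%E.
Proof. by apply: integral_ge0 => t _; rewrite lee_fin kern_ge0. Qed.

(** An exact identity: the two expectations differ by the integral of the gap against psi''. The
    bounds of (i) and (ii) follow by integrating [gap_lower] and [gap_upper]. *)
Let psi_gap : (\int[P]_t (psi (s * g t))%:E = \int[P]_t (psi (s * f t))%:E + \int[m]_x (e x)%:E)%E.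
Proof.
have [-> mkg] := psi_kern mg (law_integrable mg c0 lawg) g0.
have [-> mkf] := psi_kern mf (law_integrable mf cU lawf) f0.
rewrite -addeA; congr (_ + _)%E; rewrite -ge0_integralD//; last 2 first.
- by move=> x _; rewrite lee_fin.
- exact/measurable_EFinP.
by apply: eq_integral => x _; rewrite (kern_gap mf mg cU lawf lawg f0 g0 x s0).
Qed.

Lemma one_dim_lower : (\int[P]_t (psi (s * f t))%:E +
    (2^-1)%:E * \int[m]_x \int[mu]_(t in `]0%R, ((s ^+ 2)^-1 * (s ^+ 2 * delta) ^+ 2)%R])
      (heat_kernel t (Num.sqrt (x ^+ 2 + s ^+ 2)))%:E <= \int[P]_t (psi (s * g t))%:E)%E.
Proof.
rewrite psi_gap leeD2l//.
set J := fun x : R => (\int[mu]_(t in _) (heat_kernel t (Num.sqrt (x ^+ 2 + s ^+ 2)))%:E)%E.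
have J0 x : (0 <= J x)%E by apply: integral_ge0 => t _; rewrite lee_fin heat_kernel_ge0.
(* Measurability in x of the inner integral is read off its closed form [heat_integral]. *)
have mJ : measurable_fun setT J.
  have tlg := law_tails mg c0 lawg g0.
  have dQ (x : R) : is_derive x 1 (law_T P g) (- phi x) by have := tails_dT tlg x; rewrite oppr0 expR0 mulr1.
  have d0 := variance_deficit_ge0 mf mg cU lawf lawg f0 g0.
  set t := (s ^+ 2)^-1 * (s ^+ 2 * delta) ^+ 2.
  have t0 : 0 <= t by rewrite mulr_ge0 ?sqr_ge0// invr_ge0 sqr_ge0.
  have -> : J = fun x => (2%:E * (Num.sqrt t * mG (Num.sqrt (x ^+ 2 + s ^+ 2) / Num.sqrt t))%:E)%E.
    apply/funext => x; rewrite -(heat_integral dQ (tails_Ty tlg) t0); last first.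
      by rewrite sqrtr_gt0 ltr_wpDl ?sqr_ge0// exprn_gt0.
    by rewrite muleA -EFinM divff// mul1e.
  apply: measurable_funeM; apply/measurable_EFinP; apply: continuous_measurable_fun => x.
  apply: cvgM; first exact: cvg_cst.
  pose k (x : R) := Num.sqrt (x ^+ 2 + s ^+ 2) / Num.sqrt t.
  apply: (@continuous_comp _ _ _ k mG); last first.
    exact: (@is_derive_continuous _ mG (fun x => - law_T P g x) _ (dG dQ _)).
  apply: cvgM; last exact: cvg_cst.
  apply: (@continuous_comp _ _ _ (fun x : R => x ^+ 2 + s ^+ 2) Num.sqrt); last exact: sqrt_continuous.
  by apply: cvgD; [exact: exprn_continuous|exact: cvg_cst].
rewrite -ge0_integralZl//; last by move=> x _; exact: J0.
apply: ge0_le_integral => //.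
- by move=> x _; apply: mule_ge0; [rewrite lee_fin invr_ge0|exact: J0].
- exact: measurable_funeM.
- exact/measurable_EFinP.
by move=> x _; exact: (gap_lower mf mg cU lawf lawg f0 g0 x s0).
Qed.

Lemma one_dim_upper p q : 1 < p -> p^-1 + q^-1 = 1 ->
  (\int[P]_t (psi (s * g t))%:E <= \int[P]_t (psi (s * f t))%:E +
     Cconst (s ^+ 2) m q * ((s ^+ 2 * delta) `^ (2 * p)^-1)%:E)%E.
Proof.
move=> p1 pq; rewrite psi_gap leeD2l// /Cconst muleAC -EFinM.
set c := _ * _ `^ _.
have c_ge0 : 0 <= c by rewrite mulr_ge0 ?powR_ge0.
have mh : measurable_fun setT (fun x : R => (heat_kernel 1 (x / Num.sqrt (s ^+ 2 * (1 + q))))%:E).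
  apply/measurable_EFinP; apply: continuous_measurable_fun => x.
  apply: (@continuous_comp _ _ _ (fun x : R => x / Num.sqrt (s ^+ 2 * (1 + q))) (fun x : R => heat_kernel 1 x)).
    by apply: cvgM; [exact: cvg_id|exact: cvg_cst].
  rewrite (_ : (fun x : R => heat_kernel 1 x) = phi); first exact: phi_continuous.
  by apply/funext => z; rewrite /heat_kernel /phi !mulr1.
rewrite -ge0_integralZl//; last by move=> x _; rewrite lee_fin heat_kernel_ge0.
apply: ge0_le_integral => //.
- by move=> x _; rewrite lee_fin.
- exact/measurable_EFinP.
- exact: measurable_funeM.
by move=> x _; rewrite -EFinM lee_fin; exact: (gap_upper mf mg cU lawf lawg f0 g0 x s0 p1 pq).
Qed.

End one_dimensional.

(** * Brunn-Minkowski and Prékopa inequalities on the line *)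

Section brunn_minkowski.
Context {R : realType}.
Notation mu := lebesgue_measure.
Implicit Types (A B K : set R) (r s x y : R).

Lemma diameter_measure A r : measurable A -> A !=set0 -> (forall x y, A x -> A y -> y - x <= r) ->
  (mu A <= r%:E)%E.
Proof.
move=> mA [a0 Aa0] Ar.
have lA : has_inf A by split; [exists a0|exists (a0 - r) => y Ay; have := Ar y a0 Ay Aa0; lra].
have AI : A `<=` `[inf A, (inf A + r)]%classic.
  move=> y Ay /=; rewrite in_itv/=; apply/andP; split; first by apply: ge_inf => //; exact: lA.2.
  rewrite -lerBlDr; apply: lb_le_inf; first exact: lA.1.
  by move=> x Ax; have := Ar x y Ax Ay; lra.
have r0 : 0 <= r by have := Ar a0 a0 Aa0 Aa0; rewrite subrr.
apply: (@le_trans _ _ (mu `[inf A, (inf A + r)]%classic)).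
  by apply: le_measure; rewrite ?inE//; exact: measurable_itv.
by rewrite lebesgue_measure_itv/= lte_fin; case: ifP => _; rewrite -?EFinD lee_fin; lra.
Qed.

(** Since K is an interval, its length bounds every difference of its points, so s (b - a) + (1 - s)
    (d - c) is at most that length for a, b in A and c, d in B. The two diameters are then maximised
    one after the other. In the application K is a superlevel set of a log-concave function. *)
Lemma brunn_minkowski s A B K : 0 < s -> s < 1 -> measurable A -> measurable B -> measurable K ->
  A !=set0 -> B !=set0 -> is_interval K -> (forall x y, A x -> B y -> K (s * x + (1 - s) * y)) ->
  (s%:E * mu A + (1 - s)%:E * mu B <= mu K)%E.
Proof.
move=> s0 s1 mA mB mK A0 B0 iK ABK.
have [->|Kfin] := eqVneq (mu K) +oo%E; first by rewrite leey.
have {Kfin} Kfin : mu K \is a fin_num by rewrite ge0_fin_numE ?ltey//; exact: measure_ge0.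
pose k := fine (mu K).
have kE : mu K = k%:E by rewrite /k fineK.
have k0 : 0 <= k by rewrite -lee_fin -kE; exact: measure_ge0.
have len p q : K p -> K q -> q - p <= k.
  move=> Kp Kq; have [pq|pq] := leP p q; last by lra.
  rewrite -lee_fin -kE; apply: (@le_trans _ _ (mu `[p, q]%classic)).
    by rewrite lebesgue_measure_itv/= lte_fin; case: ifP => h; rewrite -?EFinD lee_fin//; lra.
  apply: le_measure; rewrite ?inE//.
  by move=> z /=; rewrite in_itv/= => pzq; exact: (iK _ _ Kp Kq z pzq).
have key a b c d : A a -> A b -> B c -> B d -> s * (b - a) + (1 - s) * (d - c) <= k.
  by move=> Aa Ab Bc Bd; have := len _ _ (ABK _ _ Aa Bc) (ABK _ _ Ab Bd); lra.
have AE c d : B c -> B d -> (mu A <= ((k - (1 - s) * (d - c)) / s)%:E)%E.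
  move=> Bc Bd; apply: diameter_measure => // a b Aa Ab; rewrite ler_pdivlMr//.
  by have := key a b c d Aa Ab Bc Bd; lra.
have [c0 Bc0] := B0.
have Afin : mu A \is a fin_num.
  by rewrite ge0_fin_numE ?measure_ge0//; apply: le_lt_trans (AE c0 c0 Bc0 Bc0) _; rewrite ltry.
pose i := fine (mu A).
have iE : mu A = i%:E by rewrite /i fineK.
have BE : (mu B <= ((k - s * i) / (1 - s))%:E)%E.
  apply: diameter_measure => // c d Bc Bd; rewrite ler_pdivlMr ?subr_gt0//.
  have := AE c d Bc Bd; rewrite iE lee_fin ler_pdivlMr//; lra.
rewrite iE kE -EFinM; have : ((1 - s)%:E * mu B <= (k - s * i)%:E)%E.
  have -> : k - s * i = (1 - s) * ((k - s * i) / (1 - s)) by field; rewrite subr_eq0 gt_eqF.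
  by rewrite EFinM lee_pmul2l// lte_fin subr_gt0.
move=> /(leeD2l (s * i)%:E) /le_trans; apply; rewrite -EFinD lee_fin; lra.
Qed.

(** Set to 0 for y <= 0, so that the layer-cake integral runs over the whole line. *)
Definition level_measure (F : R -> R) (y : R) : \bar R :=
  if 0 < y then mu [set x : R | y < F x] else 0%E.

Lemma level_measure_ge0 F y : (0 <= level_measure F y)%E.
Proof. by rewrite /level_measure; case: ifP => _ //; exact: measure_ge0. Qed.

Lemma measurable_superlevel (F : R -> R) y : measurable_fun setT F -> measurable [set x : R | y < F x].
Proof.
move=> mF; have := mF measurableT `]y, +oo[%classic (measurable_itv _).
by rewrite setTI; congr measurable; apply/funext => x /=; rewrite in_itv/= andbT.
Qed.

Let under_graph (F : R -> R) (p : measurableTypeR R * measurableTypeR R) : \bar R :=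
  (if (0 < p.2) && (p.2 < F p.1) then 1 else 0 : R)%:E.

Let measurable_under_graph (F : R -> R) : measurable_fun setT F -> measurable_fun setT (under_graph F).
Proof.
move=> mF; apply/measurable_EFinP; apply: measurable_fun_ifT => //; apply: measurable_and.
  by apply: measurable_fun_ltr => //; exact: measurable_snd.
apply: measurable_fun_ltr; first exact: measurable_snd.
exact: (measurableT_comp mF measurable_fst).
Qed.

Let under_graph_ge0 F p : (0 <= under_graph F p)%E.
Proof. by rewrite /under_graph lee_fin; case: ifP. Qed.

Let level_measureE (F : R -> R) y : measurable_fun setT F ->
  level_measure F y = (\int[mu]_x under_graph F (x, y))%E.
Proof.
move=> mF; rewrite /level_measure /under_graph/=; case: ifP => y0; last by rewrite integral0.
transitivity (\int[mu]_x (\1_([set x | y < F x] : set R) x)%:E)%E.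
  by rewrite integral_indic//= ?setIT//; exact: measurable_superlevel.
apply: eq_integral => x _; rewrite indicE/=; case: ifP => H; first by rewrite mem_set.
by rewrite memNset//= H.
Qed.

Lemma measurable_level_measure (F : R -> R) : measurable_fun setT F ->
  measurable_fun [set: measurableTypeR R] (level_measure F).
Proof.
move=> mF; have -> : level_measure F = fun y => (\int[mu]_x under_graph F (x, y))%E.
  by apply/funext => y; exact: level_measureE.
apply: (@measurable_fun_fubini_tonelli_G _ _ (measurableTypeR R) (measurableTypeR R) R mu _ (measurable_under_graph mF)).
exact: under_graph_ge0.
Qed.

Lemma layer_cake (F : R -> R) : measurable_fun setT F -> (forall x, 0 <= F x) ->
  (\int[mu]_x (F x)%:E = \int[mu]_y level_measure F y)%E.
Proof.
move=> mF F0.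
under [RHS]eq_integral => y _ do rewrite level_measureE//.
rewrite -(@fubini_tonelli _ _ (measurableTypeR R) (measurableTypeR R) R mu mu _ (measurable_under_graph mF) (under_graph_ge0 F)).
apply: eq_integral => x _; transitivity (\int[mu]_y (\1_(`]0%R, F x[%classic : set R) y)%:E)%E.
  rewrite integral_indic//= setIT lebesgue_measure_itv/= lte_fin.
  by case: ltP => [_|Fx]; [rewrite sube0|congr EFin; apply/eqP; rewrite eq_le F0 Fx].
apply: eq_integral => y _; rewrite /under_graph indicE/=; case: ifP => H.
  by rewrite mem_set//= in_itv.
by rewrite memNset//= in_itv/= H.
Qed.

End brunn_minkowski.

Section prekopa.
Context {R : realType}.
Notation mu := lebesgue_measure.
Implicit Types (w : R -> R) (s x y : R).

(** The infima m0 and m1 normalise exp (- w0) and exp (- w1) to supremum 1, so at each level y < 1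
    both superlevel sets are nonempty and Brunn-Minkowski applies, while for y >= 1 both are empty.
    Level by level this yields an arithmetic mean on the left. *)
Lemma prekopa s w0 w1 w : 0 < s -> s < 1 -> cvxR w0 -> cvxR w1 -> cvxR w ->
  (forall x y, w (s * x + (1 - s) * y) <= s * w0 x + (1 - s) * w1 y) ->
  (exists C, forall x, C <= w0 x) -> (exists C, forall x, C <= w1 x) ->
  exists m0 m1, (s%:E * \int[mu]_x (expR (m0 - w0 x))%:E + (1 - s)%:E * \int[mu]_x (expR (m1 - w1 x))%:E
     <= \int[mu]_x (expR (s * m0 + (1 - s) * m1 - w x))%:E)%E.
Proof.
move=> s0 s1 cw0 cw1 cw H [C0 HC0] [C1 HC1].
have hasinf (u : R -> R) C : (forall x, C <= u x) -> has_inf (range u).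
  by move=> HC; split; [exists (u 0), 0|exists C => _ [x _ <-]].
pose m0 := inf (range w0); pose m1 := inf (range w1).
have h0 := hasinf _ _ HC0; have h1 := hasinf _ _ HC1.
have m0le x : m0 <= w0 x by apply: ge_inf; [exact: h0.2|exists x].
have m1le x : m1 <= w1 x by apply: ge_inf; [exact: h1.2|exists x].
exists m0, m1; set m := s * m0 + (1 - s) * m1.
have mF (u : R -> R) c : cvxR u -> measurable_fun setT (fun x => expR (c - u x)).
  move=> cu; apply: continuous_measurable_fun => x; apply: continuous_comp; last exact: continuous_expR.
  by apply: cvgB; [exact: cvg_cst|exact: cvxR_continuous].
have F0 (u : R -> R) c (x : R) : 0 <= expR (c - u x) by exact: expR_ge0.
rewrite (layer_cake (mF _ _ cw0) (F0 _ _)) (layer_cake (mF _ _ cw1) (F0 _ _)) (layer_cake (mF _ _ cw) (F0 _ _)).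
have L0 := level_measure_ge0; have mL u c cu := measurable_level_measure (mF u c cu).
have Z (u : R -> R) c k : 0 <= k -> cvxR u ->
    (k%:E * \int[mu]_y level_measure (fun x => expR (c - u x)) y =
     \int[mu]_y (k%:E * level_measure (fun x => expR (c - u x)) y))%E.
  by move=> k0 cu; rewrite ge0_integralZl//; exact: mL.
have M (u : R -> R) c k : cvxR u ->
    measurable_fun [set: measurableTypeR R] (fun y => (k%:E * level_measure (fun x => expR (c - u x)) y)%E).
  by move=> cu; apply: measurable_funeM; exact: mL.
rewrite (Z _ _ _ (ltW s0) cw0) (Z w1) ?subr_ge0 ?(ltW s1)// -ge0_integralD//; first last.
- exact: M.
- by move=> x _; rewrite mule_ge0// lee_fin subr_ge0 ltW.
- exact: M.
- by move=> x _; rewrite mule_ge0// lee_fin ltW.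
apply: ge0_le_integral => //.
- by move=> x _; rewrite adde_ge0// mule_ge0// lee_fin ?subr_ge0 ltW.
- by apply: emeasurable_funD; exact: M.
- exact: mL.
move=> y _; rewrite /level_measure; case: ifP => y0; last by rewrite !mule0 adde0.
have superE (u : R -> R) c (x : R) : (y < expR (c - u x)) = (u x < c - ln y).
  by rewrite -{1}(lnK y0) ltr_expR ltrBrDr addrC -ltrBrDr.
have [y1|y1] := leP 1 y.
  have empty (u : R -> R) (c : R) : (forall x, c <= u x) -> mu [set x : R | y < expR (c - u x)] = 0%E.
    move=> cu; suff -> : [set x : R | y < expR (c - u x)] = set0 by exact: measure0.
    apply/seteqP; split => x //=; rewrite superE => ux.
    by have := cu x; have := ln_ge0 y1; lra.
  by rewrite (empty w0 _ m0le) (empty w1 _ m1le) !mule0 adde0; exact: measure_ge0.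
have lny : ln y < 0 by rewrite -ln1 ltr_ln ?posrE.
have nonempty (u : R -> R) C : (forall x, C <= u x) -> [set x : R | y < expR (inf (range u) - u x)] !=set0.
  move=> HC; have ly : 0 < - ln y by lra.
  have [_ [x _ <-] Hx] := inf_adherent ly (hasinf _ _ HC).
  by exists x => /=; rewrite superE.
apply: (brunn_minkowski s0 s1).
- by apply: measurable_superlevel; exact: mF.
- by apply: measurable_superlevel; exact: mF.
- by apply: measurable_superlevel; exact: mF.
- exact: nonempty HC0.
- exact: nonempty HC1.
- move=> p q /=; rewrite !superE => wp wq z /andP[pz zq] /=; rewrite superE.
  have := cvxR_between (l := Num.max (w p) (w q)) cw pz zq; rewrite !le_max !lexx orbT => /(_ isT isT).
  by case/orP => ?; lra.
- move=> x x' /=; rewrite !superE => h2 h3; have := H x x'; rewrite /m.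
  have s1' : 0 < 1 - s by lra.
  have : s * w0 x < s * (m0 - ln y) by rewrite ltr_pM2l.
  have : (1 - s) * w1 x' < (1 - s) * (m1 - ln y) by rewrite ltr_pM2l.
  by lra.
Qed.

End prekopa.

(** * Convex functions on R^n and their Gaussian averages *)

Section convex_row.
Context {R : realType} {n : nat}.
Implicit Types (V : 'rV[R]_n -> R) (x y b : 'rV[R]_n) (t s : R).
Notation mu := lebesgue_measure.

Definition cvxV V := forall t x y, 0 <= t -> t <= 1 ->
  V (t *: x + (1 - t) *: y) <= t * V x + (1 - t) * V y.

Lemma convex_function_cvxV V : convex_function setT V -> cvxV V.
Proof.
move=> cV t x y t0 t1; have := cV (Itv01 t0 t1) x y.
by rewrite !inE => /(_ I I); rewrite !convRE.
Qed.

Lemma cvxV_line V y b : cvxV V -> cvxR (fun t => V (y + t *: b)).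
Proof.
move=> cV t p q t0 t1; have := cV t (y + p *: b) (y + q *: b) t0 t1.
congr (V _ <= _); rewrite !scalerDr addrACA -scalerDl [t + _]addrC subrK scale1r.
by rewrite !scalerA -scalerDl.
Qed.

(** An upper bound for D h = V (x + h) - V x comes from continuity along the coordinate axes, by
    induction over coordinates with [half]. The lower bound follows from 0 = D 0 <= (D h + D (- h))
    / 2. *)
Lemma cvxV_continuous V : cvxV V -> continuous V.
Proof.
move=> cV x; pose D (h : 'rV[R]_n) : R := V ((x : 'rV[R]_n) + h) - V x.
have D0 : D 0 = 0 by rewrite /D addr0 subrr.
have half (a c : 'rV[R]_n) : D (a + c) <= 2^-1 * D (2 *: a) + 2^-1 * D (2 *: c).
  have h2 : 0 <= 2^-1 :> R by [].
  have h21 : 2^-1 <= 1 :> R by rewrite invf_le1// ler1n.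
  have := cV 2^-1 (x + 2 *: a) (x + 2 *: c) h2 h21.
  have -> : 1 - 2^-1 = 2^-1 :> R by field.
  have -> : 2^-1 *: (x + 2 *: a) + 2^-1 *: (x + 2 *: c) = x + (a + c).
    rewrite !scalerDr !scalerA mulVf// !scale1r addrACA -scalerDl.
    by rewrite (_ : 2^-1 + 2^-1 = 1 :> R) ?scale1r//; field.
  by rewrite /D; lra.
have line (b : 'rV[R]_n) (e : R) : 0 < e -> exists2 r, 0 < r & forall t, `|t| < r -> D (t *: b) <= e.
  move=> e0; have cL := cvxR_continuous (cvxV_line x b cV).
  have /cvgrPdist_le c0 : V (x + t *: b) @[t --> (0 : R)] --> V (x + 0 *: b) by exact: cL.
  have /nbhs_ballP[r /= r0 Hr] := c0 _ e0; exists r => // t tr.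
  have : `|V (x + 0 *: b) - V (x + t *: b)| <= e by apply: Hr; rewrite /ball/= sub0r normrN.
  by rewrite scale0r addr0 distrC => /(le_trans (ler_norm _)).
have upper (s : seq 'I_n) (e : R) : 0 < e -> exists2 r, 0 < r & forall c : 'I_n -> R,
    (forall i, `|c i| < r) -> D (\sum_(i <- s) c i *: delta_mx 0 i) <= e.
  elim: s e => [|i s IH] e e0; first by exists 1 => // c _; rewrite big_nil D0 ltW.
  have [r1 r10 H1] := line (delta_mx 0 i) e e0; have [r2 r20 H2] := IH e e0.
  exists (Num.min r1 r2 / 2); first by rewrite divr_gt0// lt_min r10.
  move=> c cr; rewrite big_cons; apply: le_trans (half _ _) _.
  have cr' j : `|2 * c j| < Num.min r1 r2.
    by have := cr j; rewrite ltr_pdivlMr// mulrC normrM ger0_norm.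
  have : D (2 *: (c i *: delta_mx 0 i)) <= e.
    by rewrite scalerA; apply: H1; have := cr' i; rewrite lt_min => /andP[].
  have : D (2 *: \sum_(j <- s) c j *: delta_mx 0 j) <= e.
    rewrite scaler_sumr; under eq_bigr => j _ do rewrite scalerA.
    by apply: H2 => j; have := cr' j; rewrite lt_min => /andP[].
  by lra.
apply/(@cvgrPdist_le _ _ _ (nbhs x) (nbhs_filter x)) => e e0.
have [r r0 Hr] := upper (index_enum 'I_n) e e0.
apply/nbhs_ballP; exists r => //= z [_ xz].
have bnd (h : 'rV[R]_n) : (forall i, `|h 0 i| < r) -> D h <= e.
  by move=> hr; rewrite (row_sum_delta h); exact: Hr.
have zr i : `|(z - x) 0 i| < r.
  by have := xz 0 i; rewrite /ball/= !mxE distrC.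
have u1 := bnd _ zr.
have u2 : D (- (z - x)) <= e by apply: bnd => i; rewrite mxE normrN.
have := half (2^-1 *: (z - x)) (2^-1 *: (- (z - x))).
rewrite -scalerDr subrr scaler0 D0 !scalerA divff// !scale1r.
have : D (z - x) = V z - V x by rewrite /D addrCA subrr addr0.
by move=> E h; rewrite ler_norml; apply/andP; split; lra.
Qed.

End convex_row.

Section gauss_average.
Context {R : realType} {n : nat}.
Implicit Types (V : 'rV[R]_n -> R) (x y b : 'rV[R]_n) (t s : R).
Notation mu := lebesgue_measure.

Lemma cvxR_expR : cvxR (@expR R).
Proof.
move=> t x y t0 t1; set c := t * x + (1 - t) * y.
have key z : expR c * (1 + (z - c)) <= expR z.
  have -> : expR z = expR c * expR (z - c) by rewrite -expRD; congr expR; ring.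
  by rewrite ler_wpM2l ?expR_ge0 ?expR_ge1Dx.
have hx := key x; have hy := key y.
have : t * (expR c * (1 + (x - c))) <= t * expR x by rewrite ler_wpM2l.
have : (1 - t) * (expR c * (1 + (y - c))) <= (1 - t) * expR y by rewrite ler_wpM2l// subr_ge0.
have E : t * (expR c * (1 + (x - c))) + (1 - t) * (expR c * (1 + (y - c))) = expR c.
  move: (expR c) => e; rewrite /c; ring.
by move=> h1 h2; rewrite -[leLHS]E; exact: lerD.
Qed.

Lemma tilt_integral_gt0 (U : R -> R) : cvxR U -> (0 < \int[mu]_t (tilt U t)%:E)%E.
Proof.
move=> cU; pose M := Num.max (U 0) (U 1); pose c := phi 1 * expR (- M).
have c0 : 0 < c by rewrite mulr_gt0 ?phi_gt0 ?expR_gt0.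
apply: (@lt_le_trans _ _ (\int[mu]_t (c * \1_(`[0%R, 1%R]%classic : set R) t)%:E)%E).
  under eq_integral => t _ do rewrite EFinM.
  rewrite ge0_integralZl//; last 2 first.
  - by apply/measurable_EFinP; apply: measurable_indic; exact: measurable_itv.
  - by rewrite lee_fin ltW.
  rewrite integral_indic//= setIT lebesgue_measure_itv/= lte_fin ltr01 sube0 mule1.
  by rewrite lte_fin.
apply: ge0_le_integral => //.
- by move=> t _; rewrite lee_fin mulr_ge0// ltW.
- apply/measurable_EFinP; apply: measurable_funM => //; apply: measurable_indic; exact: measurable_itv.
- apply/measurable_EFinP; exact: measurable_tilt.
move=> t _; rewrite lee_fin indicE; have [|tn] := boolP (t \in _); last by rewrite mulr0 ltW// tilt_gt0.
rewrite mem_setE in_itv/= mulr1 => /andP[t0 t1]; rewrite /c /tilt.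
apply: ler_pM; rewrite ?expR_ge0 ?(ltW (phi_gt0 _))//.
  by rewrite /phi ler_wpM2l ?(ltW sqrt2pi_gt0)// ler_expR lerN2 ler_pM2r// ler_sqr ?nnegrE//; lra.
by rewrite ler_expR lerN2; apply: (cvxR_between cU t0 t1); rewrite /M le_max lexx ?orbT.
Qed.

Definition gauss_average V b y : R := - ln (fine (\int[mu]_t (tilt (fun t => V (y + t *: b)) t)%:E)%E).

Lemma gauss_averageE V b y : cvxV V ->
  (\int[mu]_t (tilt (fun t => V (y + t *: b)) t)%:E = (expR (- gauss_average V b y))%:E)%E.
Proof.
move=> cV; have cU := cvxV_line y b cV; have := tilt_integral_gt0 cU.
have := tilt_moment cU 0; under eq_integral => t _ do rewrite expr0 mul1r.
rewrite /gauss_average opprK; set I := (\int[mu]_t _)%E => Ifin I0.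
have If : I \is a fin_num by rewrite ge0_fin_numE// ltW.
by rewrite lnK ?fineK// posrE fine_gt0// I0.
Qed.

(** The Gaussian weight is absorbed as t^2 / 2 into the exponent, which stays jointly convex in y
    and t and becomes bounded below, as [prekopa] requires. The arithmetic mean there dominates the
    geometric one by convexity of exp, which removes m0 and m1. *)
Lemma gauss_average_cvx V b : cvxV V -> cvxV (gauss_average V b).
Proof.
move=> cV s y0 y1; rewrite le_eqVlt => /predU1P[<- _|s0]; first by rewrite !scale0r subr0 !scale1r !add0r mul0r mul1r add0r.
rewrite le_eqVlt => /predU1P[->|s1]; first by rewrite subrr !scale0r scale1r !addr0 mul0r mul1r addr0.
pose w y t := V (y + t *: b) + t ^+ 2 / 2.
have sq : cvxR (fun t : R => t ^+ 2 / 2).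
  move=> t x y t0 t1; have : 0 <= t * (1 - t) * (x - y) ^+ 2 by rewrite mulr_ge0 ?sqr_ge0// mulr_ge0// subr_ge0.
  by lra.
have cw y : cvxR (w y).
  move=> t p q t0 t1; have := sq t p q t0 t1; have := cvxV_line y b cV p q t0 t1.
  by rewrite /w; lra.
have wlb y : exists C, forall t, C <= w y t.
  have [k k0 Hk] := cvxR_linear_lower (cvxV_line y b cV).
  exists (V (y + 0 *: b) - k ^+ 2 / 2) => t; rewrite /w; have := Hk t; have := sqr_ge0 (`|t| - k).
  by rewrite -(real_normK (num_real t)); lra.
have H p q : w (s *: y0 + (1 - s) *: y1) (s * p + (1 - s) * q) <= s * w y0 p + (1 - s) * w y1 q.
  have := cV s (y0 + p *: b) (y1 + q *: b) (ltW s0) (ltW s1); have := sq s p q (ltW s0) (ltW s1).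
  have -> : s *: (y0 + p *: b) + (1 - s) *: (y1 + q *: b) = s *: y0 + (1 - s) *: y1 + (s * p + (1 - s) * q) *: b.
    by rewrite !scalerDr addrACA !scalerA -scalerDl.
  by rewrite /w; lra.
have [m0 [m1]] := prekopa s0 s1 (cw y0) (cw y1) (cw _) H (wlb y0) (wlb y1).
pose c2 : R := Num.sqrt (2 * pi).
have c20 : 0 < c2 by rewrite sqrtr_gt0 mulr_gt0// pi_gt0.
have IE m y : (\int[mu]_t (expR (m - w y t))%:E = (c2 * expR (m - gauss_average V b y))%:E)%E.
  transitivity (\int[mu]_t ((c2 * expR m)%:E * (tilt (fun t => V (y + t *: b)) t)%:E))%E.
    apply: eq_integral => t _; rewrite -EFinM; congr EFin.
    rewrite /tilt /phi -/c2 /w -[RHS]mulrA [c2 * _]mulrC.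
    have -> : m - (V (y + t *: b) + t ^+ 2 / 2) = m + (- (t ^+ 2 / 2) + - V (y + t *: b)) by ring.
    by rewrite !expRD; field; rewrite gt_eqF.
  rewrite ge0_integralZl//; last 3 first.
  - by apply/measurable_EFinP; apply: measurable_tilt; exact: cvxV_line.
  - by move=> t _; rewrite lee_fin ltW// tilt_gt0.
  - by rewrite lee_fin mulr_ge0 ?expR_ge0// ltW.
  by rewrite gauss_averageE// -EFinM -mulrA -expRD.
rewrite !IE -!EFinM -EFinD lee_fin mulrCA [_ * (c2 * expR (m1 - _))]mulrCA -mulrDr ler_pM2l//.
move: (gauss_average V b y0) (gauss_average V b y1) (gauss_average V b (s *: y0 + (1 - s) *: y1)) => g0 g1 g h.
have h' := cvxR_expR (m0 - g0) (m1 - g1) (ltW s0) (ltW s1).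
have h2 : s * (m0 - g0) + (1 - s) * (m1 - g1) <= s * m0 + (1 - s) * m1 - g.
  by rewrite -ler_expR; exact: (le_trans h' h).
clear -h2; lra.
Qed.

End gauss_average.

(** * Borel laws on R^n determined by cosines of linear forms *)

Section borel_rV.
Context {R : realType} {n : nat}.
Implicit Types (u y : 'rV[R]_n) (A O : set 'rV[R]_n).

Lemma open_rV_measurable O : open O -> measurable O.
Proof. exact: sub_sigma_algebra. Qed.

Lemma continuous_rV_measurable (V : 'rV[R]_n -> R) : continuous V -> measurable_fun setT V.
Proof.
move=> /continuousP cV; apply: (measurability _ (RGenOpens.measurableE R)).
move=> _ [_ [a [b ->] <-]]; rewrite setTI; apply: open_rV_measurable.
exact/cV/interval_open.
Qed.

Lemma coord_continuous_rV (i : 'I_n) : continuous (fun y : 'rV[R]_n => y ord0 i).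
Proof. exact: coord_continuous. Qed.

Lemma dotDr u y z : dot u (y + z) = dot u y + dot u z.
Proof. by rewrite /dot -big_split; apply: eq_bigr => i _; rewrite mxE mulrDr. Qed.

Lemma dotZr u (a : R) y : dot u (a *: y) = a * dot u y.
Proof. by rewrite /dot mulr_sumr; apply: eq_bigr => i _; rewrite mxE mulrCA. Qed.

Lemma dotC u y : dot u y = dot y u.
Proof. by rewrite /dot; apply: eq_bigr => i _; rewrite mulrC. Qed.

Lemma dotDl u y z : dot (u + y) z = dot u z + dot y z.
Proof. by rewrite dotC dotDr !(dotC z). Qed.

Lemma dotZl u (a : R) y : dot (a *: u) y = a * dot u y.
Proof. by rewrite dotC dotZr dotC. Qed.

Lemma dot_delta (i : 'I_n) y : dot (delta_mx ord0 i) y = y ord0 i.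
Proof.
rewrite /dot (bigD1 i)//= mxE !eqxx mul1r big1 ?addr0// => j ji.
by rewrite mxE (negbTE ji) andbF mul0r.
Qed.

Lemma dot_continuous u : continuous (dot u).
Proof. by apply: cvxV_continuous => t x y _ _; rewrite dotDr !dotZr. Qed.

Lemma measurable_dot u : measurable_fun setT (dot u).
Proof. apply: continuous_rV_measurable; exact: dot_continuous. Qed.

Definition rat_box (pq : 'rV[rat]_n * 'rV[rat]_n) : set 'rV[R]_n :=
  [set y | forall i, ratr (pq.1 ord0 i) < y ord0 i < ratr (pq.2 ord0 i)].

Lemma open_rat_boxes O : open O ->
  O = \bigcup_(pq in [set: 'rV[rat]_n * 'rV[rat]_n]) (if pselect (rat_box pq `<=` O) then rat_box pq else set0).
Proof.
move=> oO; apply/seteqP; split => [y Oy|y [pq _]]; last by case: pselect => [sub /sub|_ []].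
have /nbhs_ballP[r /= r0 Br] : nbhs y O by exact: open_nbhs_nbhs.
have P i : exists q : rat * rat, [/\ y ord0 i - r < ratr q.1, ratr q.1 < y ord0 i, y ord0 i < ratr q.2 & ratr q.2 < y ord0 i + r].
  have [|q1] := @rat_in_itvoo R (y ord0 i - r) (y ord0 i); first by lra.
  rewrite /= in_itv/= => /andP[h1 h2].
  have [|q2] := @rat_in_itvoo R (y ord0 i) (y ord0 i + r); first by lra.
  by rewrite /= in_itv/= => /andP[h3 h4]; exists (q1, q2).
have [q Hq] := choice P.
have By : rat_box (\row_i (q i).1, \row_i (q i).2) y.
  by move=> i; rewrite !mxE; have [_ -> -> _] := Hq i.
exists (\row_i (q i).1, \row_i (q i).2) => //; case: pselect => // H; exfalso; apply: H => z Bz.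
apply: Br; split => // i j; rewrite (ord1 i) /ball/= ltr_norml.
have := Bz j; rewrite !mxE/=; have [h1 h2 h3 h4] := Hq j => /andP[h5 h6].
by apply/andP; split; lra.
Qed.

Lemma measurable_coords d (T : measurableType d) (f : T -> 'rV[R]_n) :
  (forall i, measurable_fun setT (fun t => f t ord0 i)) -> measurable_fun setT f.
Proof.
move=> mf; apply: (@measurability _ _ _ _ setT f (open : set (set 'rV[R]_n)) erefl).
move=> B [A oA <-]; rewrite setTI (open_rat_boxes oA) preimage_bigcup.
apply: countable_bigcupT_measurable => // pq; case: pselect => [sub|nsub]; last by rewrite preimage_set0.
have -> : f @^-1` rat_box pq = \bigcap_(i in [set: 'I_n]) ((fun t => f t ord0 i) @^-1` `]ratr (pq.1 ord0 i), ratr (pq.2 ord0 i)[).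
  apply/seteqP; split => [t Bt i _ /=|t Bt i]; first by rewrite in_itv; exact: Bt.
  by have := Bt i I; rewrite /= in_itv.
apply: fin_bigcap_measurable => // i _; rewrite -[X in measurable X]setTI.
by apply: mf => //; exact: measurable_itv.
Qed.

Definition half_spaces (s : seq ('rV[R]_n * R)) : set 'rV[R]_n :=
  [set y | forall p, p \in s -> dot p.1 y < p.2].

(** Finite intersections of open half-spaces form a pi-system, and they generate the Borel sets
    because rational boxes are among them. *)
Lemma half_spaces_unique (P Q : probability 'rV[R]_n R) :
  (forall s, P (half_spaces s) = Q (half_spaces s)) -> forall A, measurable A -> P A = Q A.
Proof.
move=> PQ A mA; pose G := range half_spaces.
have GI : setI_closed G.
  move=> _ _ [s _ <-] [t _ <-]; exists (s ++ t) => //; apply/seteqP; split => y /=.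
    move=> H; split => p ps; apply: H; rewrite mem_cat ps ?orbT//.
  by move=> [H1 H2] p; rewrite mem_cat => /orP[/H1|/H2].
have mG : (measurable : set (set 'rV[R]_n)) = <<s G >>.
  apply/seteqP; split; last first.
    apply: smallest_sub; first exact: sigma_algebra_measurable.
    move=> _ [s _ <-].
    have -> : half_spaces s = \bigcap_(p in [set` s]) (dot p.1 @^-1` `]-oo, p.2[).
      apply/seteqP; split => y H p /= ps; first by rewrite in_itv/=; exact: H.
      by have := H p ps; rewrite /= in_itv.
    apply: fin_bigcap_measurable; first exact: finite_seq.
    move=> p _; rewrite -[X in measurable X]setTI; apply: measurable_dot => //; exact: measurable_itv.
  apply: smallest_sub; first exact: smallest_sigma_algebra.
  move=> O oO; rewrite (open_rat_boxes oO).
  pose gT := g_sigma_algebraType G.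
  apply: (@countable_bigcupT_measurable _ gT) => // pq; case: pselect => [sub|nsub]; last exact: measurable0.
  apply: sub_sigma_algebra.
  exists ([seq (delta_mx ord0 i, ratr (pq.2 ord0 i)) | i <- enum 'I_n] ++
      [seq (- delta_mx ord0 i, - ratr (pq.1 ord0 i)) | i <- enum 'I_n]) => //.
  have dN i y : dot (- delta_mx ord0 i) y = - y ord0 i.
    by rewrite -scaleN1r dotZl dot_delta mulN1r.
  apply/seteqP; split => y /= H.
    move=> i; have /(_ _)h1 := H (delta_mx ord0 i, ratr (pq.2 ord0 i)).
    have /(_ _)h2 := H (- delta_mx ord0 i, - ratr (pq.1 ord0 i)).
    have ei : i \in enum 'I_n by rewrite mem_enum.
    rewrite -ltrN2 -dN h2 ?mem_cat; last by apply/orP; right; apply: map_f.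
    by rewrite -dot_delta h1// mem_cat; apply/orP; left; apply: map_f.
  move=> p; rewrite mem_cat => /orP[/mapP[i _ ->]|/mapP[i _ ->]] /=.
    by rewrite dot_delta; case/andP: (H i).
  by rewrite dN ltrN2; case/andP: (H i).
apply: (@measure_unique _ R _ G (fun=> setT)) => //.
- by move=> _; exists [::] => //; apply/seteqP; split => // y _ p.
- by rewrite bigcup_const//; exists 0%N.
- by move=> _ [s _ <-]; exact: PQ.
- by move=> _ /=; rewrite (@probability_setT _ _ R P) ltry.
Qed.

End borel_rV.

Section power_limits.
Context {R : realType}.
Implicit Types (x s t : R) (k m : nat).

Lemma bernoulli_ge x m : 0 <= x -> x <= 1 -> 1 - m%:R * x <= (1 - x) ^+ m.
Proof.
move=> x0 x1; elim: m => [|m IH]; first by rewrite mul0r subr0 expr0.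
rewrite exprS; have : (1 - x) * (1 - m%:R * x) <= (1 - x) * (1 - x) ^+ m by rewrite ler_wpM2l// subr_ge0.
have : 0 <= m%:R * x ^+ 2 :> R by rewrite mulr_ge0 ?ler0n ?sqr_ge0.
by rewrite -[in m.+1%:R]addn1 natrD; lra.
Qed.

Lemma bernoulli_le x m : 0 <= x -> x <= 1 -> (1 - x) ^+ m * (1 + m%:R * x) <= 1.
Proof.
move=> x0 x1; elim: m => [|m IH]; first by rewrite mul0r addr0 expr0 mulr1.
apply: le_trans IH; rewrite exprSr -mulrA ler_wpM2l ?exprn_ge0 ?subr_ge0//.
have : 0 <= m%:R * x ^+ 2 :> R by rewrite mulr_ge0 ?ler0n ?sqr_ge0.
by rewrite -[in m.+1%:R]addn1 natrD; have := sqr_ge0 x; lra.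
Qed.

Lemma cvg_neq0_indicator s : -1 <= s -> s <= 1 -> (1 - (1 - s ^+ 2) ^+ k) @[k --> \oo] --> (if s == 0 then 0 else 1 : R).
Proof.
move=> s1 s2; case: eqVneq => [->|s0].
  rewrite expr0n/= subr0; under eq_fun do rewrite expr1n subrr; exact: cvg_cst.
have s20 : 0 < s ^+ 2 by rewrite exprn_even_gt0.
have sle : s ^+ 2 <= 1 by nra.
rewrite -[X in _ --> X]subr0; apply: cvgB; first exact: cvg_cst.
by apply: cvg_expr; rewrite ger0_norm; lra.
Qed.

(** Polynomials in s approximating a step. With t = (1 + s) / 2, the number 2^k t^k = (1 + s)^k
    tends to 0 or to infinity according to the sign of s, and Bernoulli's inequality transfers this
    to (1 - t^k)^(2^k). *)
Lemma cvg_neg_indicator s : -1 <= s -> s <= 1 -> s != 0 ->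
  (1 - ((1 + s) / 2) ^+ k) ^+ (2 ^ k) @[k --> \oo] --> (if s < 0 then 1 else 0 : R).
Proof.
move=> s1 s2 s0; set t := (1 + s) / 2.
have t0 : 0 <= t by rewrite /t; lra.
have t1 : t <= 1 by rewrite /t; lra.
have tk0 k : 0 <= t ^+ k by rewrite exprn_ge0.
have tk1 k : t ^+ k <= 1 by rewrite exprn_ile1.
have pE k : (2 ^ k)%N%:R * t ^+ k = (2 * t) ^+ k :> R by rewrite natrX [RHS](exprMn k 2 t).
have le1 k : (1 - t ^+ k) ^+ (2 ^ k) <= 1 by rewrite exprn_ile1// ?subr_ge0// gerBl.
have ge0 k : 0 <= (1 - t ^+ k) ^+ (2 ^ k) by rewrite exprn_ge0// subr_ge0.
have [sneg|spos] := ltP s 0.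
  have h : (1 - (2 * t) ^+ k) @[k --> \oo] --> (1 - 0 : R).
    apply: cvgB; first exact: cvg_cst.
    by apply: cvg_expr; rewrite ger0_norm /t; lra.
  rewrite subr0 in h; apply: (@squeeze_cvgr _ _ _ _ (fun k => 1 - (2 * t) ^+ k) (cst 1)) => //; last exact: cvg_cst.
  by apply: nearW => k; rewrite le1 andbT -pE bernoulli_ge.
have {}spos : 0 < s by rewrite lt_neqAle eq_sym s0.
have u1 : 1 < 2 * t by rewrite /t; lra.
have u0 : 0 < 2 * t by lra.
apply: (@squeeze_cvgr _ _ _ _ (cst 0) (fun k => (2 * t)^-1 ^+ k)); last 2 first.
- exact: cvg_cst.
- by apply: cvg_expr; rewrite ger0_norm ?invr_ge0 ?(ltW u0)// invf_lt1.
apply: nearW => k; rewrite ge0/= exprVn.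
have := bernoulli_le (2 ^ k) (tk0 k) (tk1 k); rewrite pE => h.
have p0 : 0 < (2 * t) ^+ k by rewrite exprn_gt0.
rewrite -[leRHS]mul1r ler_pdivlMr//; apply: le_trans h; rewrite ler_wpM2l// lerDr//.
Qed.

End power_limits.

Section cosine_class.
Context {R : realType} {n : nat} (P Q : probability 'rV[R]_n R).
Hypothesis PQ : forall u c, (\int[P]_y cos (dot u y + c) = \int[Q]_y cos (dot u y + c))%R.
Implicit Types (g h : 'rV[R]_n -> R) (u w : 'rV[R]_n).

(** The cosine factor makes the class stable under multiplication by sines, which equality of the
    plain integrals of g would not be; with bounded limits this leads to products of indicators. *)
Definition cosine_class g := [/\ measurable_fun setT g, exists M, forall y, `|g y| <= M &
  forall u c, (\int[P]_y (g y * cos (dot u y + c)) = \int[Q]_y (g y * cos (dot u y + c)))%R].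

Lemma measurable_dot_comp (F : R -> R) u c : continuous F -> measurable_fun setT (fun y : 'rV[R]_n => F (dot u y + c)).
Proof.
move=> cF; apply: (@measurableT_comp _ _ _ _ _ _ F); first exact: continuous_measurable_fun.
by apply: measurable_funD => //; exact: measurable_dot.
Qed.

Let intg (S : probability 'rV[R]_n R) g M : measurable_fun setT g -> (forall y, `|g y| <= M) ->
  S.-integrable setT (EFin \o g).
Proof.
move=> mg gM; apply: measurable_bounded_integrable => //.
  by rewrite /= (@probability_setT _ _ R S) ltry.
exists M; split; first exact: num_real.
by move=> D CD x _; exact: le_trans (gM x) (ltW CD).
Qed.

Let cos1 z : `|cos z : R| <= 1. Proof. by rewrite ler_norml cos_geN1 cos_le1. Qed.

Let mgcos g u c : measurable_fun setT g -> measurable_fun setT (fun y => g y * cos (dot u y + c)).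
Proof. by move=> mg; apply: measurable_funM => //; apply: measurable_dot_comp; exact: continuous_cos. Qed.

Let bgcos g M u c : (forall y, `|g y| <= M) -> forall y, `|g y * cos (dot u y + c)| <= M.
Proof. by move=> gM y; rewrite normrM (le_trans _ (gM y))// ler_piMr. Qed.

Lemma cosine_class1 : cosine_class (fun=> 1).
Proof.
split => [//||u c]; first by exists 1 => y; rewrite normr1.
by under eq_Rintegral => y _ do rewrite mul1r; rewrite PQ; under [RHS]eq_Rintegral => y _ do rewrite mul1r.
Qed.

Lemma cosine_class_lin a b g h : cosine_class g -> cosine_class h -> cosine_class (fun y => a * g y + b * h y).
Proof.
move=> [mg [M gM] Hg] [mh [N hN] Hh]; split.
- by apply: measurable_funD; apply: measurable_funM.
- exists (`|a| * M + `|b| * N) => y; apply: le_trans (ler_normD _ _) _.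
  by rewrite !normrM lerD// ler_wpM2l.
move=> u c; have key (S : probability 'rV[R]_n R) :
    (\int[S]_y ((a * g y + b * h y) * cos (dot u y + c)) =
     a * \int[S]_y (g y * cos (dot u y + c)) + b * \int[S]_y (h y * cos (dot u y + c)))%R.
  have ig := intg S (mgcos u c mg) (bgcos u c gM); have ih := intg S (mgcos u c mh) (bgcos u c hN).
  rewrite -!RintegralZl// -RintegralD//; last 2 first.
  - by have := integrableZl measurableT a ig; apply: eq_integrable.
  - by have := integrableZl measurableT b ih; apply: eq_integrable.
  by apply: eq_Rintegral => y _; ring.
by rewrite !key Hg Hh.
Qed.

(** Product-to-sum formula; the resulting sines are cosines shifted by pi / 2. *)
Lemma cosine_class_sin g w b : cosine_class g -> cosine_class (fun y => g y * sin (dot w y + b)).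
Proof.
move=> [mg [M gM] Hg]; split.
- by apply: measurable_funM => //; apply: measurable_dot_comp; exact: continuous_sin.
- exists M => y; rewrite normrM (le_trans _ (gM y))// ler_piMr//.
  by rewrite ler_norml sin_geN1 sin_le1.
move=> u c; have key (S : probability 'rV[R]_n R) :
    (\int[S]_y (g y * sin (dot w y + b) * cos (dot u y + c)) =
     2^-1 * \int[S]_y (g y * cos (dot (w + u) y + (b + c - pi / 2)))
     + 2^-1 * \int[S]_y (g y * cos (dot (w - u) y + (b - c - pi / 2))))%R.
  have i1 := intg S (mgcos (w + u) (b + c - pi / 2) mg) (bgcos (w + u) (b + c - pi / 2) gM).
  have i2 := intg S (mgcos (w - u) (b - c - pi / 2) mg) (bgcos (w - u) (b - c - pi / 2) gM).
  rewrite -!RintegralZl// -RintegralD//; last 2 first.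
  - by have := integrableZl measurableT 2^-1 i1; apply: eq_integrable.
  - by have := integrableZl measurableT 2^-1 i2; apply: eq_integrable.
  apply: eq_Rintegral => y _.
  have cs z : cos (z - pi / 2) = sin z :> R by rewrite cosB cos_pihalf sin_pihalf mulr0 add0r mulr1.
  have -> : dot (w + u) y + (b + c - pi / 2) = (dot w y + b) + (dot u y + c) - pi / 2 by rewrite dotDl; ring.
  have -> : dot (w - u) y + (b - c - pi / 2) = (dot w y + b) - (dot u y + c) - pi / 2.
    by rewrite dotDl -scaleN1r dotZl; ring.
  by rewrite !cs; move: (dot w y + b) (dot u y + c) => A B; rewrite sinD sinB; field.
by rewrite !key !Hg.
Qed.

Lemma cosine_class_lim (f : ('rV[R]_n -> R)^nat) g M : (forall k, cosine_class (f k)) ->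
  (forall k y, `|f k y| <= M) -> (forall y, f k y @[k --> \oo] --> g y) -> cosine_class g.
Proof.
move=> Cf fM fg.
have mfk k : measurable_fun setT (f k) by case: (Cf k).
have mg : measurable_fun setT g by apply: (measurable_fun_cvg (h := f)) => // y _; exact: fg.
have gM y : `|g y| <= M.
  have h : `|f k y| @[k --> \oo] --> `|g y| by apply: cvg_norm; exact: fg.
  by apply: (cvgr_to_le h); apply: nearW => k; exact: fM.
split => //; first by exists M.
move=> u c; have key (S : probability 'rV[R]_n R) :
    (\int[S]_y (f k y * cos (dot u y + c))%:E)%E @[k --> \oo] --> (\int[S]_y (g y * cos (dot u y + c))%:E)%E.
  have iM : S.-integrable setT (EFin \o (fun=> M : R)).
    by have := finite_measure_integrable_cst S M measurableT.
  have [] // := @dominated_convergence _ _ R S setT measurableT (fun k y => (f k y * cos (dot u y + c))%:E)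
    (fun y => (g y * cos (dot u y + c))%:E) _
    (fun k => (measurable_EFinP _ _).2 (mgcos u c (mfk k))) ((measurable_EFinP _ _).2 (mgcos u c mg)) (aeW _ _) iM (aeW _ _).
    move=> y _; apply: cvg_EFin; first exact: nearW.
    by apply: cvgM; [exact: fg|exact: cvg_cst].
  by move=> y k _ /=; rewrite lee_fin; exact: (bgcos u c (fM k)).
have EQ k : (\int[P]_y (f k y * cos (dot u y + c))%:E = \int[Q]_y (f k y * cos (dot u y + c))%:E)%E.
  have [_ _ Hk] := Cf k; have := Hk u c; rewrite /Rintegral => H.
  have i (S : probability 'rV[R]_n R) := integrable_fin_num measurableT (intg S (mgcos u c (mfk k)) (bgcos u c (fM k))).
  by rewrite -(fineK (i P)) -(fineK (i Q)) H.
rewrite /Rintegral; congr fine; have kP := key P; have kQ := key Q.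
rewrite -(funext EQ) in kQ; apply: cvg_unique kP kQ; exact: ereal_hausdorff.
Qed.

Lemma cosine_class_ext g h : g =1 h -> cosine_class g -> cosine_class h.
Proof. by move=> /funext ->. Qed.

(** Polynomials in the sine of (dot w y - z) / (N + 1) converge to the indicator of the set where
    this sine is negative. Once N is large, the angle lies within ]-pi, pi[ and the sine has the
    sign of dot w y - z. *)
Lemma cosine_class_half_space g w z : cosine_class g -> cosine_class (fun y => g y * (if dot w y < z then 1 else 0)).
Proof.
move=> Cg; have [_ [M gM] _] := Cg.
pose s (N : nat) y : R := sin (dot (N.+1%:R^-1 *: w) y + - (z / N.+1%:R)).
have s1 N y : -1 <= s N y by exact: sin_geN1.
have s2 N y : s N y <= 1 by exact: sin_le1.
have step1 N : forall h, cosine_class h -> cosine_class (fun y => h y * s N y).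
  by move=> h Ch; exact: cosine_class_sin.
have stept N : forall h, cosine_class h -> cosine_class (fun y => h y * ((1 + s N y) / 2)).
  move=> h Ch; apply: cosine_class_ext (cosine_class_lin 2^-1 2^-1 Ch (step1 N h Ch)) => y; ring.
have pow (q : 'rV[R]_n -> R) : (forall h, cosine_class h -> cosine_class (fun y => h y * q y)) ->
    forall k h, cosine_class h -> cosine_class (fun y => h y * q y ^+ k).
  move=> Hq k h' Ch; elim: k => [|k IH]; first by apply: cosine_class_ext Ch => y; rewrite expr0 mulr1.
  by apply: cosine_class_ext (Hq _ IH) => y; rewrite exprSr mulrA.
have compl (q : 'rV[R]_n -> R) : (forall h, cosine_class h -> cosine_class (fun y => h y * q y)) ->
    forall h, cosine_class h -> cosine_class (fun y => h y * (1 - q y)).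
  by move=> Hq h Ch; apply: cosine_class_ext (cosine_class_lin 1 (-1) Ch (Hq h Ch)) => y; ring.
have bd (f : nat -> 'rV[R]_n -> R) (h : 'rV[R]_n -> R) : (forall y, `|h y| <= M) -> (forall k y, 0 <= f k y) -> (forall k y, f k y <= 1) ->
    forall k y, `|h y * f k y| <= M.
  by move=> hM f0 f1 k y; rewrite normrM (le_trans _ (hM y))// ler_piMr// ger0_norm.
have sq01 N y : 0 <= 1 - s N y ^+ 2 /\ 1 - s N y ^+ 2 <= 1.
  by have := s1 N y; have := s2 N y; have := sqr_ge0 (s N y); split; nra.
(* At s = 0 the step polynomials tend to exp (-1), so the zero set of the sine is removed first. *)
have C1 N : cosine_class (fun y => g y * (if s N y == 0 then 0 else 1)).
  apply: (@cosine_class_lim (fun k y => g y * (1 - (1 - s N y ^+ 2) ^+ k)) _ M).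
  - by move=> k; exact: (compl _ (pow _ (compl _ (pow _ (step1 N) 2)) k) g Cg).
  - apply: (bd (fun k y => 1 - (1 - s N y ^+ 2) ^+ k)) => // k y; have [h1 h2] := sq01 N y.
      by rewrite subr_ge0 exprn_ile1.
    by rewrite gerBl exprn_ge0.
  by move=> y; apply: cvgM; [exact: cvg_cst|exact: cvg_neq0_indicator].
have C2 N : cosine_class (fun y => g y * (if s N y < 0 then 1 else 0)).
  apply: (@cosine_class_lim (fun k y => (g y * (if s N y == 0 then 0 else 1)) * (1 - ((1 + s N y) / 2) ^+ k) ^+ (2 ^ k)) _ M).
  - by move=> k; exact: (pow _ (compl _ (pow _ (stept N) k)) (2 ^ k)%N _ (C1 N)).
  - apply: (bd (fun k y => (1 - ((1 + s N y) / 2) ^+ k) ^+ (2 ^ k))).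
    + move=> y; case: ifP => _; last by rewrite mulr1 gM.
      by rewrite mulr0 normr0 (le_trans _ (gM y)).
    + move=> k y; rewrite exprn_ge0// subr_ge0 exprn_ile1//; have := s1 N y; have := s2 N y; lra.
    + move=> k y; have t0 : 0 <= ((1 + s N y) / 2) ^+ k by rewrite exprn_ge0//; have := s1 N y; lra.
      have t1 : ((1 + s N y) / 2) ^+ k <= 1 by apply: exprn_ile1; have := s1 N y; have := s2 N y; lra.
      by rewrite exprn_ile1// ?subr_ge0// gerBl.
  move=> y; have [E|s0] := eqVneq (s N y) 0.
    by rewrite E ltxx mulr0; under eq_fun do rewrite mul0r; exact: cvg_cst.
  rewrite mulr1; apply: cvgM; [exact: cvg_cst|exact: cvg_neg_indicator].
apply: (@cosine_class_lim (fun N y => g y * (if s N y < 0 then 1 else 0)) _ M) => //.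
  apply: (bd (fun N y => if s N y < 0 then 1 else 0)) => // k y; case: ifP => //.
move=> y; apply: cvgM; first exact: cvg_cst.
apply: cvg_near_cst; set th := dot w y - z.
have sE N : s N y = sin (th / N.+1%:R) by rewrite /s dotZl /th; congr sin; rewrite mulrBl mulrC.
near=> N; rewrite sE -(subr_lt0 z) -/th.
have thN : `|th / N.+1%:R| < pi.
  rewrite normrM [`|_^-1|]ger0_norm// ltr_pdivrMr//.
  have b : `|th| < N.+1%:R.
    rewrite (lt_le_trans (archi_boundP (normr_ge0 th)))// ler_nat.
    by near: N; exists (Num.bound `|th|) => // N /=; exact: leqW.
  apply: lt_le_trans b _; rewrite ler_peMl//; have := @pi_ge2 R; lra.
congr (if _ then _ else _); have [th0|th0] := ltP th 0; last first.
  apply/negbTE; rewrite -leNgt sin_ge0_pi// divr_ge0//=.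
  by apply: ltW; apply: le_lt_trans thN; rewrite ler_norm.
have a : 0 < - (th / N.+1%:R) by rewrite oppr_gt0 pmulr_llt0// invr_gt0.
rewrite -[sin _]opprK -sinN oppr_lt0 sin_gt0_pi// a/=.
by apply: le_lt_trans thN; rewrite -normrN ler_norm.
Unshelve. all: end_near. Qed.

Lemma cosine_unique A : measurable A -> P A = Q A.
Proof.
apply: half_spaces_unique => s.
have C : cosine_class (fun y => \prod_(p <- s) (if dot p.1 y < p.2 then 1 else 0)).
  elim: s => [|p s IH].
    by apply: cosine_class_ext cosine_class1 => y; rewrite big_nil.
  by apply: cosine_class_ext (cosine_class_half_space p.1 p.2 IH) => y; rewrite big_cons mulrC.
have prodE y : \prod_(p <- s) (if dot p.1 y < p.2 then 1 else 0) = \1_(half_spaces s) y :> R.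
  rewrite indicE; have [/set_mem H|/negP H] := boolP (y \in half_spaces s).
    by rewrite big_seq big1// => p ps; rewrite H.
  have [p ps Hp] : exists2 p, p \in s & ~~ (dot p.1 y < p.2).
    by apply/allPn; apply/negP => /allP al; apply: H; apply/mem_set => p ps; exact: al.
  by rewrite (big_rem p)//= (negbTE Hp) mul0r.
have mH : measurable (half_spaces s).
  have -> : half_spaces s = \bigcap_(p in [set` s]) (dot p.1 @^-1` `]-oo, p.2[).
    apply/seteqP; split => y H p /= ps; first by rewrite in_itv/=; exact: H.
    by have := H p ps; rewrite /= in_itv.
  apply: fin_bigcap_measurable; first exact: finite_seq.
  move=> p _; rewrite -[X in measurable X]setTI; apply: measurable_dot => //; exact: measurable_itv.
have [_ _ /(_ 0 0) H] := C.
have key (S : probability 'rV[R]_n R) :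
    (\int[S]_y (\prod_(p <- s) (if dot p.1 y < p.2 then 1 else 0) * cos (dot 0 y + 0)))%R = fine (S (half_spaces s)).
  rewrite /Rintegral; congr fine; rewrite -[in RHS](setIT (half_spaces s)) -(integral_indic S measurableT mH).
  apply: eq_integral => y _; rewrite prodE addr0.
  have -> : dot 0 y = 0 by rewrite -(scale0r (0 : 'rV[R]_n)) dotZl mul0r.
  by rewrite cos0 mulr1.
move: H; rewrite !key => H.
by rewrite -[LHS]fineK ?fin_num_measure// H fineK// fin_num_measure.
Qed.

End cosine_class.

(** * Affine changes of variable, and sums of independent normal variables *)

Section affine_lebesgue.
Context {R : realType}.
Notation mu := lebesgue_measure.
Implicit Types (a m s t x : R).

Definition affine a m (x : measurableTypeR R) : measurableTypeR R := a * x + m.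

Lemma affine_lebesgue a m (A : set R) : a != 0 -> measurable A ->
  (mu A = `|a|%:E * mu (affine a m @^-1` A))%E.
Proof.
move=> a0 mA.
have mf : measurable_fun [set: measurableTypeR R] (affine a m) by apply: measurable_funD => //; exact: measurable_funM.
suff key p q : (mu `]p, q]%classic = `|a|%:E * mu (affine a m @^-1` `]p, q]%classic))%E.
  have := @lebesgue_measure_unique R (mscale (NngNum (normr_ge0 a)) (pushforward mu (affine a m))).
  by apply => // _ [[p q] _ <-]; exact: key.
have [an|ap|E] := ltgtP a 0; last by rewrite E eqxx in a0.
- rewrite (_ : affine a m @^-1` _ = `[(q - m) / a, (p - m) / a[%classic); last first.
    apply/seteqP; split => x /=; rewrite !in_itv/= /affine ler_ndivrMr// ltr_ndivlMr// => /andP[? ?]; apply/andP; split; nra.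
  rewrite !lebesgue_measure_itv/= !lte_fin ltr_nM2r ?invr_lt0// ltrD2r.
  by rewrite ltr0_norm//; case: ifP => _; rewrite ?mule0// -!EFinD -EFinM; congr EFin; field; rewrite lt_eqF.
- rewrite (_ : affine a m @^-1` _ = `](p - m) / a, (q - m) / a]%classic); last first.
    apply/seteqP; split => x /=; rewrite !in_itv/= /affine ltr_pdivrMr// ler_pdivlMr// => /andP[? ?]; apply/andP; split; nra.
  rewrite !lebesgue_measure_itv/= !lte_fin ltr_pM2r ?invr_gt0// ltrD2r.
  by rewrite gtr0_norm//; case: ifP => _; rewrite ?mule0// -!EFinD -EFinM; congr EFin; field; rewrite gt_eqF.
Qed.

Lemma affine_integral a m (F : R -> R) : a != 0 -> measurable_fun setT F -> (forall x, 0 <= F x) ->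
  (\int[mu]_x (F (a * x + m))%:E = (`|a|^-1)%:E * \int[mu]_x (F x)%:E)%E.
Proof.
move=> a0 mF F0; pose f := affine a m.
have mf : measurable_fun [set: measurableTypeR R] f by apply: measurable_funD => //; exact: measurable_funM.
have n0 : 0 < `|a| by rewrite normr_gt0.
rewrite (@density_integral _ _ (measurableTypeR R) (measurableTypeR R) R mu mu f (fun=> `|a|^-1) mf _ _ _ F mF F0)//.
- under eq_integral => x _ do rewrite mulrC EFinM.
  by rewrite ge0_integralZl//; [exact/measurable_EFinP|move=> x _; rewrite lee_fin].
- move=> B mB; rewrite integral_cst//; transitivity ((`|a|^-1)%:E * (`|a|%:E * mu (f @^-1` B)))%E.
    by rewrite muleA -EFinM mulVf ?gt_eqF// mul1e.
  by congr (_ * _)%E; exact/esym/affine_lebesgue.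
Qed.

End affine_lebesgue.

Section gauss_rotation.
Context {R : realType}.
Notation mu := lebesgue_measure.
Implicit Types (m s t x b : R).

Let mphi : measurable_fun setT (@phi R).
Proof. by apply: continuous_measurable_fun; exact: phi_continuous. Qed.

Let phi0 x : 0 <= phi x. Proof. exact: ltW (phi_gt0 x). Qed.

Lemma phi_integral : (\int[mu]_x (phi x : R)%:E = 1)%E.
Proof. by under eq_integral => x _ do rewrite phi_normal_pdf; exact: integral_normal_pdf. Qed.

Lemma affine_phi (F : R -> R) s m : 0 < s -> measurable_fun setT F -> (forall x, 0 <= F x) ->
  (\int[mu]_x (F (s * x + m) * phi x)%:E = \int[mu]_x (F x * (phi ((x - m) / s) / s))%:E)%E.
Proof.
move=> s0 mF F0; pose H x := F x * phi ((x - m) / s).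
have mH : measurable_fun setT H.
  apply: measurable_funM => //; apply: (measurableT_comp mphi).
  by apply: measurable_funM => //; exact: measurable_funB.
have s0' : s != 0 by rewrite gt_eqF.
have := affine_integral m s0' mH; rewrite (ger0_norm (ltW s0)) => E.
transitivity (\int[mu]_x (H (s * x + m))%:E)%E.
  by apply: eq_integral => x _; rewrite /H addrK mulrAC divff// mul1r.
rewrite E; last by move=> x; rewrite mulr_ge0.
rewrite -ge0_integralZl//; last 3 first.
- exact/measurable_EFinP.
- by move=> x _; rewrite lee_fin mulr_ge0.
- by rewrite lee_fin invr_ge0 ltW.
by apply: eq_integral => x _; rewrite -EFinM /H; congr EFin; ring.
Qed.

(** Completing the square in t: a bivariate normal density factored as the marginal in x times the
    conditional density of t. *)
Lemma phi_square s b t x : 0 < s -> phi t * (phi ((x - b * t) / s) / s) =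
  phi (x / Num.sqrt (s ^+ 2 + b ^+ 2)) / Num.sqrt (s ^+ 2 + b ^+ 2) *
  (phi ((t - b * x / (s ^+ 2 + b ^+ 2)) / (s / Num.sqrt (s ^+ 2 + b ^+ 2))) / (s / Num.sqrt (s ^+ 2 + b ^+ 2))).
Proof.
move=> s0; set D := s ^+ 2 + b ^+ 2; have D0 : 0 < D by rewrite ltr_wpDr ?sqr_ge0// exprn_gt0.
set S := Num.sqrt D; have S0 : 0 < S by rewrite sqrtr_gt0.
have SD : S ^+ 2 = D by rewrite sqr_sqrtr// ltW.
rewrite /phi; set c := (Num.sqrt (2 * pi))^-1.
have n1 : S != 0 by rewrite gt_eqF.
have n2 : s != 0 by rewrite gt_eqF.
have e1 x1 x2 y1 y2 : x1 + x2 = y1 + y2 -> c * expR x1 * (c * expR x2 / s) = c * expR y1 / S * (c * expR y2 / (s / S)).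
  move=> E; have : expR x1 * expR x2 = expR y1 * expR y2 by rewrite -!expRD E.
  by move=> h; transitivity (c ^+ 2 * (expR x1 * expR x2) / s); [field|rewrite h; field; rewrite n1 n2].
apply: e1.
have n3 : D != 0 by rewrite gt_eqF.
have -> : (x / S) ^+ 2 = x ^+ 2 / D by rewrite expr_div_n SD.
have -> : ((t - b * x / D) / (s / S)) ^+ 2 = (t - b * x / D) ^+ 2 * D / s ^+ 2 by rewrite -SD; field; rewrite n1 n2.
by rewrite /D; field; rewrite n2 -/D n3.
Qed.

(** This computes the law of s N + b N' for independent standard normals. After Tonelli,
    [phi_square] leaves a full normal density in t. The case s = 0 needs only a reflection when b <
    0. *)
Lemma gauss_rotation (F : R -> R) s b : 0 <= s -> measurable_fun setT F -> (forall x, 0 <= F x) ->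
  (\int[mu]_t ((phi t)%:E * \int[mu]_x (F (s * x + b * t) * phi x)%:E) =
   \int[mu]_x (F (Num.sqrt (s ^+ 2 + b ^+ 2) * x) * phi x)%:E)%E.
Proof.
move=> s0 mF F0.
have mFphi m a : measurable_fun setT (fun x : R => F (a * x + m) * phi x).
  apply: measurable_funM => //; apply: (measurableT_comp mF).
  by apply: measurable_funD => //; exact: measurable_funM.
move: s0; rewrite le_eqVlt => /predU1P[<-|s0].
  rewrite expr0n/= add0r sqrtr_sqr.
  transitivity (\int[mu]_t (F (b * t) * phi t)%:E)%E.
    apply: eq_integral => t _; under eq_integral => x _ do rewrite mul0r add0r EFinM.
    rewrite ge0_integralZl//; last 3 first.
    - exact/measurable_EFinP.
    - by move=> x _; rewrite lee_fin.
    - by rewrite lee_fin.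
    by rewrite phi_integral mule1 EFinM muleC.
  have [b0|b0] := leP 0 b; first by rewrite (ger0_norm b0).
  rewrite (ltr0_norm b0).
  have mH : measurable_fun setT (fun x : R => F (- b * x) * phi x).
    by have := mFphi 0 (- b); under eq_fun do rewrite addr0.
  have n1 : -1 != 0 :> R by rewrite oppr_eq0 oner_eq0.
  have := affine_integral 0 n1 mH; rewrite normrN1 invr1 mul1e => <-; last by move=> x; rewrite mulr_ge0.
  by apply: eq_integral => x _; rewrite addr0 mulN1r phiN mulrNN.
set D := s ^+ 2 + b ^+ 2; have D0 : 0 < D by rewrite ltr_wpDr ?sqr_ge0// exprn_gt0.
set S := Num.sqrt D; have S0 : 0 < S by rewrite sqrtr_gt0.
pose h (p : measurableTypeR R * measurableTypeR R) : \bar R := (phi p.1 * (F p.2 * (phi ((p.2 - b * p.1) / s) / s)))%:E.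
have mh : measurable_fun setT h.
  apply/measurable_EFinP; apply: measurable_funM.
    exact: (measurableT_comp mphi measurable_fst).
  apply: measurable_funM; first exact: (measurableT_comp mF measurable_snd).
  apply: measurable_funM => //; apply: (measurableT_comp mphi); apply: measurable_funM => //.
  apply: measurable_funB; first exact: measurable_snd.
  by apply: measurable_funM => //; exact: measurable_fst.
have h0 p : (0 <= h p)%E by rewrite lee_fin mulr_ge0// mulr_ge0// divr_ge0// ltW.
have mpart (m a : R) : measurable_fun setT (fun x : R => phi ((x - m) / a) / a).
  apply: measurable_funM => //; apply: (measurableT_comp mphi).
  by apply: measurable_funM => //; exact: measurable_funB.
transitivity (\int[mu]_t \int[mu]_x h (t, x))%E.
  apply: eq_integral => t _; rewrite affine_phi// -ge0_integralZl//.
  - by apply/measurable_EFinP; apply: measurable_funM => //; exact: mpart.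
  - by move=> x _; rewrite lee_fin mulr_ge0// divr_ge0// ltW.
  - by rewrite lee_fin.
rewrite (@fubini_tonelli _ _ (measurableTypeR R) (measurableTypeR R) R mu mu h mh h0).
transitivity (\int[mu]_x (F x * (phi ((x - 0) / S) / S))%:E)%E; last first.
  by rewrite -affine_phi//; under eq_integral => x _ do rewrite addr0.
apply: eq_integral => x _; rewrite /h/= subr0.
pose m := b * x / D; pose a := s / S; have a0 : 0 < a by rewrite divr_gt0.
transitivity (\int[mu]_t ((F x * (phi (x / S) / S))%:E * (phi ((t - m) / a) / a)%:E))%E.
  by apply: eq_integral => t _; rewrite -EFinM; congr EFin; rewrite mulrCA (phi_square b t x s0) [LHS]mulrA.
rewrite ge0_integralZl//; last 3 first.
- by apply/measurable_EFinP; exact: mpart.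
- by move=> t _; rewrite lee_fin divr_ge0// ltW.
- by rewrite lee_fin mulr_ge0// divr_ge0// ltW.
have <- : (\int[mu]_t (1 * (phi ((t - m) / a) / a))%:E = \int[mu]_t (phi ((t - m) / a) / a)%:E)%E.
  by apply: eq_integral => t _; rewrite mul1r.
rewrite -(@affine_phi (fun=> 1) a m a0)//; under eq_integral => t _ do rewrite mul1r.
by rewrite phi_integral mule1.
Qed.

End gauss_rotation.

Section standard_gauss.
Context {R : realType}.
Notation mu := lebesgue_measure.
Implicit Types (x : R).

Let gam : probability (measurableTypeR R) R := normal_prob (0 : R) 1.
Let idR (x : measurableTypeR R) : R := x.

Let c0 : @cvxR R (fun=> 0).
Proof. by move=> t x y _ _; rewrite !mulr0 addr0. Qed.

Let tilt0 x : tilt (fun=> 0) x = phi x.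
Proof. by rewrite /tilt oppr0 expR0 mulr1. Qed.

Let midR : measurable_fun [set: measurableTypeR R] idR.
Proof. exact: measurable_id. Qed.

Let lawid (B : set R) : measurable B -> (gam (idR @^-1` B) = \int[mu]_(x in B) (tilt (fun=> 0) x)%:E)%E.
Proof. by move=> mB; apply: eq_integral => x _; rewrite tilt0 phi_normal_pdf. Qed.

Lemma phi_moment_integrable k : mu.-integrable [set: R] (EFin \o (fun x : R => x ^+ k * phi x)).
Proof.
have mX : measurable_fun setT (fun x : R => x ^+ k) by exact: measurable_funX.
have := @density_integrable _ _ (measurableTypeR R) (measurableTypeR R) R gam mu idR (tilt (fun=> 0)) midR
  (measurable_tilt c0) (fun x => ltW (tilt_gt0 _ _)) lawid _ mX (law_moment midR c0 lawid k).
by apply: eq_integrable => // x _ /=; rewrite tilt0.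
Qed.

Let gamE k : (\int[gam]_x (idR x ^+ k) = \int[mu]_x (x ^+ k * phi x))%R.
Proof.
have mX : measurable_fun setT (fun x : R => x ^+ k) by exact: measurable_funX.
rewrite /Rintegral (@density_integral_signed _ _ (measurableTypeR R) (measurableTypeR R) R gam mu idR (tilt (fun=> 0)) midR
  (measurable_tilt c0) (fun x => ltW (tilt_gt0 _ _)) lawid _ mX).
by congr fine; apply: eq_integral => x _; rewrite tilt0.
Qed.

Lemma phi_mean : (\int[mu]_x ((x : R) * phi (x : R)))%R = 0 :> R.
Proof.
pose f (x : R) := x * phi x; have mf : measurable_fun setT f.
  by apply: measurable_funM => //; apply: continuous_measurable_fun; exact: phi_continuous.
have i1 : mu.-integrable [set: R] (EFin \o f) by have := phi_moment_integrable 1; apply: eq_integrable.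
have n1 : -1 != 0 :> R by rewrite oppr_eq0 oner_eq0.
have mp : measurable_fun setT (fun x => Num.max (f x) 0) by exact: measurable_maxr.
have p0 x : 0 <= Num.max (f x) 0 by rewrite le_max lexx orbT.
have := affine_integral 0 n1 mp p0; rewrite normrN1 invr1 mul1e => E.
rewrite /Rintegral integralE.
have -> : (\int[mu]_x ((fun x : R => (x * phi x)%:E)^\- x) = \int[mu]_x ((fun x : R => (x * phi x)%:E)^\+ x))%E.
  transitivity (\int[mu]_x (Num.max (f (-1 * x + 0)) 0)%:E)%E.
    by apply: eq_integral => x _; rewrite funenegE -EFinN -EFin_max addr0 mulN1r /f phiN mulNr.
  by rewrite E; apply: eq_integral => x _; rewrite funeposE -EFin_max.
by rewrite subee//; exact: (integrable_pos_fin_num measurableT i1).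
Qed.

(** The normal law compared with itself has zero gap, so its deficit is not positive by
    [tails_E_gt0], and it is nonnegative by [tails_d_ge0]. *)
Lemma phi_variance : (\int[mu]_x ((x : R) ^+ 2 * phi (x : R)))%R = 1 :> R.
Proof.
have f0 : (\int[gam]_x idR x)%R = 0.
  have := gamE 1; rewrite (_ : (\int[gam]_x (idR x ^+ 1) = \int[gam]_x idR x)%R) => [->|]; last by apply: eq_Rintegral => x _; rewrite expr1.
  by rewrite -[RHS]phi_mean; apply: eq_Rintegral => x _; rewrite expr1.
have tl := law_tails midR c0 lawid f0.
set Q := law_T gam idR; have dQ (x : R) : is_derive x 1 Q (- phi x) by have := tails_dT tl x; rewrite oppr0 expR0 mulr1.
have Qy := tails_Ty tl; have QNy := tails_TNy tl.
have d0 := tails_d_ge0 dQ Qy QNy tl; set D := 1 - _ in d0 tl.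
have : ~~ (0 < D).
  apply/negP => D0; have := @tails_E_gt0 _ _ dQ Qy QNy _ _ _ _ _ 0 tl D0.
  by rewrite (gauss_stop_loss midR lawid f0) subrr ltxx.
rewrite -leNgt => d0'; rewrite -(gamE 2); apply/esym/eqP; rewrite -subr_eq0; apply/eqP.
by apply/le_anti/andP; split.
Qed.

End standard_gauss.

(** * Normal laws on the line, degenerate ones included *)

Section normal_law.
Context {R : realType} d (T : measurableType d) (P : probability T R).
Notation mu := lebesgue_measure.
Implicit Types (f g : T -> R) (m s b c : R).

(** The law of s N + m, tested on nonnegative functions. The value s = 0 gives the Dirac mass at m,
    so degenerate directions fit the same predicate. *)
Definition normal_law f m s := 0 <= s /\
  forall F : R -> R, measurable_fun setT F -> (forall x, 0 <= F x) ->
  (\int[P]_t (F (f t))%:E = \int[mu]_x (F (s * x + m) * phi x)%:E)%E.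

Lemma normal_law_signed f m s (F : R -> R) : normal_law f m s -> measurable_fun setT F ->
  (\int[P]_t (F (f t))%:E = \int[mu]_x (F (s * x + m) * phi x)%:E)%E.
Proof.
move=> [_ H] mF; have phi0 x : 0 <= phi x :> R by exact: ltW (phi_gt0 x).
rewrite integralE [RHS]integralE; congr (_ - _)%E.
  have mp : measurable_fun setT (fun x => Num.max (F x) 0) by exact: measurable_maxr.
  transitivity (\int[P]_t (Num.max (F (f t)) 0)%:E)%E.
    by apply: eq_integral => t _; rewrite funeposE -EFin_max.
  rewrite (H _ mp) => [|x]; last by rewrite le_max lexx orbT.
  by apply: eq_integral => x _; rewrite funeposE -EFin_max maxr_pMl ?mul0r.
have mp : measurable_fun setT (fun x => Num.max (- F x) 0).
  by apply: measurable_maxr => //; exact: measurableT_comp.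
transitivity (\int[P]_t (Num.max (- F (f t)) 0)%:E)%E.
  by apply: eq_integral => t _; rewrite funenegE -EFinN -EFin_max.
rewrite (H _ mp) => [|x]; last by rewrite le_max lexx orbT.
by apply: eq_integral => x _; rewrite funenegE -EFinN -EFin_max maxr_pMl ?mul0r ?mulNr.
Qed.

Lemma normal_law_shift f m s b : normal_law f m s -> normal_law (fun t => f t + b) (m + b) s.
Proof.
move=> [s0 H]; split => // F mF F0.
rewrite (H (fun x => F (x + b))); first by apply: eq_integral => x _; rewrite addrA.
  by apply: measurableT_comp => //; exact: measurable_funD.
by move=> x; exact: F0.
Qed.

Lemma normal_law_cst m : normal_law (fun=> m) m 0.
Proof.
split => // F mF F0; have phi0 x : 0 <= phi x :> R by exact: ltW (phi_gt0 x).
rewrite integral_cst//= (@probability_setT _ T R P) mule1.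
under eq_integral => x _ do rewrite mul0r add0r EFinM.
rewrite ge0_integralZl ?phi_integral ?mule1//.
- by apply/measurable_EFinP; apply: continuous_measurable_fun; exact: phi_continuous.
- by move=> x _; rewrite lee_fin.
- by rewrite lee_fin.
Qed.

Lemma square_integrable f g : measurable_fun setT f -> measurable_fun setT g ->
  P.-integrable setT (EFin \o (fun t => f t ^+ 2)) -> P.-integrable setT (EFin \o (fun t => g t ^+ 2)) ->
  P.-integrable setT (EFin \o (fun t => f t * g t)).
Proof.
move=> mf mg if2 ig2; have := integrableD measurableT if2 ig2; apply: le_integrable => //.
  by apply/measurable_EFinP; exact: measurable_funM.
move=> t _ /=; rewrite lee_fin normrM [leRHS]ger0_norm ?addr_ge0 ?sqr_ge0//.
rewrite -(real_normK (num_real (f t))) -(real_normK (num_real (g t))).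
have := sqr_ge0 (`|f t| - `|g t|); have := sqr_ge0 (`|f t|); have := sqr_ge0 (`|g t|); lra.
Qed.

Let i1 c : P.-integrable setT (EFin \o (fun=> c : R)).
Proof. by have := finite_measure_integrable_cst P c measurableT. Qed.

Lemma square_integrable1 f : measurable_fun setT f ->
  P.-integrable setT (EFin \o (fun t => f t ^+ 2)) -> P.-integrable setT (EFin \o f).
Proof.
move=> mf if2; have i : P.-integrable setT (EFin \o (fun t => (fun=> 1 : R) t ^+ 2)).
  by have := i1 1; apply: eq_integrable => // t _ /=; rewrite expr1n.
have := square_integrable mf (@measurable_cst _ _ _ _ setT (1 : R)) if2 i.
by apply: eq_integrable => // t _ /=; rewrite mulr1.
Qed.

Let quad_integral m s : mu.-integrable [set: R] (EFin \o (fun x : R => (s * x + m) ^+ 2 * phi x)) /\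
  (\int[mu]_x ((s * (x : R) + m) ^+ 2 * phi x))%R = m ^+ 2 + s ^+ 2 /\
  (\int[mu]_x ((s * (x : R) + m) * phi x))%R = m.
Proof.
have I0 := @phi_moment_integrable R 0; have I1 := @phi_moment_integrable R 1; have I2 := @phi_moment_integrable R 2.
have iZ c k : mu.-integrable [set: R] (EFin \o (fun x : R => c * (x ^+ k * phi x))).
  by have := integrableZl measurableT c (@phi_moment_integrable R k); apply: eq_integrable.
have Z c k : (\int[mu]_x (c * ((x : R) ^+ k * phi x)) = c * \int[mu]_x ((x : R) ^+ k * phi x))%R.
  by rewrite RintegralZl//; exact: phi_moment_integrable.
have J0 : (\int[mu]_x ((x : R) ^+ 0 * phi x))%R = 1 :> R.
  rewrite /Rintegral; under eq_integral => x _ do rewrite expr0 mul1r.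
  by rewrite phi_integral.
have J1 : (\int[mu]_x ((x : R) ^+ 1 * phi x))%R = 0 :> R.
  by rewrite -[RHS]phi_mean; apply: eq_Rintegral => x _; rewrite expr1.
have iD : mu.-integrable [set: R] (EFin \o (fun x : R => s ^+ 2 * (x ^+ 2 * phi x) + 2 * s * m * (x ^+ 1 * phi x))).
  by have := integrableD measurableT (iZ (s ^+ 2) 2) (iZ (2 * s * m) 1); apply: eq_integrable.
have e (x : R) : (s * x + m) ^+ 2 * phi x = s ^+ 2 * (x ^+ 2 * phi x) + 2 * s * m * (x ^+ 1 * phi x) + m ^+ 2 * (x ^+ 0 * phi x).
  by rewrite expr1 expr0; ring.
have e' (x : R) : (s * x + m) * phi x = s * (x ^+ 1 * phi x) + m * (x ^+ 0 * phi x).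
  by rewrite expr1 expr0; ring.
split; [|split].
- by have := integrableD measurableT iD (iZ (m ^+ 2) 0); apply: eq_integrable => // x _ /=; rewrite e.
- under eq_Rintegral => x _ do rewrite e.
  rewrite RintegralD ?RintegralD// !Z J0 J1 (@phi_variance R); ring.
- under eq_Rintegral => x _ do rewrite e'.
  by rewrite RintegralD// !Z J0 J1; ring.
Qed.

Lemma normal_law_integrable f m s : measurable_fun setT f -> normal_law f m s ->
  P.-integrable setT (EFin \o (fun t => f t ^+ 2)).
Proof.
move=> mf N; have [/integrableP[_ iq] _] := quad_integral m s.
apply/integrableP; split; first by apply/measurable_EFinP; exact: measurable_funX.
under eq_integral => t _ do rewrite /= ger0_norm ?sqr_ge0//.
have -> := N.2 (fun x => x ^+ 2) _ (fun x => sqr_ge0 _); last by exact: measurable_funX.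
move: iq; congr (_ < _)%E; apply: eq_integral => x _ /=.
by rewrite ger0_norm// mulr_ge0 ?sqr_ge0// ltW// phi_gt0.
Qed.

Lemma normal_law_mean f m s : normal_law f m s -> (\int[P]_t f t)%R = m.
Proof.
move=> N; have [_ [_ <-]] := quad_integral m s.
by rewrite /Rintegral; congr fine; exact: (normal_law_signed (F := fun x : R => x) N).
Qed.

Lemma normal_law_square f m s : normal_law f m s -> (\int[P]_t (f t ^+ 2))%R = m ^+ 2 + s ^+ 2.
Proof.
move=> N; have [_ [<- _]] := quad_integral m s.
rewrite /Rintegral; congr fine; apply: (normal_law_signed (F := fun x : R => x ^+ 2) N).
exact: measurable_funX.
Qed.

Lemma normal_law_dirac f m : measurable_fun setT f -> normal_law f m 0 -> {ae P, forall t, f t = m}.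
Proof.
move=> mf N; pose F (x : R) := \1_([set~ m]) x : R.
have mS : measurable ([set~ m] : set R) by apply: measurableC; exact: measurable_set1.
have mA : measurable (f @^-1` [set~ m]) by rewrite -[X in measurable X]setTI; exact: mf.
exists (f @^-1` [set~ m]); split => //.
have mF : measurable_fun setT F by exact: measurable_indic.
have := N.2 F mF (fun x => ler0n _ _); rewrite /F.
rewrite [RHS](_ : _ = 0%E); last first.
  by rewrite -[RHS](@integral0 _ _ _ mu setT); apply: eq_integral => x _; rewrite mul0r add0r indicE memNset ?mul0r//= => /(_ erefl).
move=> <-; have := @integral_indic _ _ _ P setT measurableT _ mA; rewrite setIT => <-.
by apply: eq_integral => t _; rewrite !indicE.
Qed.

End normal_law.

(** * Splitting a Gaussian vector along one direction *)

Section random_shift.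
Context {R : realType} d (T : measurableType d) (P : probability T R) {n : nat}.
Notation mu := lebesgue_measure.
Variables (Y' : T -> 'rV[R]_n) (b : 'rV[R]_n).
Hypothesis mY' : measurable_fun setT Y'.

Let gam : probability (measurableTypeR R) R := normal_prob (0 : R) 1.
Definition shifted (z : T * measurableTypeR R) : 'rV[R]_n := Y' z.1 + (z.2 : R) *: b.

Lemma measurable_shifted : measurable_fun setT shifted.
Proof.
apply: measurable_coords => i; rewrite /shifted.
have -> : (fun z : T * measurableTypeR R => (Y' z.1 + (z.2 : R) *: b) ord0 i) = (fun z => (fun t => Y' t ord0 i) z.1 + (fun x : R => x * b ord0 i) z.2).
  by apply/funext => z; rewrite !mxE.
apply: measurable_funD.
  apply: (@measurableT_comp _ _ _ _ _ _ (fun t => Y' t ord0 i) _ fst); last exact: measurable_fst.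
  apply: (@measurableT_comp _ _ _ _ _ _ (fun y : 'rV[R]_n => y ord0 i) _ Y') => //.
  by apply: continuous_rV_measurable; exact: coord_continuous_rV.
apply: (@measurableT_comp _ _ _ _ _ _ (fun x : R => x * b ord0 i) _ snd); last exact: measurable_snd.
exact: measurable_funM.
Qed.

HB.instance Definition _ := isMeasurableFun.Build _ _ _ _ shifted measurable_shifted.

Let PG : probability (T * measurableTypeR R)%type R := (P \x gam)%E.

(** The law of Y' + N b with N standard normal and independent of Y', realised on a product space
    because Omega may carry no such N. *)
Definition shift_law : probability 'rV[R]_n R := distribution PG shifted.

Let gamE (F : R -> R) : measurable_fun setT F -> (forall x, 0 <= F x) ->
  (\int[gam]_x (F x)%:E = \int[mu]_x (F x * phi x)%:E)%E.
Proof.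
move=> mF F0; apply: (@density_integral _ _ (measurableTypeR R) (measurableTypeR R) R gam mu (fun x => x) phi) => //.
- by apply: continuous_measurable_fun; exact: phi_continuous.
- by move=> x; exact: ltW (phi_gt0 x).
- by move=> B mB; apply: eq_integral => x _; rewrite phi_normal_pdf.
Qed.

Let mF2 (F : 'rV[R]_n -> R) : measurable_fun setT F -> measurable_fun setT (fun z => (F (shifted z))%:E).
Proof. by move=> mF; apply/measurable_EFinP; apply: (measurableT_comp mF); exact: measurable_shifted. Qed.

Lemma measurable_shift_section (F : 'rV[R]_n -> R) t : measurable_fun setT F -> measurable_fun setT (fun x : R => F (Y' t + x *: b)).
Proof.
move=> mF; apply: (measurableT_comp mF); apply: measurable_coords => i.
rewrite (_ : (fun x : R => _) = (fun x : R => Y' t ord0 i + x * b ord0 i)); last by apply/funext => x; rewrite !mxE.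
by apply: measurable_funD => //; exact: measurable_funM.
Qed.

Lemma shift_lawE (F : 'rV[R]_n -> R) : measurable_fun setT F -> (forall y, 0 <= F y) ->
  (\int[shift_law]_y (F y)%:E = \int[P]_t \int[mu]_x (F (Y' t + x *: b) * phi x)%:E)%E.
Proof.
move=> mF F0; rewrite ge0_integral_distribution; [|exact/measurable_EFinP|by move=> y; rewrite lee_fin].
rewrite (@fubini_tonelli1 _ _ _ _ R P gam (fun z => (F (shifted z))%:E))//; last 2 first.
- exact: mF2.
- by move=> z; rewrite lee_fin.
apply: eq_integral => t _; rewrite /fubini_F/= /shifted/=.
by rewrite (@gamE (fun x => F (Y' t + x *: b)))//; exact: measurable_shift_section.
Qed.

Lemma shift_lawE' (F : 'rV[R]_n -> R) : measurable_fun setT F -> (forall y, 0 <= F y) ->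
  (\int[shift_law]_y (F y)%:E = \int[mu]_x ((phi x)%:E * \int[P]_t (F (Y' t + x *: b))%:E))%E.
Proof.
move=> mF F0; rewrite shift_lawE//.
pose G (z : T * measurableTypeR R) := F (shifted z) * phi z.2.
have mG : measurable_fun setT G.
  apply: measurable_funM; first by apply: (measurableT_comp mF); exact: measurable_shifted.
  apply: (@measurableT_comp _ _ _ _ _ _ phi _ snd); last exact: measurable_snd.
  by apply: continuous_measurable_fun; exact: phi_continuous.
have G0 z : (0 <= (G z)%:E)%E by rewrite lee_fin mulr_ge0// ltW// phi_gt0.
rewrite (@fubini_tonelli _ _ _ (measurableTypeR R) R P mu (fun z => (G z)%:E))//; last exact/measurable_EFinP.
apply: eq_integral => x _; rewrite /G/=.
under eq_integral => t _ do rewrite mulrC EFinM.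
rewrite ge0_integralZl//.
- by apply: (@measurableT_comp _ _ _ _ _ _ (fun z => (F (shifted z))%:E) _ (fun t => (t, x))); [exact: mF2|exact: pair2_measurable].
- by move=> t _; rewrite lee_fin.
- by rewrite lee_fin ltW// phi_gt0.
Qed.

End random_shift.

Section gauss_vector.
Context {R : realType} d (T : measurableType d) (P : probability T R) {n : nat}.
Notation mu := lebesgue_measure.
Implicit Types (Y : T -> 'rV[R]_n) (u v b y : 'rV[R]_n) (f g : T -> R) (m s c x z : R).
Local Notation EE g := (\int[P]_t g t)%R.
Local Notation L2 f := (P.-integrable setT (EFin \o (fun t => f t ^+ 2))).

Definition gauss_vec Y := measurable_fun setT Y /\
  forall u, exists m s, normal_law P (fun t => dot u (Y t)) m s.

Lemma measurable_dotY Y u : measurable_fun setT Y -> measurable_fun setT (fun t => dot u (Y t)).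
Proof. by move=> mY; apply: (@measurableT_comp _ _ _ _ _ _ (dot u) _ Y) => //; exact: measurable_dot. Qed.

Lemma row_of_linear_form (c : 'rV[R]_n -> R) : (forall a b, c (a + b) = c a + c b) -> (forall k a, c (k *: a) = k * c a) ->
  forall u, c u = dot u (\row_i c (delta_mx ord0 i)).
Proof.
move=> cD cZ u; have c0 : c 0 = 0 by have := cZ 0 0; rewrite scale0r mul0r.
rewrite {1}(row_sum_delta u) /dot (big_morph c cD c0); apply: eq_bigr => i _.
by rewrite cZ mxE.
Qed.

Let EED f g : P.-integrable setT (EFin \o f) -> P.-integrable setT (EFin \o g) ->
  EE (fun t => f t + g t) = EE f + EE g /\ P.-integrable setT (EFin \o (fun t => f t + g t)).
Proof.
move=> jf ig; split; first by rewrite RintegralD.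
by have := integrableD measurableT jf ig; apply: eq_integrable.
Qed.

Let EEZ c f : P.-integrable setT (EFin \o f) ->
  EE (fun t => c * f t) = c * EE f /\ P.-integrable setT (EFin \o (fun t => c * f t)).
Proof. by move=> jf; split; [rewrite RintegralZl|exact: integrableZ']. Qed.

Let i1 c : P.-integrable setT (EFin \o (fun=> c : R)).
Proof. by have := finite_measure_integrable_cst P c measurableT. Qed.

Let EE1 c : EE (fun=> c) = c.
Proof. by rewrite Rintegral_cst//= (@probability_setT _ T R P) mulr1. Qed.

(* The covariance of [f] and [N] enters through the second moment of [f - c N]. *)
Let quadratic f (N : T -> R) c : measurable_fun setT f -> measurable_fun setT N -> L2 f -> L2 N ->
  EE (fun t => (f t - c * N t) ^+ 2) = EE (fun t => f t ^+ 2) - 2 * c * EE (fun t => f t * N t) + c ^+ 2 * EE (fun t => N t ^+ 2).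
Proof.
move=> mf mN f2 N2; have fN := square_integrable mf mN f2 N2.
have [e1 j1] := EEZ (- (2 * c)) fN; have [e2 j2] := EEZ (c ^+ 2) N2.
have [e3 j3] := EED f2 j1; have [e4 _] := EED j3 j2.
rewrite (_ : EE (fun t => (f t - c * N t) ^+ 2) = EE (fun t => f t ^+ 2 + - (2 * c) * (f t * N t) + c ^+ 2 * N t ^+ 2)).
  by rewrite e4 e3 e1 e2; ring.
by apply: eq_Rintegral => t _; ring.
Qed.

(** Regression of Y on N = (v.Y - m) / s: b is the vector of covariances of Y with N, and Y' = Y - N
    b is the residual. Independence is not extracted from the marginals; instead the law of Y is
    identified with that of Y' plus an independent normal multiple of b. *)
Lemma gauss_split Y v m s : gauss_vec Y -> normal_law P (fun t => dot v (Y t)) m s -> 0 < s ->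
  exists b Y', [/\ gauss_vec Y', dot v b = s, forall t, dot v (Y' t) = m,
    forall u m', normal_law P (fun t => dot u (Y t)) m' 0 -> normal_law P (fun t => dot u (Y' t)) m' 0 &
    forall F : 'rV[R]_n -> R, measurable_fun setT F -> (forall y, 0 <= F y) ->
      (\int[P]_t (F (Y t))%:E = \int[P]_t \int[mu]_x (F (Y' t + x *: b) * phi x)%:E)%E /\
      (\int[P]_t (F (Y t))%:E = \int[mu]_x ((phi x)%:E * \int[P]_t (F (Y' t + x *: b))%:E))%E].
Proof.
move=> [mY GY] Nv s0; have sn0 : s != 0 by rewrite gt_eqF.
have mdY u := measurable_dotY u mY.
have D2 u : L2 (fun t => dot u (Y t)) by have [m' [s' N']] := GY u; exact: normal_law_integrable N'.
have D1 u := square_integrable1 (mdY u) (D2 u).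
pose N t := s^-1 * (dot v (Y t) - m).
have mN : measurable_fun setT N by apply: measurable_funM => //; exact: measurable_funB.
have [eS iS] := EED (D1 v) (i1 (- m)).
have iN : P.-integrable setT (EFin \o N) by exact: (EEZ s^-1 iS).2.
have EN : EE N = 0.
  by rewrite (EEZ s^-1 iS).1 eS EE1 (normal_law_mean Nv) subrr mulr0.
have vE t : dot v (Y t) = s * N t + m by rewrite /N mulrA mulfV// mul1r subrK.
have N2 : L2 N.
  have [_ j] := EED (D2 v) (EEZ (- (2 * m)) (D1 v)).2; have [_ j'] := EED j (i1 (m ^+ 2)).
  have := (EEZ (s^-1 ^+ 2) j').2; apply: eq_integrable => // t _ /=.
  by congr EFin; rewrite /N; ring.
have ivN u : P.-integrable setT (EFin \o (fun t => dot u (Y t) * N t)) by exact: square_integrable.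
have EN2 : EE (fun t => N t ^+ 2) = 1.
  have := normal_law_square Nv.
  have [e1 j1] := EEZ (s ^+ 2) N2; have [e2 j2] := EEZ (2 * s * m) iN.
  have [e3 j3] := EED j1 j2; have [e4 j4] := EED j3 (i1 (m ^+ 2)).
  rewrite (_ : EE (fun t => dot v (Y t) ^+ 2) = EE (fun t => s ^+ 2 * N t ^+ 2 + 2 * s * m * N t + m ^+ 2)).
    rewrite e4 e3 e1 e2 EN EE1 mulr0 addr0 addrC => /addrI H.
    by apply: (@mulfI _ (s ^+ 2)); rewrite ?sqrf_eq0// mulr1.
  by apply: eq_Rintegral => t _; rewrite vE; ring.
pose c u := EE (fun t => dot u (Y t) * N t).
have cD a1 a2 : c (a1 + a2) = c a1 + c a2.
  rewrite /c -(EED (ivN a1) (ivN a2)).1; apply: eq_Rintegral => t _.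
  by rewrite dotDl mulrDl.
have cZ k a : c (k *: a) = k * c a.
  rewrite /c -(EEZ k (ivN a)).1; apply: eq_Rintegral => t _.
  by rewrite dotZl mulrA.
pose b := \row_i c (delta_mx ord0 i); pose Y' t := Y t + (- N t) *: b.
have cE u : dot u b = c u by rewrite [RHS](row_of_linear_form cD cZ).
have cv : c v = s.
  have [e1 j1] := EEZ s N2; have [e2 j2] := EEZ m iN; have [e3 _] := EED j1 j2.
  transitivity (EE (fun t => s * N t ^+ 2 + m * N t)); last by rewrite e3 e1 e2 EN EN2; ring.
  by apply: eq_Rintegral => t _; rewrite vE; ring.
have dY' u t : dot u (Y' t) = dot u (Y t) - c u * N t by rewrite /Y' dotDr dotZr cE; ring.
have mY' : measurable_fun setT Y'.
  apply: measurable_coords => i; rewrite (_ : (fun t => _) = fun t => dot (delta_mx ord0 i) (Y t) - c (delta_mx ord0 i) * N t).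
    by apply: measurable_funB => //; exact: measurable_funM.
  by apply/funext => t; rewrite -dot_delta dY'.
(* Up to a constant, u.Y' is the linear form of Y along u - (c u / s) v, hence normal. *)
have GY' u : exists m' s', normal_law P (fun t => dot u (Y' t)) m' s'.
  have [m' [s' N']] := GY (u + (- (c u / s)) *: v).
  exists (m' + c u / s * m), s'; have := normal_law_shift (c u / s * m) N'.
  congr (normal_law P _ _ _); apply/funext => t; rewrite dY' dotDl dotZl vE.
  by field.
have M1 u : EE (fun t => dot u (Y' t)) = EE (fun t => dot u (Y t)).
  have [e1 j1] := EEZ (- c u) iN; have [e2 _] := EED (D1 u) j1.
  rewrite (_ : EE (fun t => dot u (Y' t)) = EE (fun t => dot u (Y t) + - c u * N t)); first by rewrite e2 e1 EN mulr0 addr0.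
  by apply: eq_Rintegral => t _; rewrite dY' mulNr.
have M2 u : EE (fun t => dot u (Y' t) ^+ 2) = EE (fun t => dot u (Y t) ^+ 2) - c u ^+ 2.
  rewrite (_ : EE (fun t => dot u (Y' t) ^+ 2) = EE (fun t => (dot u (Y t) - c u * N t) ^+ 2)).
    by rewrite (quadratic (c u) (mdY u) mN (D2 u) N2) EN2 -/(c u); ring.
  by apply: eq_Rintegral => t _; rewrite dY'.
exists b, Y'; split => //.
- by rewrite cE.
- by move=> t; rewrite dY' cv vE; ring.
(* By [M2] the variance of u.Y' is at most that of u.Y, which is 0 here. *)
- move=> u m' Nu; have [m1 [s1 N1]] := GY' u.
  have e1 := normal_law_mean N1; have e2 := normal_law_square N1.
  move: e1 e2; rewrite M1 M2 (normal_law_mean Nu) (normal_law_square Nu) => -> e.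
  have s10 : s1 = 0 by apply/eqP; rewrite -sqrf_eq0; have := sqr_ge0 s1; have := sqr_ge0 (c u); rewrite eq_le => *; apply/andP; split; lra.
  by rewrite -s10.
pose mfY : {RV P >-> 'rV[R]_n} := mfun_Sub (mem_set mY).
(* Along every u both laws are normal with equal means and, by [M2], equal variances, so cosines of
   linear forms cannot tell them apart. *)
have key A : measurable A -> distribution P mfY A = shift_law P b mY' A.
  apply: cosine_unique => u a.
  (* Adding 1 makes the integrand nonnegative, as the formulas for [normal_law] and [shift_law]
     demand. *)
  pose F z := 1 + cos (z + a) : R.
  have F0 z : 0 <= F z by have := cos_geN1 (z + a); rewrite /F; lra.
  have mF : measurable_fun setT F.
    apply: measurable_funD => //; apply: (measurableT_comp (continuous_measurable_fun (@continuous_cos R))).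
    exact: measurable_funD.
  have mFu w : measurable_fun setT (fun y : 'rV[R]_n => F (dot w y)) by exact: (measurableT_comp mF (measurable_dot w)).
  have red (S : probability 'rV[R]_n R) : (\int[S]_y cos (dot u y + a))%R = fine (\int[S]_y (F (dot u y))%:E) - 1.
    have ib : S.-integrable setT (EFin \o (fun y => cos (dot u y + a))).
      apply: measurable_bounded_integrable => //; first by rewrite /= (@probability_setT _ _ R S) ltry.
        by apply: measurable_dot_comp; exact: continuous_cos.
      exists 1; split; first exact: num_real.
      by move=> D CD y _; apply: le_trans (ltW CD); rewrite ler_norml cos_geN1 cos_le1.
    have -> : fine (\int[S]_y (F (dot u y))%:E) = (\int[S]_y (1 + cos (dot u y + a)))%R by [].
    rewrite RintegralD//; last by have := finite_measure_integrable_cst S (1 : R) measurableT.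
    by rewrite Rintegral_cst//= (@probability_setT _ _ R S) mulr1 addrAC subrr add0r.
  rewrite !red; congr (fine _ - 1).
  rewrite ge0_integral_distribution; [|by apply/measurable_EFinP; exact: mFu|by move=> y; rewrite lee_fin].
  rewrite (shift_lawE' P b mY' (mFu u))//.
  have [m1 [s1 N1]] := GY' u; have [m2 [s2 N2']] := GY u.
  have e1 := normal_law_mean N1; have e2 := normal_law_square N1.
  move: e1 e2; rewrite M1 M2 (normal_law_mean N2') (normal_law_square N2') => e1 e2; rewrite {}e1 in N2' e2.
  transitivity (\int[mu]_x (F (s2 * x + m1) * phi x)%:E)%E; first exact: N2'.2.
  pose G z := F (z + m1).
  have mG : measurable_fun setT G by apply: (measurableT_comp mF); exact: measurable_funD.
  have [s10 H1] := N1; have [s20 _] := N2'.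
  have -> : s2 = Num.sqrt (s1 ^+ 2 + c u ^+ 2).
    by rewrite (_ : _ + _ = s2 ^+ 2) ?sqrtr_sqr ?ger0_norm//; lra.
  rewrite -(gauss_rotation (c u) s10 mG (fun z => F0 _)).
  apply: eq_integral => x _; congr (_ * _)%E.
  pose H r := F (r + c u * x).
  transitivity (\int[mu]_z (H (s1 * z + m1) * phi z)%:E)%E.
    by apply: eq_integral => z _; rewrite /G /H; congr (F _ * _)%:E; ring.
  have mH : measurable_fun setT H by apply: (measurableT_comp mF); exact: measurable_funD.
  rewrite -(H1 H mH (fun r => F0 _)).
  by apply: eq_integral => t _; rewrite /H dotDr dotZr cE [x * _]mulrC.
move=> F mF F0; have E : (\int[P]_t (F (Y t))%:E = \int[shift_law P b mY']_y (F y)%:E)%E.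
  rewrite -(eq_measure_integral (shift_law P b mY') (fun A mA _ => key A mA)).
  by rewrite ge0_integral_distribution; [|exact/measurable_EFinP|move=> y; rewrite lee_fin].
by split; rewrite E; [rewrite (shift_lawE P b mY' mF F0)|rewrite (shift_lawE' P b mY' mF F0)].
Qed.

(** The list r contains the coordinates that may still be random. A random one is split off and
    integrated out, which replaces V by its Gaussian average, convex again, and Y by a residual
    constant in that coordinate while constant coordinates stay constant. When r is empty, Y is
    almost surely a point. *)
Lemma gauss_prekopa (r : seq 'I_n) Y V b : gauss_vec Y ->
  (forall i, i \notin r -> exists m, normal_law P (fun t => dot (delta_mx ord0 i) (Y t)) m 0) ->
  cvxV V -> exists2 U : R -> R, cvxR U &
  forall x, (\int[P]_t (expR (- V (Y t + x *: b)))%:E = (expR (- U x))%:E)%E.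
Proof.
elim: r Y V => [|i r IH] Y V GY degY cV.
  have mV := continuous_rV_measurable (cvxV_continuous cV).
  have /choice[y0 Hy] : forall i : 'I_n, exists m, normal_law P (fun t => dot (delta_mx ord0 i) (Y t)) m 0 by move=> i; exact: degY.
  pose y := \row_i y0 i; exists (fun x => V (y + x *: b)) => [|x]; first exact: cvxV_line.
  have ae : {ae P, forall t, Y t = y}.
    have H : {ae P, forall t, forall i, dot (delta_mx ord0 i) (Y t) = y0 i}.
      apply: filter_forall => i; apply: normal_law_dirac (Hy i); exact: measurable_dotY GY.1.
    by apply: filterS H => t H; apply/rowP => i; rewrite mxE -H dot_delta.
  transitivity (\int[P]_t (expR (- V (y + x *: b)))%:E)%E; last by rewrite integral_cst//= (@probability_setT _ T R P) mule1.
  apply: ge0_ae_eq_integral => //.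
  - apply/measurable_EFinP; apply: measurableT_comp => //; apply: measurableT_comp => //.
    apply: (measurableT_comp mV); apply: measurable_coords => j.
    rewrite (_ : (fun t => _) = fun t => dot (delta_mx ord0 j) (Y t) + x * b ord0 j).
      by apply: measurable_funD => //; exact: measurable_dotY GY.1.
    by apply/funext => t; rewrite !mxE dot_delta.
  - by apply: filterS ae => t -> _.
have [m [s N]] := GY.2 (delta_mx ord0 i).
have := N.1; rewrite le_eqVlt => /predU1P[s0|s0].
  apply: IH => // j jr; have [->|ji] := eqVneq j i; first by exists m; move: N; rewrite -s0.
  by apply: degY; rewrite inE negb_or ji.
have [b' [Y' [GY' _ Y'm deg law]]] := gauss_split GY N s0.
have [j jr|U cU HU] := IH Y' (gauss_average V b') GY' _ (gauss_average_cvx b' cV).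
  have [->|ji] := eqVneq j i.
    by exists m; rewrite (_ : (fun t => _) = (fun=> m)); [exact: normal_law_cst|apply/funext => t; rewrite Y'm].
  by have [|m' Nm] := degY j; [rewrite inE negb_or ji|exists m'; exact: deg].
exists U => // x; rewrite -HU.
have mV := continuous_rV_measurable (cvxV_continuous cV).
have mW : measurable_fun setT (fun y : 'rV[R]_n => expR (- V (y + x *: b))).
  apply: measurableT_comp => //; apply: measurableT_comp => //.
  apply: (measurableT_comp mV); apply: measurable_coords => j.
  rewrite (_ : (fun y : 'rV[R]_n => _) = fun y => dot (delta_mx ord0 j) y + x * b ord0 j).
    by apply: measurable_funD => //; exact: measurable_dot.
  by apply/funext => y; rewrite !mxE dot_delta.
have [-> _] := law _ mW (fun y => expR_ge0 _).
apply: eq_integral => t _; rewrite -(gauss_averageE _ _ cV).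
by apply: eq_integral => z _; rewrite /tilt mulrC addrAC.
Qed.

End gauss_vector.

(** * The laws of v.Y and v.X after normalisation *)

Section marginal_laws.
Context {R : realType} d (T : measurableType d) (P : probability T R) {n : nat}.
Notation mu := lebesgue_measure.
Implicit Types (u v b y : 'rV[R]_n) (m s c x z : R).

Lemma gaussian_law_vec (Y : {RV P >-> 'rV[R]_n}) : gaussian_law (distribution P Y) -> gauss_vec P Y.
Proof.
move=> G; split => // u; have [m [[s s0 H]|H]] := G u; last first.
  exists m, 0; split => // F mF F0.
  transitivity (\int[\d_m]_x (F x)%:E)%E.
    have mfY : measurable_fun setT (fun t => dot u (Y t)) by exact: measurable_dotY.
    rewrite -(@eq_measure_integral _ _ R setT (\d_m) (pushforward P (fun t => dot u (Y t)))) => [|A mA _]; last exact: H.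
    by rewrite ge0_integral_pushforward//; [exact/measurable_EFinP|move=> y _; rewrite lee_fin].
  rewrite integral_dirac//; last exact/measurable_EFinP.
  rewrite diracT mul1e; have := (normal_law_cst P m).2 F mF F0.
  by rewrite integral_cst//= (@probability_setT _ T R P) mule1.
exists m, s; split; first exact: ltW.
move=> F mF F0; have phi0 x : 0 <= phi x :> R by exact: ltW (phi_gt0 x).
have mphi : measurable_fun setT (@phi R) by apply: continuous_measurable_fun; exact: phi_continuous.
pose W x := phi ((x - m) / s) / s.
have mW : measurable_fun setT W.
  apply: measurable_funM => //; apply: (measurableT_comp mphi).
  by apply: measurable_funM => //; exact: measurable_funB.
have W0 x : 0 <= W x by rewrite /W divr_ge0// ltW.
have nW x : normal_pdf m s x = W x.
  have s1 : s != 0 by rewrite gt_eqF.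
  rewrite /normal_pdf (negbTE s1) /normal_peak /normal_fun /W /phi.
  have -> : s ^+ 2 * pi *+ 2 = s ^+ 2 * (2 * pi) by rewrite -mulr_natl; ring.
  rewrite sqrtrM ?sqr_ge0// sqrtr_sqr gtr0_norm// invfM.
  rewrite [RHS]mulrC mulrA; congr (_ * expR _); rewrite -mulr_natl; field.
  by rewrite s1.
have law (B : set R) : measurable B -> (P ((fun t => dot u (Y t)) @^-1` B) = \int[mu]_(x in B) (W x)%:E)%E.
  by move=> mB; transitivity (normal_prob m s B); [exact: H|apply: eq_integral => x _; rewrite nW].
rewrite (@density_integral _ _ T (measurableTypeR R) R P mu (fun t => dot u (Y t)) W _ mW W0 law F mF F0); last exact: measurable_dotY.
by rewrite (affine_phi m s0 mF F0).
Qed.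

Variables (Y X : {RV P >-> 'rV[R]_n}) (V : 'rV[R]_n -> R) (v : 'rV[R]_n) (Z m s : R).
Hypotheses (GY : gauss_vec P Y) (cV : cvxV V) (N : normal_law P (fun t => dot v (Y t)) m s) (s0 : 0 < s).
Hypothesis ZE : (\int[distribution P Y]_y (expR (- V y))%:E = Z%:E)%E.
Hypothesis lawX : forall B : set 'rV[R]_n, measurable B ->
  (distribution P X B = (Z^-1)%:E * \int[distribution P Y]_(x in B) (expR (- V x))%:E)%E.

Lemma gauss_marginal_law (B : set R) : measurable B ->
  (P ((fun t => s^-1 * (dot v (Y t) - m))%R @^-1` B) = \int[mu]_(x in B) (tilt (fun=> 0) x)%:E)%E.
Proof.
move=> mB; pose F z : R := \1_B (s^-1 * (z - m)).
have mF : measurable_fun setT F.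
  apply: (@measurableT_comp _ _ _ _ _ _ (\1_B : R -> R)); first exact: measurable_indic.
  by apply: measurable_funM => //; exact: measurable_funB.
have mf : measurable_fun setT (fun t => s^-1 * (dot v (Y t) - m)).
  by apply: measurable_funM => //; apply: measurable_funB => //; exact: measurable_dotY.
have mA : measurable ((fun t => s^-1 * (dot v (Y t) - m)) @^-1` B) by rewrite -[X in measurable X]setTI; exact: mf.
have := @integral_indic _ _ _ P setT measurableT _ mA; rewrite setIT => <-.
transitivity (\int[P]_t (F (dot v (Y t)))%:E)%E; first by apply: eq_integral => t _; rewrite /F !indicE.
have F0 z : 0 <= F z by rewrite /F indicE ler0n.
rewrite (N.2 F mF F0).
rewrite [RHS]integral_mkcond; apply: eq_integral => x _.
have e : s^-1 * (s * x + m - m) = x by rewrite addrK mulKf// gt_eqF.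
rewrite /F e patchE indicE /tilt oppr0 expR0 mulr1.
by case: ifP => _; rewrite ?mul1r ?mul0r.
Qed.

Let mV : measurable_fun setT (fun y => expR (- V y)).
Proof.
apply: measurableT_comp => //; apply: measurableT_comp => //.
by apply: continuous_rV_measurable; exact: cvxV_continuous.
Qed.

(** After splitting along v, the normalised form s^-1 (v.y - m) at y = Y' + x b is exactly x. So its
    density under X is phi x times the expectation of exp (- V (Y' + x b)) divided by Z, and
    [gauss_prekopa] makes the second factor log-concave. *)
Lemma tilted_marginal_law : exists2 U : R -> R, cvxR U & forall B : set R, measurable B ->
  (P ((fun t => s^-1 * (dot v (X t) - m))%R @^-1` B) = \int[mu]_(x in B) (tilt U x)%:E)%E.
Proof.
have [b [Y' [GY' vb Y'm _ law]]] := gauss_split GY N s0.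
have [|U cU HU] := gauss_prekopa (r := enum 'I_n) b GY' _ cV; first by move=> i; rewrite mem_enum.
have ZU : (\int[mu]_x (tilt U x)%:E = Z%:E)%E.
  rewrite -ZE ge0_integral_distribution; [|exact/measurable_EFinP|by move=> y; rewrite lee_fin expR_ge0].
  have [_] := law _ mV (fun y => expR_ge0 _); rewrite /comp => ->.
  by apply: eq_integral => x _; rewrite HU -EFinM.
have Z0 : 0 < Z by rewrite -lte_fin -ZU; exact: tilt_integral_gt0.
exists (fun x => U x + ln Z).
  by move=> t x y t0 t1; have := cU t x y t0 t1; lra.
move=> B mB; pose F y : R := \1_B (s^-1 * (dot v y - m)).
have mg : measurable_fun setT (fun y : 'rV[R]_n => s^-1 * (dot v y - m)).
  by apply: measurable_funM => //; apply: measurable_funB => //; exact: measurable_dot.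
have mA : measurable ((fun y : 'rV[R]_n => s^-1 * (dot v y - m)) @^-1` B) by rewrite -[X in measurable X]setTI; exact: mg.
have mF : measurable_fun setT (fun y => F y * expR (- V y)).
  apply: measurable_funM => //; apply: (@measurableT_comp _ _ _ _ _ _ (\1_B : R -> R)) => //; exact: measurable_indic.
have F0 y : 0 <= F y * expR (- V y) by rewrite mulr_ge0 ?expR_ge0// /F indicE ler0n.
have := lawX mA; rewrite -[LHS]/(P _) => ->.
have -> : (\int[distribution P Y]_(x in (fun y => s^-1 * (dot v y - m))%R @^-1` B) (expR (- V x))%:E =
    \int[P]_t (F (Y t) * expR (- V (Y t)))%:E)%E.
  rewrite -[RHS](@ge0_integral_distribution _ _ _ _ _ P Y (fun y => (F y * expR (- V y))%:E)); [|exact/measurable_EFinP|by move=> y; rewrite lee_fin].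
  rewrite integral_mkcond; apply: eq_integral => y _; rewrite patchE /F indicE.
  rewrite (_ : (y \in _) = (s^-1 * (dot v y - m) \in B)); last by apply/idP/idP => /set_mem H; exact: mem_set.
  by case: ifP => _; rewrite ?mul1r ?mul0r.
have [_ ->] := law _ mF F0.
have inner x : (\int[P]_t (F (Y' t + x *: b) * expR (- V (Y' t + x *: b)))%:E = (\1_B x * expR (- U x))%:E)%E.
  have FE t : F (Y' t + x *: b) = \1_B x.
    by rewrite /F dotDr dotZr Y'm vb; congr (\1_B _); field; rewrite gt_eqF.
  under eq_integral => t _ do rewrite FE indicE.
  rewrite indicE; case: (x \in B); rewrite /=.
    by under eq_integral => t _ do rewrite mul1r; rewrite HU mul1r.
  by under eq_integral => t _ do rewrite mul0r; rewrite integral0 mul0r.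
under eq_integral => x _ do rewrite inner -EFinM.
have mU : measurable_fun setT U by apply: continuous_measurable_fun; exact: cvxR_continuous.
rewrite -ge0_integralZl//; last 3 first.
- apply/measurable_EFinP; apply: measurable_funM; first by apply: continuous_measurable_fun; exact: phi_continuous.
  apply: measurable_funM; first exact: measurable_indic.
  by apply: measurableT_comp => //; exact: measurableT_comp.
- by move=> x _; rewrite lee_fin mulr_ge0// ?mulr_ge0 ?expR_ge0 ?indicE ?ler0n// ltW// phi_gt0.
- by rewrite lee_fin invr_ge0 ltW.
rewrite [RHS]integral_mkcond; apply: eq_integral => x _.
rewrite patchE indicE /tilt opprD expRD (expRN (ln Z)) lnK ?posrE// -EFinM.
by case: ifP => _; rewrite ?mul1r ?mul0r ?mulr0//; congr EFin; ring.
Qed.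

End marginal_laws.

Section recenter.
Context {R : realType} d (T : measurableType d) (P : probability T R).
Notation mu := lebesgue_measure.
Implicit Types (f : T -> R) (U : R -> R) (c x : R).

(** A translation of phi produces the factor exp (- c x - c^2 / 2), whose exponent is affine and
    leaves U convex. It is needed because X is normalised with the mean of Y, which need not be its
    own. *)
Lemma recentered_law f U c : measurable_fun setT f -> cvxR U ->
  (forall B : set R, measurable B -> (P (f @^-1` B) = \int[mu]_(x in B) (tilt U x)%:E)%E) ->
  exists2 U' : R -> R, cvxR U' & forall B : set R, measurable B ->
    (P ((fun t => f t - c)%R @^-1` B) = \int[mu]_(x in B) (tilt U' x)%:E)%E.
Proof.
move=> mf cU law; exists (fun x => U (x + c) + (c * x + c ^+ 2 / 2)).
  move=> t x y t0 t1; have := cU t (x + c) (y + c) t0 t1.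
  rewrite (_ : t * (x + c) + (1 - t) * (y + c) = t * x + (1 - t) * y + c); last ring.
  by lra.
move=> B mB; pose F x : R := \1_B (x - c).
have mF : measurable_fun setT F.
  apply: (@measurableT_comp _ _ _ _ _ _ (\1_B : R -> R)); first exact: measurable_indic.
  exact: measurable_funB.
have mA : measurable ((fun t => f t - c) @^-1` B).
  by rewrite -[X in measurable X]setTI; apply: measurable_funB.
have := @integral_indic _ _ _ P setT measurableT _ mA; rewrite setIT => <-.
transitivity (\int[P]_t (F (f t))%:E)%E; first by apply: eq_integral => t _; rewrite /F !indicE.
have F0 x : 0 <= F x by rewrite /F indicE ler0n.
rewrite (law_expectation mf cU law mF F0).
have mG : measurable_fun setT (fun x => F x * tilt U x) by apply: measurable_funM => //; exact: measurable_tilt.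
have G0 x : 0 <= F x * tilt U x by rewrite mulr_ge0// ltW// tilt_gt0.
have := affine_integral c (@oner_neq0 R) mG G0; rewrite normr1 invr1 mul1e => <-.
rewrite [RHS]integral_mkcond; apply: eq_integral => x _.
rewrite patchE /F mul1r addrK indicE; case: ifP => _; rewrite /= ?mul0r// mul1r.
by rewrite /tilt /phi -!mulrA -!expRD; congr (_ * expR _)%:E; field.
Qed.

End recenter.

(** * Reduction of the inequalities to dimension one *)

Theorem theorem1p1 (R : realType) (d : measure_display) (Omega : measurableType d)
    (P : probability Omega R) (n : nat) (X Y : {RV P >-> 'rV[R]_n})
    (V : 'rV[R]_n -> R) (v : 'rV[R]_n) :
  let nu := distribution P Y in
  let mu := distribution P X in
  let Z := (\int[nu]_x (expR (- V x))%:E)%E in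
  let vX := fun w : Omega => dot v (X w) in
  let vY := fun w : Omega => dot v (Y w) in
  let centered_vX := fun w : Omega => vX w - fine ('E_P[vX])%E in
  let centered_vY := fun w : Omega => vY w - fine ('E_P[vY])%E in
  let a := fine (variance P vY) in
  let varX := fine (variance P vX) in
  gaussian_law nu ->
  convex_function setT V ->
  (Z < +oo)%E ->
  (forall B : set 'rV[R]_n, measurable B ->
     mu B = ((fine Z)^-1)%:E * \int[nu]_(x in B) (expR (- V x))%:E)%E ->
  v != 0 ->
  0 < a ->
  forall psi : R -> R, convex_function (E := R^o) setT psi ->
  ('E_P[psi \o centered_vY] >= 'E_P[psi \o centered_vX])%E /\
  forall ddpsi : {measure set R -> \bar R},
    second_derivative_measure psi ddpsi ->
  [/\ ('E_P[psi \o centered_vY] >= 'E_P[psi \o centered_vX] +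
         (2^-1)%:E * \int[ddpsi]_x
           \int[lebesgue_measure]_(s in `]0%R, (a^-1 * (a - varX) ^+ 2)%R])
             (heat_kernel s (Num.sqrt (x ^+ 2 + a)))%:E)%E,
      0 <= a - varX
    & forall p q : R, 1 < p -> p^-1 + q^-1 = 1 ->
      ('E_P[psi \o centered_vY] <= 'E_P[psi \o centered_vX] +
         Cconst a ddpsi q * ((a - varX) `^ (2 * p)^-1)%:E)%E].
Proof.
move=> nu mu Z vX vY centered_vX centered_vY a varX Gnu cV Zoo lawX v0 a0 psi cpsi.
have GY := gaussian_law_vec Gnu; have cV' := convex_function_cvxV cV.
have [m [s N]] := GY.2 v.
have mvY : measurable_fun setT vY by exact: measurable_dotY.
have mvX : measurable_fun setT vX by exact: measurable_dotY.
have Em : (fine 'E_P[vY])%E = m by rewrite unlock; exact: (normal_law_mean N).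
have varE (f : Omega -> R) : fine (variance P f) = (\int[P]_t ((f t - fine ('E_P[f])%E) ^+ 2))%R.
  by rewrite /variance covariance.unlock expectation.unlock.
have aE : a = s ^+ 2.
  rewrite /a varE Em; have := normal_law_square (normal_law_shift (- m) N).
  by rewrite subrr expr0n/= add0r.
have s0 : 0 < s by rewrite lt_neqAle N.1 andbT; apply/eqP => E; move: a0; rewrite aE -E expr0n/= ltxx.
have sn0 : s != 0 by rewrite gt_eqF.
have ZE : (\int[distribution P Y]_y (expR (- V y))%:E = (fine Z)%:E)%E.
  by rewrite fineK// ge0_fin_numE// integral_ge0// => y _; rewrite lee_fin expR_ge0.
have [U1 cU1 law1] := tilted_marginal_law GY cV' N s0 ZE lawX.
(* Both variables are normalised with the mean and deviation of v.Y; subtracting c then centres the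
   one from X, so that the centred forms are s f and s g. *)
pose f1 t := s^-1 * (vX t - m); pose g t := s^-1 * (vY t - m).
have mf1 : measurable_fun setT f1 by apply: measurable_funM => //; exact: measurable_funB.
have mg : measurable_fun setT g by apply: measurable_funM => //; exact: measurable_funB.
pose c := (\int[P]_t f1 t)%R; pose f t := f1 t - c.
have [U cU lawf] := recentered_law c mf1 cU1 law1.
have mf : measurable_fun setT f by exact: measurable_funB.
have lawg := gauss_marginal_law N s0.
have i1 k : P.-integrable setT (EFin \o (fun=> k : R)) by have := finite_measure_integrable_cst P k measurableT.
have E1 k : (\int[P]_t (fun=> k) t)%R = k by rewrite Rintegral_cst//= (@probability_setT _ Omega R P) mulr1.
have if1 := law_integrable mf1 cU1 law1.
have f0 : (\int[P]_t f t)%R = 0 by rewrite (RintegralB measurableT if1 (i1 c)) E1 subrr.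
have vXE t : vX t = s * f1 t + m by rewrite /f1 mulrA mulfV// mul1r subrK.
have isf : P.-integrable setT (EFin \o (fun t => s * f1 t)) by exact: integrableZ'.
have EX : (fine 'E_P[vX])%E = s * c + m.
  rewrite unlock -[LHS]/(\int[P]_t vX t)%R.
  transitivity (\int[P]_t (s * f1 t + m))%R; first by apply: eq_Rintegral => t _.
  by rewrite (RintegralD measurableT isf (i1 m)) E1 RintegralZl.
have cXE t : centered_vX t = s * f t by rewrite /centered_vX EX vXE /f; ring.
have cYE t : centered_vY t = s * g t by rewrite /centered_vY Em /g mulrA mulfV// mul1r.
have g0 : (\int[P]_t g t)%R = 0.
  have N' := normal_law_mean (normal_law_shift (- m) N).
  have [m2 i2] : measurable_fun setT (fun t => vY t - m) /\ P.-integrable setT (EFin \o (fun t => vY t - m)).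
    have mm : measurable_fun setT (fun t => vY t - m) by exact: measurable_funB.
    by split => //; exact: square_integrable1 (normal_law_integrable mm (normal_law_shift (- m) N)).
  by rewrite RintegralZl// [X in _ * X]N' subrr mulr0.
pose delta := 1 - (\int[P]_t (f t ^+ 2))%R.
(* The variance difference in the statement is s^2 times the deficit of the normalised variable. *)
have dE : a - varX = s ^+ 2 * delta.
  have e : varX = s ^+ 2 * (\int[P]_t (f t ^+ 2))%R.
    rewrite /varX varE -RintegralZl//; last exact: (law_moment mf cU lawf 2).
    by apply: eq_Rintegral => t _; rewrite -exprMn -cXE.
  by rewrite aE e /delta; ring.
have EXE : ('E_P[psi \o centered_vX] = \int[P]_t (psi (s * f t))%:E)%E.
  by rewrite unlock; apply: eq_integral => t _ /=; rewrite cXE.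
have EYE : ('E_P[psi \o centered_vY] = \int[P]_t (psi (s * g t))%:E)%E.
  by rewrite unlock; apply: eq_integral => t _ /=; rewrite cYE.
have cp := convex_function_cvxR cpsi.
rewrite EXE EYE; split; first exact: (one_dim_domination mf mg cU lawf lawg f0 g0 s cp).
move=> ddpsi mpsi; rewrite dE aE; split.
- exact: (one_dim_lower mf mg cU lawf lawg f0 g0 s0 cp mpsi).
- by rewrite mulr_ge0 ?sqr_ge0//; exact: (variance_deficit_ge0 mf mg cU lawf lawg f0 g0).
- by move=> p q p1 pq; exact: (one_dim_upper mf mg cU lawf lawg f0 g0 s0 cp mpsi p1 pq).
Qed.
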